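(* Let $\mu$ be a radial real-valued Borel measure on the unit disk $\mathbb{D}$ such that its total variation $|\mu|$ is a Carleson measure for $A^2$. Suppose that the limit $L=\lim_{|z|\to 1}\tilde\mu(z)$ exists. Then $T_\mu$ is essentially positive on $A^2$ if and only if $L\ge 0$.
   Context: $\mathbb{D}$ is the open unit disk in $\mathbb{C}$ and $dA(z)=\frac{1}{\pi}\,dx\,dy$ is the normalized area measure. The Bergman space $A^2$ is the Hilbert space of analytic functions $f$ on $\mathbb{D}$ with $\int_{\mathbb{D}}|f|^2\,dA<\infty$, with the $L^2(dA)$ inner product; its reproducing kernel is $K_z(w)=(1-\bar z w)^{-2}$ and the normalized reproducing kernel is $k_z=K_z/\|K_z\|$. Measures are assumed to have finite total variation. A measure $\mu$ on $\mathbb{D}$ is radial if $\mu(E)=\mu(e^{i\theta}E)$ for all $\theta\in\mathbb{R}$ and all Borel sets $E\subset\mathbb{D}$. A positive Borel measure $\nu$ on $\mathbb{D}$ is a Carleson measure for $A^2$ if there is a constant $C$ with $\int_{\mathbb{D}}|P|^2\,d\nu\le C\int_{\mathbb{D}}|P|^2\,dA$ for all polynomials $P$. The Toeplitz operator $T_\mu$ is given on polynomials $g$ by $T_\mu(g)(z)=\int_{\mathbb{D}}\frac{g(w)\,d\mu(w)}{(1-\bar w z)^2}$, $z\in\mathbb{D}$; when $|\mu|$ is a Carleson measure for $A^2$, it extends (by density of the polynomials) to a bounded operator $T_\mu:A^2\to A^2$, which is self-adjoint if $\mu$ is real-valued. The Berezin transform of $\mu$ is $\tilde\mu(z)=\int_{\mathbb{D}}|k_z(w)|^2\,d\mu(w)$,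 $z\in\mathbb{D}$. A bounded operator $T$ on a Hilbert space $H$ is Fredholm if $\ker T$ and $H/T(H)$ are finite-dimensional; $\sigma_{\rm ess}(T)=\{\lambda\in\mathbb{C}:T-\lambda\text{ is not Fredholm}\}$. A bounded self-adjoint operator $T$ is essentially positive if $\sigma_{\rm ess}(T)\subset[0,\infty)$. *)

(* Defs.v *)
From HB Require Import structures.
From mathcomp Require Import all_boot all_order all_algebra.
From mathcomp Require Import all_classical all_reals all_analysis.
From mathcomp.analysis Require Import measurable_realfun.
From mathcomp Require Import ring lra.
From mathcomp.real_closed Require Import complex.

Set Implicit Arguments.
Unset Strict Implicit.
Unset Printing Implicit Defensive.

Import Order.TTheory GRing.Theory Num.Theory.
Import numFieldNormedType.Exports.
Import ComplexField Normc.

Local Open Scope classical_set_scope.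
Local Open Scope ring_scope.
Local Open Scope complex_scope.

Record disk (R : realType) := Disk { dval :> R[i]; _ : normc dval < 1 }.
Arguments Disk {R}.

HB.instance Definition _ (R : realType) := [isSub for @dval R].
HB.instance Definition _ (R : realType) := [Choice of disk R by <:].

Section disk_measurable.
Context {R : realType}.

Lemma normc0_lt1 : normc (0 : R[i]) < 1.
Proof. by rewrite normc0 ltr01. Qed.

HB.instance Definition _ := isPointed.Build (disk R) (Disk 0 normc0_lt1).

Definition xy (z : disk R) : R * R := (complex.Re z, complex.Im z).

(* The sigma-algebra induced by the product (that is, Borel) sigma-algebra of
   R * R through the identification of C with the plane. *)
HB.instance Definition _ :=
  Measurable.copy (disk R) (g_sigma_algebra_preimageType xy).

Lemma xy_inj : injective xy.
Proof.
move=> [[a b] p] [[c d] q] [/= ac bd]; subst c d.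
by congr Disk; exact: bool_irrelevance.
Qed.

Lemma measurable_xy : measurable_fun setT xy.
Proof. by move=> _ B mB; exists B. Qed.

Lemma range_xyE :
  range xy = [set p : R * R | p.1 ^+ 2 + p.2 ^+ 2 < 1].
Proof.
have sqE (a b : R) : (normc (a +i* b) < 1) = (a ^+ 2 + b ^+ 2 < 1).
  rewrite /= -{1}(sqrtr1 R) ltr_sqrt //.
rewrite eqEsubset; split => [p [[[a b] z1] _ <-]|[a b] /=].
  by rewrite /= -sqE.
by rewrite -sqE => ab; exists (Disk _ ab).
Qed.

Lemma measurable_range_xy : measurable (range xy).
Proof.
rewrite range_xyE.
have mf : measurable_fun setT (fun p : R * R => p.1 ^+ 2 + p.2 ^+ 2).
  by apply: measurable_funD; apply: measurable_funX.
rewrite (_ : [set _ | _] =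
  setT `&` (fun p : R * R => p.1 ^+ 2 + p.2 ^+ 2) @^-1` `]-oo, 1[).
  by apply: mf => //; exact: measurable_itv.
by rewrite setTI; apply/seteqP; split => p; rewrite /preimage /= in_itv.
Qed.

Lemma measurable_xy_image (E : set (disk R)) :
  measurable E -> measurable (xy @` E).
Proof.
move=> [B mB <-].
rewrite (_ : xy @` _ = B `&` range xy); first exact: measurableI measurable_range_xy.
rewrite eqEsubset; split => [_ [z [_ Bz] <-]|p [Bp [z _ zp]]].
  by split => //; exists z.
by exists z => //; split => //=; rewrite /preimage /= zp.
Qed.


Local Notation lebesgue2 :=
  (@lebesgue_measure R \x @lebesgue_measure R)%E.

Definition dA (E : set (disk R)) : \bar R :=
  ((pi^-1)%:E * lebesgue2 (xy @` E))%E.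

Let dA0 : dA set0 = 0%E.
Proof. by rewrite /dA image_set0 measure0 mule0. Qed.

Let dA_ge0 E : (0 <= dA E)%E.
Proof. by rewrite /dA mule_ge0 // lee_fin invr_ge0 pi_ge0. Qed.

Let dA_sigma_additive : semi_sigma_additive dA.
Proof.
move=> F mF tF mUF; rewrite /dA.
rewrite (_ : (fun n => _) = (fun n => (pi^-1)%:E *
    \sum_(0 <= i < n) lebesgue2 (xy @` F i))%E); last first.
  by apply/funext => n; rewrite ge0_sume_distrr.
apply: cvgeZl => //.
rewrite image_bigcup.
apply: (@measure_semi_sigma_additive _ _ _ lebesgue2 (fun i => xy @` F i)).
- by move=> i; exact: measurable_xy_image.
- move=> i j _ _ [_ [[z Fz <-] [w Fw /xy_inj wz]]].
  by subst w; apply: (tF i j) => //; exists z.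
- by rewrite -image_bigcup; exact: measurable_xy_image.
Qed.

HB.instance Definition _ := isMeasure.Build _ _ _ dA
  dA0 dA_ge0 dA_sigma_additive.

Lemma dA_setT_fin : (dA setT < +oo)%E.
Proof.
pose I := `[-1, 1]%classic : set R.
apply: (@le_lt_trans _ _ ((pi^-1)%:E * lebesgue2 (I `*` I))%E).
  apply: lee_wpmul2l; first by rewrite lee_fin invr_ge0 pi_ge0.
  apply: le_measure.
  - by rewrite inE; exact: measurable_range_xy.
  - by rewrite inE; apply: measurableX; exact: measurable_itv.
  - have sq1 (a b : R) : a ^+ 2 + b ^+ 2 < 1 -> -1 <= a <= 1.
      move=> ab; rewrite -ler_norml -(@expr_le1 _ 2) // real_normK ?num_real //.
      by apply: ltW; apply: le_lt_trans ab; rewrite lerDl sqr_ge0.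
    rewrite range_xyE => -[a b] /= ab; rewrite /I; split => /=; rewrite in_itv /=.
      exact: sq1 ab.
    by apply: (sq1 _ a); rewrite addrC.
rewrite product_measure1E; [|exact: measurable_itv..].
have I2 : (lebesgue_measure I < +oo)%E.
  by rewrite /I lebesgue_measure_itv /=; case: ifP => _; rewrite -?EFinB ltry.
apply: lte_mul_pinfty; [by rewrite lee_fin invr_ge0 pi_ge0|by []|].
by apply: lte_mul_pinfty; rewrite ?ge0_fin_numE.
Qed.

End disk_measurable.

Section bergman.
Context {R : realType}.
Local Notation C := R[i].
Implicit Types f g : disk R -> C.

Definition analytic f := forall z : disk R,
  exists2 r : R, 0 < r & exists a : nat -> C, forall w : disk R,
    normc (dval w - dval z) < r ->
    series (fun k => a k * (dval w - dval z) ^+ k : C^o) @ \oo --> (f w : C^o).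

Definition cmeasurable f :=
  measurable_fun setT (fun z => complex.Re (f z)) /\
  measurable_fun setT (fun z => complex.Im (f z)).

(* Measurability is automatic for analytic functions; it is part of the
   definition of L^2(dA). *)
Definition square_integrable f :=
  cmeasurable f /\ (\int[dA]_z (normc (f z) ^+ 2)%:E < +oo)%E.

Definition bergman_pred : {pred disk R -> C} :=
  [pred f | `[< analytic f /\ square_integrable f >]].

Lemma sqr_normcE (x : C) : normc x ^+ 2 = complex.Re x ^+ 2 + complex.Im x ^+ 2.
Proof. by case: x => a b /=; rewrite sqr_sqrtr // addr_ge0 ?sqr_ge0. Qed.

Lemma normc_ge0 (x : C) : 0 <= normc x.
Proof. by case: x => a b; exact: sqrtr_ge0. Qed.

Lemma measurable_sqr_normc f : cmeasurable f ->
  measurable_fun setT (fun z => normc (f z) ^+ 2).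
Proof.
move=> [mr mi]; under eq_fun do rewrite sqr_normcE.
by apply: measurable_funD; apply: measurable_funX.
Qed.

Lemma cmeasurableM f g : cmeasurable f -> cmeasurable g ->
  cmeasurable (fun z => f z * g z).
Proof.
move=> [fr fi] [gr gi]; split.
  rewrite (_ : (fun z => _) = (fun z => complex.Re (f z) * complex.Re (g z)) \-
    (fun z => complex.Im (f z) * complex.Im (g z))); last first.
    by apply/funext => z /=; case: (f z) => ? ?; case: (g z) => ? ?.
  by apply: measurable_funB; apply: measurable_funM.
rewrite (_ : (fun z => _) = (fun z => complex.Re (f z) * complex.Im (g z)) \+
  (fun z => complex.Im (f z) * complex.Re (g z))); last first.
  by apply/funext => z /=; case: (f z) => ? ?; case: (g z) => ? ?.
by apply: measurable_funD; apply: measurable_funM.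
Qed.

Lemma cmeasurableD f g : cmeasurable f -> cmeasurable g ->
  cmeasurable (fun z => f z + g z).
Proof.
move=> [fr fi] [gr gi]; split.
  rewrite (_ : (fun z => _) = (fun z => complex.Re (f z)) \+
    (fun z => complex.Re (g z))); last first.
    by apply/funext => z /=; case: (f z) => ? ?; case: (g z) => ? ?.
  exact: measurable_funD.
rewrite (_ : (fun z => _) = (fun z => complex.Im (f z)) \+
  (fun z => complex.Im (g z))); last first.
  by apply/funext => z /=; case: (f z) => ? ?; case: (g z) => ? ?.
exact: measurable_funD.
Qed.

Lemma cmeasurable_cst (c : C) : cmeasurable (fun=> c).
Proof. by split; exact: measurable_cst. Qed.

Lemma cmeasurable_dval : cmeasurable (@dval R).
Proof.
split; [rewrite (_ : (fun z => _) = fst \o xy) //|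
        rewrite (_ : (fun z => _) = snd \o xy) //];
apply: measurableT_comp measurable_xy => //.
Qed.

Lemma normcD_sqr (x y : C) :
  normc (x + y) ^+ 2 <= 2 * normc x ^+ 2 + 2 * normc y ^+ 2.
Proof.
rewrite !sqr_normcE; case: x y => [a b] [c d] /=.
rewrite -subr_ge0 (_ : _ - _ = (a - c) ^+ 2 + (b - d) ^+ 2).
  by rewrite addr_ge0 ?sqr_ge0.
by rewrite !sqrrB !sqrrD !mulr2n !mulrDl !mul1r; ring.
Qed.

Lemma bergman_submod_closed : submod_closed bergman_pred.
Proof.
split=> [|c f g].
  apply/asboolP; split.
    move=> z; exists 1 => //; exists (fun=> 0) => w _.
    rewrite (_ : series _ = fun=> 0); first exact: cvg_cst.
    by apply/funext => n; rewrite /series /= big1 // => k _; rewrite mul0r.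
  split; first exact: cmeasurable_cst.
  rewrite (eq_integral (cst 0%E)) ?integral_cst ?mul0e // => z _.
  by rewrite [X in X%:E](_ : _ = 0) // (normc0 R : normc (0 : C) = 0) expr0n.
move=> /asboolP[af [mf f2]] /asboolP[ag [mg g2]]; apply/asboolP; split.
  move=> z; have [r r0 [a ha]] := af z; have [s s0 [b hb]] := ag z.
  exists (Num.min r s); first by rewrite lt_min r0.
  exists (fun k => c * a k + b k) => w; rewrite lt_min => /andP[wr ws].
  rewrite (_ : series _ = (fun n => c *: (series (fun k => a k * (dval w - dval z) ^+ k : C^o) n) +
    series (fun k => b k * (dval w - dval z) ^+ k : C^o) n)).
    by apply: cvgD; [apply: cvgZr; exact: ha|exact: hb].
  apply/funext => n; rewrite /series /= scaler_sumr -big_split /=.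
  by apply: eq_bigr => k _; rewrite mulrDl -mulrA.
have mcf : cmeasurable (fun z => c * f z).
  by apply: cmeasurableM => //; exact: cmeasurable_cst.
split; first exact: cmeasurableD.
have mE h : cmeasurable h -> measurable_fun setT (fun z => (normc (h z) ^+ 2)%:E).
  by move=> mh; apply/measurable_EFinP; exact: measurable_sqr_normc.
apply: (@le_lt_trans _ _ (\int[dA]_z ((2 * normc c ^+ 2)%:E * (normc (f z) ^+ 2)%:E +
    2%:E * (normc (g z) ^+ 2)%:E))%E).
  apply: ge0_le_integral => //=.
  - by move=> z _; rewrite lee_fin sqr_ge0.
  - by apply: mE; exact: cmeasurableD.
  - by apply: emeasurable_funD; apply: measurable_funeM; exact: mE.
  - move=> z _; rewrite -!EFinM -EFinD lee_fin.
    rewrite -mulrA -exprMn -normcM; exact: normcD_sqr.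
have sq0 h : forall z : disk R, [set: disk R] z -> (0 <= (normc (h z) ^+ 2)%:E)%E.
  by move=> z _; rewrite lee_fin sqr_ge0.
have k0 : (0 <= (2 * normc c ^+ 2)%:E)%E by rewrite lee_fin mulr_ge0 ?sqr_ge0.
rewrite ge0_integralD //=; first last.
- by apply: measurable_funeM; exact: mE.
- by move=> z _; rewrite mule_ge0 // lee_fin sqr_ge0.
- by apply: measurable_funeM; exact: mE.
- by move=> z _; rewrite mule_ge0 // lee_fin sqr_ge0.
rewrite !ge0_integralZl //=;
  do ?[exact: mE|by move=> z _; rewrite lee_fin sqr_ge0].
by apply: lte_add_pinfty; apply: lte_mul_pinfty.
Qed.

HB.instance Definition _ := GRing.isSubmodClosed.Build C (disk R -> C)
  bergman_pred bergman_submod_closed.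

End bergman.

Record bergman (R : realType) :=
  Bergman { bfun :> disk R -> R[i]; _ : bfun \in bergman_pred }.
Arguments Bergman {R}.

HB.instance Definition _ (R : realType) := [isSub for @bfun R].
HB.instance Definition _ (R : realType) := [Choice of bergman R by <:].
HB.instance Definition _ (R : realType) :=
  [SubChoice_isSubLmodule of bergman R by <:].

Section polynomials.
Context {R : realType}.
Implicit Types p : {poly R[i]}.

Lemma cmeasurable_poly p : cmeasurable (fun z : disk R => p.[dval z]).
Proof.
elim/poly_ind: p => [|p c ih].
  by under eq_fun do rewrite horner0; exact: cmeasurable_cst.
under eq_fun do rewrite hornerMXaddC.
apply: cmeasurableD; last exact: cmeasurable_cst.
by apply: cmeasurableM => //; exact: cmeasurable_dval.
Qed.

Lemma poly_bounded p : exists M : R, forall z : disk R,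
  normc p.[dval z] ^+ 2 <= M.
Proof.
elim/poly_ind: p => [|p c [M hM]].
  by exists 0 => z; rewrite horner0 normc0 expr0n.
exists (2 * M + 2 * normc c ^+ 2) => z.
rewrite hornerMXaddC; apply: (le_trans (normcD_sqr _ _)).
rewrite lerD2r ler_pM2l // normcM exprMn.
apply: le_trans (hM z); rewrite ler_piMr ?sqr_ge0 //.
by case: z => x x1; rewrite expr_le1 ?normc_ge0 // ltW.
Qed.

Lemma analytic_poly p : analytic (fun z : disk R => p.[dval z]).
Proof.
move=> z; exists 1 => //; pose q := p \Po ('X + (dval z)%:P).
exists (fun k => q`_k) => w _.
have pq : p.[dval w] = q.[dval w - dval z].
  by rewrite horner_comp !hornerE subrK.
apply: cvg_near_cst; exists (size q) => // n /= qn.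
by rewrite pq (horner_coef_wide _ qn) /series /= big_mkord.
Qed.

Lemma poly_bergman p : (fun z : disk R => p.[dval z]) \in bergman_pred.
Proof.
apply/asboolP; split; first exact: analytic_poly.
split; first exact: cmeasurable_poly.
have [M hM] := poly_bounded p.
apply: (@le_lt_trans _ _ (\int[@dA R]_z (cst M%:E z))%E).
  apply: ge0_le_integral => //=.
  - by move=> z _; rewrite lee_fin sqr_ge0.
  - by apply/measurable_EFinP/measurable_sqr_normc; exact: cmeasurable_poly.
  - by move=> z _; rewrite lee_fin hM.
have M0 : 0 <= M by apply: le_trans (hM point); exact: sqr_ge0.
rewrite integral_cst //; apply: lte_mul_pinfty => //; exact: dA_setT_fin.
Qed.

Definition bergman_poly p : bergman R := Bergman _ (poly_bergman p).

End polynomials.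

Section bergman_operators.
Context {R : realType}.
Local Notation C := R[i].

Definition cintegral (m : {measure set (disk R) -> \bar R})
    (f : disk R -> C) : C :=
  (\int[m]_z complex.Re (f z)) +i* (\int[m]_z complex.Im (f z)).

Definition bergman_dot (f g : bergman R) : C := cintegral dA (fun z => f z * (g z)^*).

Definition L2norm (f : disk R -> C) : R :=
  Num.sqrt (\int[dA]_z normc (f z) ^+ 2).

Definition bounded_op (T : bergman R -> bergman R) :=
  exists M : R, forall f, L2norm (T f) <= M * L2norm f.

Definition selfadjoint (T : bergman R -> bergman R) :=
  forall f g, bergman_dot (T f) g = bergman_dot f (T g).

End bergman_operators.

Section fredholm.
Context {K : fieldType} {V : lmodType K}.

Definition lin_span (s : seq V) : set V :=
  [set v | exists c : 'I_(size s) -> K, v = \sum_i c i *: s`_i].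

(* Meant for linear subspaces S. *)
Definition finite_dim (S : set V) := exists s, S `<=` lin_span s.

(* The classes of finitely many vectors span V / S. *)
Definition finite_codim (S : set V) :=
  exists s : seq V, forall v : V, exists2 u, S u & lin_span s (v - u).

Definition fredholm (T : {linear V -> V}) :=
  finite_dim [set v | T v = 0] /\ finite_codim (range T).

Definition ess_spectrum (T : {linear V -> V}) : set K :=
  [set l | ~ fredholm (T \- l \*: idfun)].

End fredholm.

(* In the order of R[i], 0 <= l means that l is real and nonnegative. *)
Definition essentially_positive (R : realType)
    (T : {linear bergman R -> bergman R}) :=
  [/\ bounded_op T, selfadjoint T & ess_spectrum T `<=` [set l | 0 <= l]].

(* A charge takes finite values, so charge (disk R) R is the type of real Borel
   measures of finite total variation on the disk. *)
Section measures.
Context {R : realType}.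
Local Notation C := R[i].
Implicit Type mu : charge (disk R) R.

Definition rotate (t : R) (E : set (disk R)) : set (disk R) :=
  [set w | exists2 z, E z & dval w = (cos t +i* sin t) * dval z].

Definition radial mu :=
  forall (t : R) (E : set (disk R)), measurable E -> mu E = mu (rotate t E).

Definition carleson (nu : {measure set (disk R) -> \bar R}) :=
  exists M : R, forall p : {poly C},
    (\int[nu]_z (normc p.[dval z] ^+ 2)%:E <=
     M%:E * \int[dA]_z (normc p.[dval z] ^+ 2)%:E)%E.

(* The Jordan decomposition does not depend on the Hahn decomposition chosen
   here. *)
Lemma hahn_ex mu : {PN | hahn_decomposition mu PN.1 PN.2}.
Proof.
by apply: cid; have [P [N h]] := Hahn_decomposition mu; exists (P, N).
Qed.

Definition pos_part mu : {measure set (disk R) -> \bar R} :=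
  jordan_pos (svalP (hahn_ex mu)).

Definition neg_part mu : {measure set (disk R) -> \bar R} :=
  jordan_neg (svalP (hahn_ex mu)).

Definition total_variation_measure mu : {measure set (disk R) -> \bar R} :=
  charge_variation (svalP (hahn_ex mu)).

Definition charge_integral mu (f : disk R -> R) : R :=
  \int[pos_part mu]_z f z - \int[neg_part mu]_z f z.

Definition charge_cintegral mu (f : disk R -> C) : C :=
  charge_integral mu (fun z => complex.Re (f z)) +i*
  charge_integral mu (fun z => complex.Im (f z)).

Definition toeplitz_extension mu (T : {linear bergman R -> bergman R}) :=
  bounded_op T /\
  forall (p : {poly C}) (z : disk R),
    T (bergman_poly p) z =
    charge_cintegral mu
      (fun w => p.[dval w] / (1 - (dval w)^* * dval z) ^+ 2).

(* The bounded extension is unique, and exists when the total variation of mu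
   is a Carleson measure; when there is none, the value 0 is irrelevant. *)
Definition toeplitz mu : {linear bergman R -> bergman R} :=
  if pselect (exists T, toeplitz_extension mu T) is left exT then sval (cid exT)
  else \0.

Definition bergman_kernel (z w : disk R) : C := (1 - (dval z)^* * dval w) ^- 2.

Definition normalized_kernel (z w : disk R) : C :=
  bergman_kernel z w / (L2norm (bergman_kernel z))%:C.

Definition berezin mu (z : disk R) : R :=
  charge_integral mu (fun w => normc (normalized_kernel z w) ^+ 2).

(* The filter of |z| -> 1 in the disk. *)
Definition near_circle : set_system (disk R) :=
  filter_from [set r : R | r < 1] (fun r => [set z | r < normc (dval z)]).

Global Instance near_circle_filter : ProperFilter near_circle.
Proof.
apply: filter_from_proper; last first.
  move=> r /= r1; pose s := Num.max 0 ((r + 1) / 2).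
  have s01 : 0 <= s < 1 by rewrite /s le_max lexx gt_max ltr01 /=; lra.
  have ns : normc (s +i* 0) = s.
    by rewrite /= expr0n /= addr0 sqrtr_sqr ger0_norm //; case/andP: s01.
  have s1 : normc (s +i* 0) < 1 by rewrite ns; case/andP: s01.
  exists (Disk _ s1); change (r < normc (s +i* 0)); rewrite ns /s lt_max.
  by apply/orP; right; lra.
apply: filter_from_filter; first by exists 0 => /=.
move=> r s /= r1 s1; exists (Num.max r s); first by rewrite /= gt_max r1.
by move=> z /=; rewrite gt_max => /andP.
Qed.

End measures.

(* Main.v *)
Require Import Defs.
From HB Require Import structures.
From mathcomp Require Import all_boot all_order all_algebra.
From mathcomp Require Import all_classical all_reals all_analysis.
From mathcomp.analysis Require Import measurable_realfun.
From mathcomp Require Import ring lra.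
From mathcomp.real_closed Require Import complex.

Set Implicit Arguments.
Unset Strict Implicit.
Unset Printing Implicit Defensive.

Import Order.TTheory GRing.Theory Num.Theory.
Import numFieldNormedType.Exports.
Import ComplexField Normc.

Local Open Scope classical_set_scope.
Local Open Scope ring_scope.
Local Open Scope complex_scope.

(** Let mu be radial, m_n its moment against |w|^(2n), and lam_n = (n+1) m_n. By
    orthogonality of the powers of w under rotation-invariant integrals, the
    Toeplitz operator multiplies the n-th Taylor coefficient by lam_n
    ([toeplitz_diagonal]), and with x = |z|^2 the Berezin transform at z is
    (1-x)^2 sum (n+1) lam_n x^n, up to the total mass c of the area measure
    ([berezinE], [rf_kernel]): an Abel-type mean of the eigenvalues.

    Convergence of means says nothing about a general bounded sequence. Here the
    Carleson condition, tested on monomials, gives moments of order 1/n for |mu|;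
    they form a decreasing convex sequence, hence their increments are of order
    1/n^2 and those of lam_n are of order 1/n ([toeplitz_eigenvalue_slow]). The
    Tauberian theorem [abel_tauberian] then gives lam_n -> cL. It is proved with
    Karamata's idea: taking x among the powers of r, where r^N = 1/2, produces
    means with polynomial weights in r^n. The weights y (4y(1-y))^k with y = r^n
    concentrate near n = N as k grows, and slow oscillation turns the mean into
    lam_N.

    It follows that the essential spectrum of T is {cL}. If l differs from cL then
    T - l is diagonal with entries bounded away from 0, up to finitely many, and
    [fredholm_diagonal] applies. On the other hand T - cL has entries tending to 0,
    so its range has infinite codimension ([not_fredholm_diagonal]). Self-adjointness
    and boundedness are read off the real bounded diagonal.

    This takes place in coefficient space, so the Bergman space, defined by local
    expansions and area integrals, has to be identified with a weighted l^2 space.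
    A function with local expansions is the sum of one power series on the disk
    ([analytic_expands]): the radius of the expansion at 0 is enlarged step by step
    using a uniform local radius and Cauchy's estimate, itself a consequence of
    orthogonality. Parseval's identity ([bsum_cvg]) and its converse ([coef_surj])
    follow from orthogonality on smaller discs. The invariance of area under
    rotations, written as products of shears, is proved in [leb2_rot], and its
    behaviour under dilations determines the moments of the area measure
    ([area_moment]). *)

(** * Null sequences and the complex modulus *)

Section real_null_sequences.
Context {R : realType}.
Implicit Types v : nat -> R.

Lemma cvg0_bound v e : v @ \oo --> (0 : R) -> 0 < e ->
  exists N, forall n, (N <= n)%N -> `|v n| < e.
Proof.
move=> v0 e0; have [N _ hN] := cvgr0_norm_lt _ v0 _ e0.
by exists N => n Nn; exact: hN.
Qed.

Lemma cvg0_of_bound v :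
  (forall e, 0 < e -> exists N, forall n, (N <= n)%N -> `|v n| <= e) ->
  v @ \oo --> (0 : R).
Proof.
move=> h; apply/cvgrPdistC_le => e e0.
by have [N hN] := h _ e0; exists N => // n Nn; rewrite subr0 hN.
Qed.

Lemma squeeze0 v e : (forall n, `|v n| <= e n) -> e @ \oo --> (0 : R) ->
  v @ \oo --> (0 : R).
Proof.
move=> ve e0; apply: cvg0_of_bound => d d0.
have [N hN] := cvg0_bound e0 d0; exists N => n Nn.
by rewrite (le_trans (ve n)) // (le_trans (ler_norm _)) // ltW // hN.
Qed.

Lemma subr_cvg0_seq v l : (fun n => v n - l) @ \oo --> (0 : R) -> v @ \oo --> l.
Proof.
move=> h; rewrite -(add0r l) (_ : v = (fun n => v n - l) \+ cst l).
  by apply: cvgD => //; exact: cvg_cst.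
by apply/funext => n /=; rewrite subrK.
Qed.

Lemma cvg_subr0_seq v l : v @ \oo --> l -> (fun n => v n - l) @ \oo --> (0 : R).
Proof. by move=> h; rewrite -(subrr l); apply: cvgB => //; exact: cvg_cst. Qed.

Lemma cvg_eq_from u v (l : R) N : (forall n, (N <= n)%N -> u n = v n) ->
  v @ \oo --> l -> u @ \oo --> l.
Proof.
move=> uv vl; apply: subr_cvg0_seq; apply: cvg0_of_bound => e e0.
have [N' hN'] := cvg0_bound (cvg_subr0_seq vl) e0.
exists (maxn N N') => n; rewrite geq_max => /andP[Nn N'n].
by rewrite uv // ltW // hN'.
Qed.

Lemma cvg0Z c v : v @ \oo --> (0 : R) -> (fun n => c * v n) @ \oo --> (0 : R).
Proof.
by move=> v0; rewrite -[X in _ --> X](mulr0 c); apply: cvgM => //; exact: cvg_cst.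
Qed.

Lemma cvgXr v (l : R) n : v @ \oo --> l -> (fun k => v k ^+ n) @ \oo --> (l ^+ n : R).
Proof.
move=> vl; elim: n => [|n ih]; first by under eq_fun do rewrite expr0; exact: cvg_cst.
by under eq_fun do rewrite exprS; rewrite exprS; apply: cvgM.
Qed.

Lemma cvg_sum_nat (f : nat -> nat -> R) (l : nat -> R) N :
  (forall k, (fun n => f n k) @ \oo --> l k) ->
  (fun n => \sum_(0 <= k < N) f n k) @ \oo --> \sum_(0 <= k < N) l k.
Proof.
move=> fl; elim: N => [|N ih].
  by under eq_fun do rewrite big_geq //; rewrite big_geq //; exact: cvg_cst.
by under eq_fun do rewrite big_nat_recr //=; rewrite big_nat_recr //=; apply: cvgD.
Qed.

End real_null_sequences.

Section complex_modulus.
Context {R : realType}.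
Local Notation C := R[i].
Implicit Types (x y z : C) (u v : nat -> C).

Lemma normcX x n : normc (x ^+ n) = normc x ^+ n.
Proof.
elim: n => [|n ih]; first by rewrite !expr0; exact: (normc1 R).
by rewrite !exprS normcM ih.
Qed.

Lemma normc_real (t : R) : normc t%:C = `|t|.
Proof. by rewrite /= expr0n /= addr0 sqrtr_sqr. Qed.

Lemma normc_conj x : normc x^*%C = normc x.
Proof. by case: x => a b /=; rewrite sqrrN. Qed.

Lemma normc_distC x y : normc (x - y) = normc (y - x).
Proof. by rewrite -normcN opprB. Qed.

Lemma normcn0 : normc (0 : C) = 0.
Proof. exact: (normc0 R). Qed.

Lemma normc_eq0 x : (normc x == 0) = (x == 0).
Proof. by apply/eqP/eqP => [/eq0_normc //|->]; exact: normcn0. Qed.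

Lemma le_norm_Re x : `|complex.Re x| <= normc x.
Proof.
case: x => a b /=; rewrite -(sqrtr_sqr a) ler_sqrt ?addr_ge0 ?sqr_ge0 //.
by rewrite lerDl sqr_ge0.
Qed.

Lemma le_norm_Im x : `|complex.Im x| <= normc x.
Proof.
case: x => a b /=; rewrite -(sqrtr_sqr b) ler_sqrt ?addr_ge0 ?sqr_ge0 //.
by rewrite lerDr sqr_ge0.
Qed.

Lemma le_normc_ReIm x : normc x <= `|complex.Re x| + `|complex.Im x|.
Proof.
rewrite -(@ler_pXn2r _ 2) ?nnegrE ?addr_ge0 ?normc_ge0 //.
rewrite sqr_normcE sqrrD !real_normK ?num_real // lerD2r lerDl.
by rewrite mulrn_wge0 // mulr_ge0.
Qed.

Lemma dist_normc x y : `|normc x - normc y| <= normc (x - y).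
Proof.
have xy := le_normcD (x - y) y; have yx := le_normcD (y - x) x.
rewrite subrK in xy; rewrite subrK (normc_distC y) in yx.
by rewrite ler_norml; apply/andP; split; lra.
Qed.

Lemma normc_sum (I : Type) (s : seq I) (P : pred I) (F : I -> C) :
  normc (\sum_(i <- s | P i) F i) <= \sum_(i <- s | P i) normc (F i).
Proof.
elim/big_ind2 : _ => // [|x a y b xa yb]; first by rewrite normcn0.
by rewrite (le_trans (le_normcD _ _)) // lerD.
Qed.

Lemma mulc_conj x : x * x^*%C = (normc x ^+ 2)%:C.
Proof.
rewrite sqr_normcE; case: x => a b; apply/eqP; rewrite eq_complex /=.
by apply/andP; split; apply/eqP; ring.
Qed.

Lemma ReM_real (t : R) x : complex.Re (t%:C * x) = t * complex.Re x.
Proof. by case: x => a b /=; ring. Qed.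

Lemma ReD x y : complex.Re (x + y) = complex.Re x + complex.Re y.
Proof. by case: x; case: y. Qed.

Lemma ReB x y : complex.Re (x - y) = complex.Re x - complex.Re y.
Proof. by case: x; case: y. Qed.

Lemma ImB x y : complex.Im (x - y) = complex.Im x - complex.Im y.
Proof. by case: x; case: y. Qed.

Lemma conjcM x y : (x * y)^*%C = x^*%C * y^*%C.
Proof. exact: rmorphM. Qed.

Lemma conjcB x y : (x - y)^*%C = x^*%C - y^*%C.
Proof. exact: rmorphB. Qed.

Lemma conjc_sum (I : Type) (s : seq I) (P : pred I) (F : I -> C) :
  (\sum_(i <- s | P i) F i)^*%C = \sum_(i <- s | P i) (F i)^*%C.
Proof. exact: rmorph_sum. Qed.

Lemma Re_sum (I : Type) (s : seq I) (P : pred I) (F : I -> C) :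
  complex.Re (\sum_(i <- s | P i) F i) = \sum_(i <- s | P i) complex.Re (F i).
Proof. by elim/big_rec2 : _ => // i y x _ <-; rewrite ReD. Qed.

(** Convergence in modulus: the limits that matter below come with real error
    bounds, so they are handled through this real null sequence. *)
Definition cto u (l : C) := (fun n => normc (u n - l)) @ \oo --> (0 : R).

Lemma cto_le u l (e : nat -> R) : (forall n, normc (u n - l) <= e n) ->
  e @ \oo --> (0 : R) -> cto u l.
Proof. by move=> ue; apply: squeeze0 => n; rewrite ger0_norm ?normc_ge0. Qed.

Lemma cto_Re u l : cto u l ->
  (fun n => complex.Re (u n)) @ \oo --> complex.Re l.
Proof.
move=> ul; apply: subr_cvg0_seq; apply: squeeze0 ul => n.
by rewrite -ReB le_norm_Re.
Qed.

Lemma cto_Im u l : cto u l ->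
  (fun n => complex.Im (u n)) @ \oo --> complex.Im l.
Proof.
move=> ul; apply: subr_cvg0_seq; apply: squeeze0 ul => n.
by rewrite -ImB le_norm_Im.
Qed.

Lemma cto_unique u l l' : cto u l -> cto u l' -> l = l'.
Proof.
move=> ul ul'; apply/eqP; rewrite eq_complex; apply/andP; split; apply/eqP.
  by apply: (@cvg_unique _ (@Rhausdorff R)) (cto_Re ul) (cto_Re ul').
by apply: (@cvg_unique _ (@Rhausdorff R)) (cto_Im ul) (cto_Im ul').
Qed.

Lemma cto_normc u l : cto u l -> (fun n => normc (u n)) @ \oo --> normc l.
Proof.
by move=> ul; apply: subr_cvg0_seq; apply: squeeze0 ul => n; exact: dist_normc.
Qed.

Lemma cto_cvg u l : cto u l <-> (u : nat -> C^o) @ \oo --> (l : C^o).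
Proof.
have nE (n : nat) : `|(u n - l : C^o)| = (normc (u n - l))%:C by [].
split=> [ul|ul].
  apply/cvgrPdistC_lt => e e0; move: (e0); rewrite ltcE => /andP[/= /eqP ei er].
  have [N hN] := cvg0_bound ul er; exists N => // n /= /hN.
  rewrite ger0_norm ?normc_ge0 // => h.
  by rewrite nE ltcE /= ei eqxx.
apply: cvg0_of_bound => e e0.
have ec0 : (0 : C) < (e : R)%:C by rewrite ltcR.
have [N _ hN] := cvgr_distC_lt _ _ ul _ ec0; exists N => n /hN.
by rewrite /= ltcR ger0_norm ?normc_ge0 // => /ltW.
Qed.

Lemma ctoD u v l l' : cto u l -> cto v l' -> cto (fun n => u n + v n) (l + l').
Proof.
move=> ul vl.
apply: (@cto_le _ _ (fun n => normc (u n - l) + normc (v n - l'))) => [n|].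
  by rewrite opprD addrACA; exact: le_normcD.
by rewrite -(addr0 0); apply: cvgD.
Qed.

Lemma ctoZ c u l : cto u l -> cto (fun n => c * u n) (c * l).
Proof.
move=> ul; apply: (@cto_le _ _ (fun n => normc c * normc (u n - l))) => [n|].
  by rewrite -mulrBr normcM.
by rewrite -(mulr0 (normc c)); apply: cvgM => //; exact: cvg_cst.
Qed.

Lemma ctoB u v l l' : cto u l -> cto v l' -> cto (fun n => u n - v n) (l - l').
Proof.
move=> ul vl; rewrite -mulN1r (_ : (fun _ => _) = (fun n => u n + -1 * v n)).
  by apply: ctoD => //; exact: ctoZ.
by apply/funext => n; rewrite mulN1r.
Qed.

Lemma cto_cst l : cto (fun=> l) l.
Proof. by rewrite /cto (_ : (fun _ => _) = cst 0) ?subrr ?normcn0 //; exact: cvg_cst. Qed.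

Lemma cto_sum (f : nat -> nat -> C) (l : nat -> C) N :
  (forall k, cto (f k) (l k)) ->
  cto (fun n => \sum_(0 <= k < N) f k n) (\sum_(0 <= k < N) l k).
Proof.
move=> fl; elim: N => [|N ih].
  rewrite big_geq // (_ : (fun _ => _) = fun=> 0); first exact: cto_cst.
  by apply/funext => n; rewrite big_geq.
rewrite big_nat_recr //= (_ : (fun _ => _) = fun n => \sum_(0 <= k < N) f k n + f N n).
  by apply: ctoD.
by apply/funext => n; rewrite big_nat_recr.
Qed.

Lemma cto_shift k u l : cto (fun n => u (n + k)%N) l -> cto u l.
Proof.
move=> h; apply: cvg0_of_bound => e e0; have [N hN] := cvg0_bound h e0.
exists (N + k)%N => n Nn; have kn : (k <= n)%N := leq_trans (leq_addl _ _) Nn.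
by have := hN (n - k)%N; rewrite subnK // => /(_ _)/ltW; apply; rewrite leq_subRL // addnC.
Qed.

(** Completeness, keeping the rate for the error bounds on power series. *)
Lemma cto_cauchy u (e : nat -> R) :
    (forall n m, (n <= m)%N -> normc (u m - u n) <= e n) ->
    e @ \oo --> (0 : R) ->
  exists l, forall n, normc (l - u n) <= e n.
Proof.
move=> ue e0.
have cvgr (f : C -> R) : (forall x y, `|f x - f y| <= normc (x - y)) ->
    cvgn (f \o u).
  move=> fle; apply/cauchy_cvgP/cauchy_exP => d d0.
  have [N hN] := cvg0_bound e0 d0.
  exists (f (u N)); exists N => // n Nn /=; rewrite /ball /= distrC.
  apply: le_lt_trans (hN N _) => //=.
  by rewrite (le_trans (fle _ _)) // (le_trans (ue _ _ Nn)) // ler_norm.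
have cR : cvgn ((fun n => complex.Re (u n))) by apply: cvgr => x y; rewrite -ReB le_norm_Re.
have cI : cvgn ((fun n => complex.Im (u n))) by apply: cvgr => x y; rewrite -ImB le_norm_Im.
pose l := limn ((fun n => complex.Re (u n))) +i* limn ((fun n => complex.Im (u n))).
have ul : cto u l.
  apply: (@cto_le _ _ (fun n => `|complex.Re (u n) - complex.Re l| +
      `|complex.Im (u n) - complex.Im l|)).
    by move=> n; rewrite -ReB -ImB le_normc_ReIm.
  rewrite -(addr0 0); apply: cvgD.
    by apply/norm_cvg0P/subr_cvg0; exact: cR.
  by apply/norm_cvg0P/subr_cvg0; exact: cI.
exists l => n.
have h : (fun m => normc (u m - u n)) @ \oo --> normc (l - u n).
  apply: (@cto_normc (fun m => u m - u n)).
  apply: cto_le ul => m; rewrite (_ : _ - _ - _ = u m - l) //.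
  by rewrite opprB addrA subrK.
apply: (ler_cvg_to h (cvg_cst (e n))); near=> m; apply: ue; near: m; exact: nbhs_infty_ge.
Unshelve. all: by end_near. Qed.

End complex_modulus.

(** * Power series and their re-expansion *)

Section power_series.
Context {R : realType}.
Local Notation C := R[i].
Implicit Types (a b : nat -> C) (z w h : C) (r q M : R).

Lemma geo_cvg0 M q : 0 <= q < 1 -> (fun n => M * q ^+ n) @ \oo --> (0 : R).
Proof.
by move=> /andP[q0 q1]; apply: cvg_geometric; rewrite ger0_norm.
Qed.

Lemma geo_sum_le q n m : 0 <= q < 1 -> \sum_(n <= k < m) q ^+ k <= q ^+ n / (1 - q).
Proof.
move=> /andP[q0 q1]; have q1' : 0 < 1 - q by rewrite subr_gt0.
have [nm|/ltnW mn] := leqP n m; last first.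
  by rewrite big_geq // divr_ge0 ?exprn_ge0 // ltW.
rewrite ler_pdivlMr // mulr_suml (eq_bigr (fun k => - (q ^+ k.+1 - q ^+ k))).
  by rewrite sumrN telescope_sumr // opprB lerBlDr lerDl exprn_ge0.
by move=> k _; rewrite exprS; ring.
Qed.

Lemma natr_geo_le q n : 0 <= q < 1 -> n.+1%:R * q ^+ n <= (1 - q)^-1.
Proof.
move=> /andP[q0 q1]; have := @geo_sum_le q 0 n.+1; rewrite q0 q1 => /(_ isT).
rewrite expr0 mul1r; apply: le_trans.
rewrite mulr_natl -[X in _ *+ X]subn0 -sumr_const_nat.
apply: ler_sum_nat => k /andP[_ kn].
by rewrite ler_wiXn2l // ltW.
Qed.

Definition psum a w N : C := \sum_(0 <= k < N) a k * w ^+ k.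

(** The value 0 is taken where the series diverges. *)
Definition ps a w : C := xget 0 [set s | cto (psum a w) s].

(** [psbnd a r M] witnesses that the power series of a has radius of convergence
    at least r. *)
Definition psbnd a r M := forall n, normc (a n) * r ^+ n <= M.

Lemma ps_eq a w s : cto (psum a w) s -> ps a w = s.
Proof.
move=> h; rewrite /ps; case: xgetP => [t _ ht|/(_ s)//].
exact: cto_unique ht h.
Qed.

Lemma psbnd_ge0 a r M : psbnd a r M -> 0 <= M.
Proof. by move=> /(_ 0); rewrite expr0 mulr1; apply: le_trans; exact: normc_ge0. Qed.

Lemma psbnd_term a r M q w n : psbnd a r M -> 0 <= q -> normc w <= q * r ->
  normc (a n * w ^+ n) <= M * q ^+ n.
Proof.
move=> aM q0 wq; rewrite normcM normcX.
apply: (@le_trans _ _ (normc (a n) * (q * r) ^+ n)).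
  by rewrite ler_wpM2l ?normc_ge0 // lerXn2r // nnegrE ?normc_ge0 // (le_trans _ wq) ?normc_ge0.
rewrite exprMn mulrCA mulrC ler_wpM2r ?exprn_ge0 //.
Qed.

Lemma psum_diff a r M q w n m : psbnd a r M -> 0 <= q < 1 -> normc w <= q * r ->
  (n <= m)%N -> normc (psum a w m - psum a w n) <= M * (q ^+ n / (1 - q)).
Proof.
move=> aM q01 wq nm; have /andP[q0 q1] := q01.
rewrite /psum (big_cat_nat (n := n)) //= addrAC subrr add0r.
rewrite (le_trans (normc_sum _ _ _)) //.
rewrite (le_trans (ler_sum _ (fun k _ => psbnd_term k aM q0 wq))) //.
by rewrite -mulr_sumr ler_wpM2l ?(psbnd_ge0 aM) // geo_sum_le.
Qed.

Lemma ps_err a r M q w N : psbnd a r M -> 0 <= q < 1 -> normc w <= q * r ->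
  normc (ps a w - psum a w N) <= M * (q ^+ N / (1 - q)).
Proof.
move=> aM q01 wq.
have e0 : (fun n => M * (q ^+ n / (1 - q))) @ \oo --> (0 : R).
  rewrite (_ : (fun _ => _) = (fun n => M / (1 - q) * q ^+ n)).
    exact: geo_cvg0.
  by apply/funext => n; rewrite mulrCA mulrC mulrAC -mulrA.
have [l hl] := cto_cauchy (fun n m => psum_diff aM q01 wq) e0.
have -> // : ps a w = l.
apply: ps_eq; apply: cto_le e0 => n; rewrite normc_distC; exact: hl.
Qed.

Lemma ps_cto a r M w : psbnd a r M -> normc w < r -> cto (psum a w) (ps a w).
Proof.
move=> aM wr; have r0 : 0 < r by rewrite (le_lt_trans _ wr) ?normc_ge0.
pose q := normc w / r.
have q01 : 0 <= q < 1 by rewrite divr_ge0 ?normc_ge0 ?ltW //= ltr_pdivrMr // mul1r.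
have wq : normc w <= q * r by rewrite /q divfK // gt_eqF.
apply: (@cto_le _ _ _ (fun n => M / (1 - q) * q ^+ n)); last exact: geo_cvg0.
move=> n; rewrite normc_distC (le_trans (ps_err n aM q01 wq)) //.
by rewrite mulrCA mulrC mulrAC -mulrA.
Qed.

Lemma ps_bound a r M q w : psbnd a r M -> 0 <= q < 1 -> normc w <= q * r ->
  normc (ps a w) <= M / (1 - q).
Proof.
move=> aM q01 wq; have := ps_err 0 aM q01 wq.
by rewrite /psum big_geq // subr0 expr0 mul1r.
Qed.

Lemma psumD a b c w N :
  psum (fun n => c * a n + b n) w N = c * psum a w N + psum b w N.
Proof.
by rewrite /psum mulr_sumr -big_split /=; apply: eq_bigr => k _; rewrite mulrDl mulrA.
Qed.

Lemma psbnd_le a r r' M : 0 <= r' <= r -> psbnd a r M -> psbnd a r' M.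
Proof.
move=> /andP[r0 rr] aM n; apply: le_trans (aM n).
by rewrite ler_wpM2l ?normc_ge0 // lerXn2r // nnegrE // (le_trans r0).
Qed.

Lemma psbndD a b c r M M' : 0 <= r -> psbnd a r M -> psbnd b r M' ->
  psbnd (fun n => c * a n + b n) r (normc c * M + M').
Proof.
move=> r0 aM bM n; apply: le_trans (lerD (ler_wpM2l (normc_ge0 c) (aM n)) (bM n)).
rewrite mulrA -normcM -mulrDl ler_wpM2r ?exprn_ge0 //; exact: le_normcD.
Qed.

Lemma psD a b c w r M M' : psbnd a r M -> psbnd b r M' -> normc w < r ->
  ps (fun n => c * a n + b n) w = c * ps a w + ps b w.
Proof.
move=> aM bM wr; apply: ps_eq.
have ha := ps_cto aM wr; have hb := ps_cto bM wr.
apply: (@cto_le _ _ _ (fun n => normc c * normc (psum a w n - ps a w) +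
    normc (psum b w n - ps b w))) => [n|].
  rewrite psumD (_ : _ - _ = c * (psum a w n - ps a w) + (psum b w n - ps b w)).
    by rewrite (le_trans (le_normcD _ _)) // normcM.
  by ring.
rewrite -(addr0 0) -[X in X + _](mulr0 (normc c)).
by apply: cvgD => //; apply: cvgM => //; exact: cvg_cst.
Qed.

Lemma psbndZ a u r M : psbnd a r M -> psbnd (fun n => u * a n) r (normc u * M).
Proof. by move=> aM n; rewrite normcM -mulrA ler_wpM2l ?normc_ge0. Qed.

Lemma psZ a u w r M : psbnd a r M -> normc w < r ->
  ps (fun n => u * a n) w = u * ps a w.
Proof.
move=> aM wr; apply: ps_eq.
rewrite (_ : psum _ _ = fun N => u * psum a w N); first exact: ctoZ (ps_cto aM wr).
by apply/funext => N; rewrite /psum mulr_sumr; apply: eq_bigr => k _; rewrite mulrA.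
Qed.

(** The terms of a convergent series are bounded. *)
Lemma cto_psbnd a h s : cto (psum a h) s -> exists M, psbnd a (normc h) M.
Proof.
move=> hs; have [N hN] := cvg0_bound hs ltr01.
pose B := \sum_(0 <= k < N) normc (a k * h ^+ k).
have B0 : 0 <= B by apply: sumr_ge0 => k _; exact: normc_ge0.
exists (2 + B) => n; rewrite -normcX -normcM.
have [Nn|nN] := leqP N n; last first.
  rewrite /B (bigD1_seq n) //= ?mem_index_iota ?iota_uniq //.
  rewrite addrCA lerDl addr_ge0 ?ler0n //.
  by apply: sumr_ge0 => k _; exact: normc_ge0.
have -> : a n * h ^+ n = (psum a h n.+1 - s) - (psum a h n - s).
  by rewrite /psum big_nat_recr //=; ring.
have h1 := hN n Nn; have h2 := hN n.+1 (leqW Nn).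
rewrite !ger0_norm ?normc_ge0 // in h1 h2.
have := le_normcD (psum a h n.+1 - s) (- (psum a h n - s)).
by rewrite normcN; lra.
Qed.

End power_series.

Section reexpansion.
Context {R : realType}.
Local Notation C := R[i].
Implicit Types (a b : nat -> C) (z w h : C) (r q M : R).

(** The coefficients of the k-th derivative, divided by k factorial. *)
Definition dercoef a k (n : nat) : C := 'C(n + k, k)%:R * a (n + k)%N.

Definition taylor a z k : C := ps (dercoef a k) z.

Let tsum a z k N : C := \sum_(0 <= n < N) 'C(n, k)%:R * a n * z ^+ (n - k).

Lemma normc_nat n : normc (n%:R : C) = n%:R.
Proof. by rewrite -(rmorph_nat (real_complex R)) normc_real normr_nat. Qed.

Let tsumE a z k N : tsum a z k (N + k) = psum (dercoef a k) z N.
Proof.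
rewrite /tsum (big_cat_nat (n := k)) ?leq_addl //= big_nat_cond big1 ?add0r; last first.
  by move=> i /andP[/andP[_ ik] _]; rewrite bin_small // !mul0r.
rewrite -{1}(add0n k) big_addn addnK /psum; apply: eq_bigr => i _.
by rewrite /dercoef addnK.
Qed.

Lemma bin_term_le (x y : R) n k : 0 <= x -> 0 <= y ->
  'C(n + k, k)%:R * x ^+ n * y ^+ k <= (x + y) ^+ (n + k).
Proof.
move=> x0 y0; rewrite exprDn.
have kn : (k < (n + k).+1)%N by rewrite ltnS leq_addl.
rewrite (bigD1 (Ordinal kn)) //= addnK mulr_natl mulrnAl lerDl.
by apply: sumr_ge0 => i _; rewrite mulrn_wge0 // mulr_ge0 // exprn_ge0.
Qed.

(** Leaving a margin y in the radius pays for the binomial coefficient. *)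
Lemma dercoef_psbnd a r M k x y : 0 <= x -> 0 < y -> x + y <= r -> psbnd a r M ->
  psbnd (dercoef a k) x (M / y ^+ k).
Proof.
move=> x0 y0 xy aM n; rewrite ler_pdivlMr ?exprn_gt0 //.
rewrite normcM normc_nat mulrAC -mulrA -mulrA mulrCA.
have aM' := psbnd_le (_ : 0 <= x + y <= r) aM.
apply: le_trans (aM' _ (n + k)%N); last by rewrite xy addr_ge0 // ltW.
rewrite ler_wpM2l ?normc_ge0 //; apply: le_trans (bin_term_le n k x0 (ltW y0)).
by rewrite le_eqVlt; apply/orP; left; apply/eqP; ring.
Qed.

Lemma taylor_cto a r M k z : psbnd a r M -> normc z < r ->
  cto (psum (dercoef a k) z) (taylor a z k).
Proof.
move=> aM zr; pose y := (r - normc z) / 2; have z0 := normc_ge0 z.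
apply: (@ps_cto _ _ (r - y) (M / y ^+ k)); last by rewrite /y; lra.
by apply: (@dercoef_psbnd _ r) => //; rewrite /y; lra.
Qed.

(** The binomial theorem bounds the k-th Taylor coefficient at z against the
    geometric series of ratio q. *)
Lemma taylor_psbnd a r M q z d : psbnd a r M -> 0 <= q < 1 -> 0 <= d ->
  normc z + d <= q * r -> normc z < r -> psbnd (taylor a z) d (M / (1 - q)).
Proof.
move=> aM q01 d0 zd zr k; have /andP[q0 q1] := q01; have z0 := normc_ge0 z.
have r0 : 0 <= r by exact: le_trans (ltW zr).
have h := cto_normc (taylor_cto k aM zr).
have h' : (fun N => normc (psum (dercoef a k) z N) * d ^+ k) @ \oo -->
    normc (taylor a z k) * d ^+ k by apply: cvgM => //; exact: cvg_cst.
apply: (ler_cvg_to h' (cvg_cst (M / (1 - q)))); near=> N.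
apply: (@le_trans _ _ (\sum_(0 <= n < N) M * q ^+ (n + k))).
  apply: (@le_trans _ _ (\sum_(0 <= n < N) normc (dercoef a k n * z ^+ n) * d ^+ k)).
    by rewrite -mulr_suml ler_wpM2r ?exprn_ge0 // normc_sum.
  apply: ler_sum => n _; rewrite normcM normcM normc_nat normcX.
  apply: (@le_trans _ _ (normc (a (n + k)%N) * (normc z + d) ^+ (n + k))).
    apply: (@le_trans _ _ (normc (a (n + k)%N) * ('C(n + k, k)%:R * normc z ^+ n * d ^+ k))).
      by rewrite le_eqVlt; apply/orP; left; apply/eqP; ring.
    by rewrite ler_wpM2l ?normc_ge0 // bin_term_le.
  apply: (@le_trans _ _ (normc (a (n + k)%N) * (q * r) ^+ (n + k))).
    by rewrite ler_wpM2l ?normc_ge0 // lerXn2r // nnegrE ?mulr_ge0 // addr_ge0.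
  by rewrite exprMn mulrCA mulrC ler_wpM2r ?exprn_ge0.
rewrite -mulr_sumr ler_wpM2l ?(psbnd_ge0 aM) //.
have := @geo_sum_le _ q k (N + k) q01.
rewrite -{1}(add0n k) big_addn addnK => /le_trans; apply.
by rewrite ler_piMl ?invr_ge0 ?subr_ge0 ?(ltW q1) // exprn_ile1 // ltW.
Unshelve. all: by end_near. Qed.

Let binom_trunc z h n N :
  normc (\sum_(0 <= k < N) 'C(n, k)%:R * z ^+ (n - k) * h ^+ k - (z + h) ^+ n) <=
  if (N <= n)%N then (normc z + normc h) ^+ n else 0.
Proof.
have binE (x y : C) : (x + y) ^+ n =
    \sum_(0 <= k < n.+1) 'C(n, k)%:R * x ^+ (n - k) * y ^+ k.
  rewrite exprDn big_mkord; apply: eq_bigr => i _.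
  by rewrite -mulrA mulr_natl.
have binER (x y : R) : (x + y) ^+ n =
    \sum_(0 <= k < n.+1) 'C(n, k)%:R * x ^+ (n - k) * y ^+ k.
  rewrite exprDn big_mkord; apply: eq_bigr => i _.
  by rewrite -mulrA mulr_natl.
have [Nn|nN] := leqP N n; last first.
  rewrite binE (big_cat_nat (n := n.+1) (m := 0%N) (p := N)) //= addrAC subrr add0r.
  rewrite big_nat_cond big1 ?normcn0 // => i /andP[/andP[ni _] _].
  by rewrite bin_small // !mul0r.
rewrite binE binER (big_cat_nat (n := N) (m := 0%N) (p := n.+1)) ?leqW //= opprD addrA subrr add0r normcN.
rewrite (big_cat_nat (n := N) (m := 0%N) (p := n.+1)) ?leqW //=.
rewrite (le_trans (normc_sum _ _ _)) // -[leLHS]add0r lerD //.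
  by apply: sumr_ge0 => k _; rewrite !mulr_ge0 ?exprn_ge0 ?normc_ge0.
by apply: ler_sum => k _; rewrite !normcM normc_nat !normcX.
Qed.

(** Expansion of a power series about another point of its disc: the N-th partial
    sum in h is compared, uniformly in the truncation order N', with the
    polynomial obtained by truncating a at order N'. *)
Lemma ps_taylor a r M z h : psbnd a r M -> normc z + normc h < r ->
  cto (psum (taylor a z) h) (ps a (z + h)).
Proof.
move=> aM zhr; have z0 := normc_ge0 z; have h0 := normc_ge0 h.
have r0 : 0 < r by lra.
pose q := (normc z + normc h) / r.
have q01 : 0 <= q < 1.
  by rewrite divr_ge0 ?addr_ge0 ?(ltW r0) //= ltr_pdivrMr // mul1r.
have zq : normc z + normc h = q * r by rewrite /q divfK // gt_eqF.
have zr : normc z < r by lra.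
apply: (@cto_le _ _ _ (fun N => M / (1 - q) * q ^+ N)); last exact: geo_cvg0.
move=> N.
pose Q N' : C := \sum_(0 <= k < N) tsum a z k N' * h ^+ k.
have QE N' : Q N' = \sum_(0 <= n < N') a n *
    \sum_(0 <= k < N) 'C(n, k)%:R * z ^+ (n - k) * h ^+ k.
  rewrite /Q (eq_bigr (fun k => \sum_(0 <= n < N') a n *
      ('C(n, k)%:R * z ^+ (n - k) * h ^+ k))); last first.
    by move=> k _; rewrite mulr_suml; apply: eq_bigr => n _; ring.
  by rewrite exchange_big /=; apply: eq_bigr => n _; rewrite mulr_sumr.
have Qle N' : normc (Q N' - psum a (z + h) N') <= M / (1 - q) * q ^+ N.
  rewrite QE /psum -sumrB (le_trans (normc_sum _ _ _)) //.
  apply: (@le_trans _ _ (\sum_(0 <= n < N' | (N <= n)%N) M * q ^+ n)).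
    rewrite [leRHS]big_mkcond /=; apply: ler_sum => n _.
    rewrite -mulrBr normcM; have := binom_trunc z h n N.
    case: ifP => _ le; last first.
      by rewrite (le_anti (introT andP (conj le (normc_ge0 _)))) mulr0.
    rewrite (le_trans (ler_wpM2l (normc_ge0 _) le)) // zq exprMn mulrCA mulrC.
    by rewrite ler_wpM2r ?exprn_ge0 //; case/andP: q01.
  rewrite -mulr_sumr -mulrA ler_wpM2l ?(psbnd_ge0 aM) //.
  rewrite [leRHS]mulrC; apply: le_trans (geo_sum_le N N' q01).
  have [NN|/ltnW NN] := leqP N N'; last first.
    rewrite (big_geq NN) big_nat_cond big1 // => i /andP[/andP[_ iN'] Ni].
    by move: (leq_trans iN' NN); rewrite ltnNge Ni.
  rewrite (big_cat_nat (n := N) (m := 0%N) (p := N')) //= big_nat_cond big1 ?add0r.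
    by rewrite big_mkcond /=; apply: ler_sum_nat => i /andP[-> _].
  by move=> i /andP[/andP[_ iN] Ni]; move: iN; rewrite ltnNge Ni.
have Qcto : cto (fun N' => Q N' - psum a (z + h) N')
    (psum (taylor a z) h N - ps a (z + h)).
  apply: ctoB; last by apply: (ps_cto aM); exact: le_lt_trans (le_normcD _ _) zhr.
  apply: cto_sum => k; rewrite mulrC (_ : (fun _ => _) = (fun N' => h ^+ k * tsum a z k N')).
    apply: ctoZ; apply: (cto_shift (k := k)).
    rewrite (_ : (fun _ => _) = psum (dercoef a k) z); first exact: taylor_cto aM zr.
    by apply/funext => K; rewrite tsumE.
  by apply/funext => K; rewrite mulrC.
apply: (ler_cvg_to (cto_normc Qcto) (cvg_cst (M / (1 - q) * q ^+ N))).
by near=> N'; exact: Qle.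
Unshelve. all: by end_near. Qed.

End reexpansion.

(** * A Tauberian theorem for the Bergman weights *)

Section tauberian.
Context {R : realType}.
Implicit Types (u lam : nat -> R) (g : R -> R) (p : {poly R}) (r x y : R).

(** The weights n + 1 are those of the Bergman kernel: on the constant sequence 1
    the sum is (1 - x)^-2. *)
Definition abel_sum u g := forall x, 0 <= x < 1 ->
  (fun T => \sum_(0 <= n < T) n.+1%:R * u n * x ^+ n) @ \oo --> g x.

Lemma natr_geo_cvg0 x : 0 <= x < 1 -> (fun n => n.+1%:R * x ^+ n) @ \oo --> (0 : R).
Proof.
move=> /andP[x0 x1].
pose s := Num.sqrt x; have s0 : 0 <= s by exact: sqrtr_ge0.
have ss : s ^+ 2 = x by rewrite sqr_sqrtr.
have s01 : 0 <= s < 1 by rewrite s0 -(@ltr_pXn2r _ 2) ?nnegrE // ss expr1n.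
apply: (@squeeze0 _ _ (fun n => (1 - s)^-1 * s ^+ n)); last exact: geo_cvg0.
move=> n; rewrite ger0_norm ?mulr_ge0 ?exprn_ge0 // -ss -exprM mulnC mulnS muln1 exprD mulrA.
by rewrite ler_wpM2r ?exprn_ge0 // natr_geo_le.
Qed.

Lemma geo2_sum (F : comNzRingType) (x : F) T : (1 - x) ^+ 2 * \sum_(0 <= n < T) n.+1%:R * x ^+ n =
  1 - T.+1%:R * x ^+ T + T%:R * x ^+ T.+1.
Proof.
elim: T => [|T ih]; first by rewrite big_geq // mulr0 expr0 mul0r; ring.
by rewrite big_nat_recr //= mulrDr ih !exprS -!natr1; ring.
Qed.

Lemma abel_sum1 : abel_sum (fun=> 1) (fun x => (1 - x) ^- 2).
Proof.
move=> x x01; have /andP[x0 x1] := x01; have x1' : 1 - x != 0 by rewrite subr_eq0 gt_eqF.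
have c0 := natr_geo_cvg0 x01.
have h : (fun T => (1 - x) ^- 2 * (1 - T.+1%:R * x ^+ T + x * (T.+1%:R * x ^+ T - x ^+ T)))
    @ \oo --> (1 - x) ^- 2 * (1 - 0 + x * (0 - 0)).
  apply: cvgM; first exact: cvg_cst.
  apply: cvgD; first by apply: cvgB => //; exact: cvg_cst.
  apply: cvgM; first exact: cvg_cst.
  apply: cvgB => //; have := geo_cvg0 1 x01.
  by under eq_fun do rewrite mul1r.
rewrite !subr0 mulr0 addr0 mulr1 in h.
rewrite (_ : (fun _ => _) = (fun T => (1 - x) ^- 2 *
  (1 - T.+1%:R * x ^+ T + x * (T.+1%:R * x ^+ T - x ^+ T)))) //.
apply/funext => T; under eq_bigr do rewrite mulr1.
have -> : 1 - T.+1%:R * x ^+ T + x * (T.+1%:R * x ^+ T - x ^+ T) =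
    (1 - x) ^+ 2 * \sum_(0 <= n < T) n.+1%:R * x ^+ n.
  by rewrite geo2_sum exprS -natr1; ring.
by rewrite mulrA mulVf ?mul1r // expf_neq0.
Qed.

(** Karamata's device: replacing x by powers of r turns the generating function
    into sums weighted by a polynomial in r^n. *)
Lemma abel_sum_poly u g p r : abel_sum u g -> p`_0 = 0 -> 0 < r < 1 ->
  (fun T => \sum_(0 <= n < T) n.+1%:R * u n * p.[r ^+ n]) @ \oo -->
  \sum_(0 <= j < size p) p`_j * g (r ^+ j).
Proof.
move=> ug p0 /andP[r0 r1].
rewrite (_ : (fun _ => _) = fun T => \sum_(0 <= j < size p)
    p`_j * \sum_(0 <= n < T) n.+1%:R * u n * (r ^+ j) ^+ n); last first.
  apply/funext => T; under [RHS]eq_bigr do rewrite mulr_sumr.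
  rewrite exchange_big /=; apply: eq_bigr => n _.
  rewrite horner_coef mulr_sumr big_mkord; apply: eq_bigr => j _.
  by rewrite -!exprM mulnC mulrCA.
apply: cvg_sum_nat => -[|j].
  rewrite p0 mul0r; under eq_fun do rewrite mul0r; exact: cvg_cst.
apply: cvgM; first exact: cvg_cst.
by apply: ug; rewrite exprn_ge0 ?(ltW r0) //= exprn_ilt1 // ltW.
Qed.

(** Positive weights y (4 y (1 - y))^k; for large k they concentrate at y = 1/2. *)
Definition bump k : {poly R} := 'X * (4%:P * 'X * (1 - 'X)) ^+ k.

Lemma bumpE k y : (bump k).[y] = y * (4 * y * (1 - y)) ^+ k.
Proof. by rewrite /bump !hornerE. Qed.

Lemma bump0 k : (bump k)`_0 = 0.
Proof. by rewrite -horner_coef0 bumpE mul0r. Qed.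

Lemma bump_ge0 k y : 0 <= y <= 1 -> 0 <= (bump k).[y].
Proof.
move=> /andP[y0 y1]; rewrite bumpE mulr_ge0 // exprn_ge0 //.
by rewrite !mulr_ge0 // subr_ge0.
Qed.

(** The second moment of a weight around 1/2 is a difference of consecutive total
    weights. *)
Lemma bumpS k y : (1 - 2 * y) ^+ 2 * (bump k).[y] = (bump k).[y] - (bump k.+1).[y].
Proof. by rewrite !bumpE (exprS _ k); ring. Qed.

Section half_life.
Variables (r : R) (N : nat).
Hypotheses (r01 : 0 < r < 1) (N0 : (0 < N)%N) (rN : r ^+ N = 2^-1).

Let r0 : 0 < r. Proof. by case/andP: r01. Qed.
Let r1 : r < 1. Proof. by case/andP: r01. Qed.

Lemma one_subX_le m : 1 - r ^+ m <= m%:R * (1 - r).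
Proof.
elim: m => [|m ih]; first by rewrite expr0 subrr mul0r.
have : r ^+ m <= 1 by rewrite exprn_ile1 // ltW.
by rewrite exprS -natr1; move: r1 ih; nra.
Qed.

Lemma one_subX_ge m : m%:R * r ^+ m * (1 - r) <= 1 - r ^+ m.
Proof.
elim: m => [|m ih]; first by rewrite expr0 subrr !mul0r.
have rm : 0 <= r ^+ m by rewrite exprn_ge0 // ltW.
have mr : 0 <= m%:R * r ^+ m * (1 - r) by rewrite !mulr_ge0 // subr_ge0 ltW.
have h : m%:R * r ^+ m * r * (1 - r) <= m%:R * r ^+ m * (1 - r).
  by rewrite (mulrAC _ r) ler_piMr // ltW.
have h2 : r * r ^+ m * (1 - r) <= r ^+ m * (1 - r).
  by rewrite ler_wpM2r ?subr_ge0 ?(ltW r1) // ler_piMl // ltW.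
by rewrite exprS -natr1; move: ih h h2; lra.
Qed.

(** So 1 - r is comparable with 1/N. *)
Lemma half_life_ge : 2^-1 <= N%:R * (1 - r).
Proof. by have := one_subX_le N; rewrite rN; lra. Qed.

Lemma half_life_le : 1 - r <= N%:R^-1.
Proof.
have := one_subX_ge N; rewrite rN -[X in _ -> _ <= X]mul1r ler_pdivlMr ?ltr0n //; lra.
Qed.

Lemma powX_ge_half m : (m <= N)%N -> 2^-1 <= r ^+ m.
Proof. by move=> mN; rewrite -rN ler_wiXn2l // ltW. Qed.

Lemma one_subX_lin m : (m <= N)%N -> m%:R / (4 * N%:R) <= 1 - r ^+ m.
Proof.
move=> mN; apply: le_trans (one_subX_ge m).
have h1 := powX_ge_half mN; have h2 := half_life_ge.
have n0 : 0 < (N%:R : R) by rewrite ltr0n.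
rewrite ler_pdivrMr ?mulr_gt0 // -!mulrA ler_peMr //.
have -> : r ^+ m * ((1 - r) * (4 * N%:R)) = 4 * (r ^+ m * (N%:R * (1 - r))) by ring.
have : 2^-1 * 2^-1 <= r ^+ m * (N%:R * (1 - r)) by rewrite ler_pM.
lra.
Qed.

(** Slow oscillation against the weights: with r^N = 1/2, the deviation of lam n
    from lam N is controlled by the distance of r^n to 1/2. *)
Lemma slow_oscillation lam (B D : R) n : (forall n, `|lam n| <= B) ->
  (forall n, `|lam n.+1 - lam n| <= D / n.+1%:R) ->
  `|lam n - lam N| <= (8 * D + 16 * B) * `|1 - 2 * r ^+ n|.
Proof.
move=> hB hD.
have B0 : 0 <= B by exact: le_trans (hB 0%N).
have D0 : 0 <= D by have := le_trans (normr_ge0 _) (hD 0%N); rewrite invr1 mulr1.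
have n0 : 0 < (N%:R : R) by rewrite ltr0n.
have tel i j : (i <= j)%N -> `|lam j - lam i| <= (j - i)%:R * (D / i.+1%:R).
  move=> ij; rewrite -(telescope_sumr _ ij) (le_trans (ler_norm_sum _ _ _)) //.
  rewrite mulr_natl -sumr_const_nat; apply: ler_sum_nat => k /andP[ik _].
  by rewrite (le_trans (hD k)) // ler_wpM2l // lef_pV2 ?posrE ?ltr0n // ler_nat ltnS.
have triv i j : `|lam i - lam j| <= 2 * B.
  by rewrite (le_trans (ler_normB _ _)) //; have := hB i; have := hB j; lra.
(* Between N/2 and 2N the increments of lam are summed; outside this range r^n is
   far from 1/2 and the bound B suffices. *)
have [Nn|nN] := leqP N n.
  have -> : 1 - 2 * r ^+ n = 1 - r ^+ (n - N).
    by rewrite -{1}(subnKC Nn) exprD rN mulrA divff ?mul1r // pnatr_eq0.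
  have x0 : 0 <= 1 - r ^+ (n - N) by rewrite subr_ge0 exprn_ile1 // ltW.
  rewrite (ger0_norm x0); have [mN|Nm] := leqP (n - N) N.
    have h := one_subX_lin mN.
    have h' : (n - N)%:R * (D / N.+1%:R) <= 4 * D * (1 - r ^+ (n - N)).
      apply: le_trans (_ : 4 * D * ((n - N)%:R / (4 * N%:R)) <= _); last first.
        by rewrite ler_wpM2l // mulr_ge0.
      have -> : 4 * D * ((n - N)%:R / (4 * N%:R)) = (n - N)%:R * (D / N%:R).
        by field; rewrite pnatr_eq0 -lt0n.
      by rewrite ler_wpM2l // ler_wpM2l // lef_pV2 ?posrE ?ltr0n // ler_nat.
    apply: le_trans (tel _ _ Nn) _; apply: le_trans h' _.
    by rewrite ler_wpM2r //; lra.
  have xh : 2^-1 <= 1 - r ^+ (n - N).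
    have : r ^+ (n - N) <= r ^+ N by rewrite ler_wiXn2l ?(ltW r0) ?(ltW r1) ?(ltnW Nm).
    by rewrite rN; lra.
  apply: le_trans (triv _ _) _; have := mulr_ge0 D0 x0; have := ler_wpM2l B0 xh; lra.
pose m := (N - n)%N; have mN : (m <= N)%N by exact: leq_subr.
have rm0 : 0 < r ^+ m by rewrite exprn_gt0.
have e : 2 * r ^+ n = (r ^+ m)^-1.
  apply: (mulIf (lt0r_neq0 rm0)); rewrite mulVf ?gt_eqF // -mulrA -exprD /m.
  by rewrite subnKC ?(ltnW nN) // rN divff // pnatr_eq0.
have h := one_subX_lin mN.
have xm : 1 - r ^+ m <= `|1 - 2 * r ^+ n|.
  have x1 : r ^+ m <= 1 by rewrite exprn_ile1 // ltW.
  have y1 : 1 <= (r ^+ m)^-1 by rewrite invf_ge1.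
  have xy : r ^+ m * (r ^+ m)^-1 = 1 by rewrite divff // gt_eqF.
  rewrite e ler0_norm ?subr_le0 //; move: (r ^+ m) (r ^+ m)^-1 xy x1 y1 => x y; nra.
set X := `|1 - 2 * r ^+ n| in xm *.
have X0 : 0 <= X by exact: normr_ge0.
have mE : (m%:R : R) = N%:R - n%:R by rewrite /m natrB // ltnW.
have n0' : 0 <= (n%:R : R) by [].
have [nh|nh] := leP (N%:R : R) (2 * n.+1%:R).
  rewrite distrC; apply: le_trans (tel _ _ (ltnW nN)) _.
  rewrite -/m; apply: (@le_trans _ _ (8 * D * (m%:R / (4 * N%:R)))).
    have -> : 8 * D * (m%:R / (4 * N%:R)) = m%:R * (D * (2 / N%:R)).
      by field; rewrite pnatr_eq0 -lt0n.
    rewrite ler_wpM2l // ler_wpM2l // ler_pdivlMr // mulrC ler_pdivrMr ?ltr0n //.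
  have : 8 * D * (m%:R / (4 * N%:R)) <= 8 * D * X by rewrite ler_wpM2l ?mulr_ge0 //; lra.
  by have := mulr_ge0 B0 X0; lra.
have X8 : 8^-1 <= X.
  apply: le_trans xm; apply: le_trans h; rewrite ler_pdivlMr ?mulr_gt0 // mE.
  by move: nh; rewrite -natr1; lra.
apply: le_trans (triv _ _) _.
by have := mulr_ge0 D0 X0; have := ler_wpM2l B0 X8; lra.
Qed.

Lemma bump_window k q : (0 < q)%N ->
  forall n, (N <= n < N + (N %/ q).+1)%N -> 4^-1 * (1 - q%:R ^- 2) ^+ k <= (bump k).[r ^+ n].
Proof.
move=> q0 n /andP[Nn nN]; pose m := (n - N)%N.
have mq : (m <= N %/ q)%N by rewrite leq_subLR -ltnS -addnS.
have mN : (m <= N)%N by rewrite (leq_trans mq) // leq_div.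
have rm := powX_ge_half mN.
have n0 : 0 < (N%:R : R) by rewrite ltr0n.
have q0' : 0 < (q%:R : R) by rewrite ltr0n.
have yE : r ^+ n = 2^-1 * r ^+ m by rewrite -rN -exprD /m subnKC.
have ym : 1 - r ^+ m <= q%:R^-1.
  apply: le_trans (one_subX_le m) _; apply: le_trans (ler_wpM2l (ler0n _ _) half_life_le) _.
  rewrite ler_pdivrMr // mulrC ler_pdivlMr // -natrM ler_nat.
  by rewrite (leq_trans _ (leq_trunc_div N q)) // leq_mul2r mq orbT.
have rm1 : r ^+ m <= 1 by rewrite exprn_ile1 // ltW.
rewrite bumpE yE (_ : 4 * _ * _ = 1 - (1 - r ^+ m) ^+ 2); last by field.
have q1 : 0 <= 1 - (q%:R : R) ^- 2.
  by rewrite subr_ge0 invf_le1 ?exprn_gt0 // exprn_ege1 // ler1n.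
rewrite ler_pM ?exprn_ge0 //; first lra.
rewrite lerXn2r // ?nnegrE; last first.
  by rewrite lerD2l lerN2 -exprVn lerXn2r // nnegrE ?subr_ge0 // invr_ge0 ltW.
by rewrite subr_ge0 exprn_ile1 ?subr_ge0 //; lra.
Qed.

End half_life.

Lemma half_life_ex N : (0 < N)%N -> exists2 r : R, 0 < r < 1 & r ^+ N = 2^-1.
Proof.
move=> N0; have n0 : 0 < (N%:R : R) by rewrite ltr0n.
exists (expR (- (ln 2 / N%:R))).
  by rewrite expR_gt0 /= expR_lt1 oppr_lt0 divr_gt0 // ln_gt0 // ltr1n.
by rewrite -expRM_natl mulrN mulrC divfK ?gt_eqF // expRN lnK // posrE.
Qed.

Section bump_sums.
Variables (hl : nat -> R).
Hypotheses (hl01 : forall N, 0 < hl N < 1) (hlN : forall N, hl N ^+ N.+1 = 2^-1).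

Let hl_cvg1 : hl @ \oo --> (1 : R).
Proof.
apply: subr_cvg0_seq; apply: (@squeeze0 _ _ (@harmonic R)); last exact: cvg_harmonic.
move=> N; have /andP[_ h1] := hl01 N.
rewrite ler0_norm ?subr_le0 ?(ltW h1) // opprB.
exact: (half_life_le (hl01 N) (ltn0Sn N) (hlN N)).
Qed.

Let poly_sum g p N := \sum_(0 <= j < size p) p`_j * g (hl N ^+ j).

Let geom_ratio N j : (1 - hl N) * \sum_(0 <= i < j) hl N ^+ i = 1 - hl N ^+ j.
Proof. by rewrite -{2}(expr1n R j) subrXX big_mkord; under [in RHS]eq_bigr do rewrite expr1n mul1r. Qed.

(** Powers of r tend to 1 with r, so the hypothesis on g near 1 applies to each
    term; the factor (1 - r)^2 is at most (1 - r^j)^2. *)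
Lemma poly_sum_cvg0 g p : p`_0 = 0 ->
  (forall e, 0 < e -> exists2 d, 0 < d &
    forall x, 1 - d < x < 1 -> `|(1 - x) ^+ 2 * g x| <= e) ->
  (fun N => (1 - hl N) ^+ 2 * poly_sum g p N) @ \oo --> (0 : R).
Proof.
move=> p0 hg.
rewrite (_ : (fun _ => _) = fun N => \sum_(0 <= j < size p)
    (p`_j * ((1 - hl N) ^+ 2 * g (hl N ^+ j)))); last first.
  by apply/funext => N; rewrite mulr_sumr; apply: eq_bigr => j _; rewrite mulrCA.
rewrite [X in _ --> X](_ : 0 = \sum_(0 <= j < size p) (0 : R)); last by rewrite big1.
apply: cvg_sum_nat => -[|j].
  by rewrite p0; under eq_fun do rewrite mul0r; exact: cvg_cst.
apply: cvg0Z; apply: cvg0_of_bound => e e0; have [d d0 hd] := hg e e0.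
have [N0 hN0] := cvg0_bound (cvg_subr0_seq (@cvgXr _ _ _ j.+1 hl_cvg1)) d0.
exists N0 => N /hN0; rewrite expr1n; have /andP[r0 r1] := hl01 N.
have x1 : hl N ^+ j.+1 < 1 by rewrite exprn_ilt1 // ltW.
rewrite ltr0_norm ?subr_lt0 // opprB => h.
have xd : 1 - d < hl N ^+ j.+1 < 1 by rewrite x1 andbT; lra.
apply: le_trans (hd _ xd).
have le : (1 - hl N) ^+ 2 <= (1 - hl N ^+ j.+1) ^+ 2.
  rewrite lerXn2r ?nnegrE ?subr_ge0 ?(ltW r1) ?(ltW x1) //.
  by rewrite lerD2l lerN2 exprS ler_piMr ?(ltW r0) // exprn_ile1 // ltW.
rewrite (normrM ((1 - hl N) ^+ 2)) (normrM ((1 - hl N ^+ j.+1) ^+ 2)).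
by rewrite !(ger0_norm (sqr_ge0 _)) ler_wpM2r.
Qed.

(** The total weight of the k-th bump at scale r = hl N, normalized; as r tends to 1
    it tends to [blim k]. *)
Let bmass k N := (1 - hl N) ^+ 2 * poly_sum (fun x => (1 - x) ^- 2) (bump k) N.

Let blim k := \sum_(0 <= j < size (bump k)) (bump k)`_j * j%:R ^- 2.

Lemma bmass_cvg k : bmass k @ \oo --> blim k.
Proof.
rewrite (_ : bmass k = fun N => \sum_(0 <= j < size (bump k))
    ((bump k)`_j * (\sum_(0 <= i < j) hl N ^+ i) ^- 2)); last first.
  apply/funext => N; rewrite /bmass mulr_sumr; apply: eq_bigr => -[|j] _.
    by rewrite bump0 !mul0r mulr0.
  have /andP[r0 r1] := hl01 N.
  rewrite mulrCA; congr (_ * _).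
  rewrite -geom_ratio exprMn invfM mulrA mulfV ?mul1r // expf_neq0 //.
  by rewrite subr_eq0 gt_eqF.
apply: cvg_sum_nat => -[|j].
  by rewrite bump0; under eq_fun do rewrite mul0r; rewrite mul0r; exact: cvg_cst.
apply: cvgM; first exact: cvg_cst.
apply: cvgV; first by rewrite expf_neq0 // pnatr_eq0.
apply: cvgXr; rewrite (_ : j.+1%:R = \sum_(0 <= i < j.+1) 1 ^+ i).
  by apply: cvg_sum_nat => i; exact: cvgXr hl_cvg1.
by under eq_bigr do rewrite expr1n; rewrite sumr_const_nat subn0.
Qed.

(** The window 1 <= n / (N+1) <= 1 + 1/q already carries this mass. *)
Lemma blim_ge k q : (0 < q)%N -> (16 * q%:R)^-1 * (1 - q%:R ^- 2) ^+ k <= blim k.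
Proof.
move=> q0; have q0' : 0 < (q%:R : R) by rewrite ltr0n.
apply: (ler_cvg_to (cvg_cst _) (bmass_cvg (k := k))); near=> N0.
have r01 := hl01 N0; have rN := hlN N0; have /andP[r0 r1] := r01.
set r := hl N0 in r01 rN r0 r1; pose N := N0.+1; pose M := (N %/ q).+1.
have w0 n : 0 <= n.+1%:R * 1 * (bump k).[r ^+ n].
  by rewrite mulr1 mulr_ge0 // bump_ge0 // exprn_ge0 ?(ltW r0) //= exprn_ile1 // ltW.
have cv := abel_sum_poly abel_sum1 (bump0 k) r01.
have lb : M%:R * (N%:R * (4^-1 * (1 - q%:R ^- 2) ^+ k)) <= poly_sum (fun x => (1 - x) ^- 2) (bump k) N0.
  apply: (ler_cvg_to (cvg_cst _) cv); near=> T.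
  have MT : (N + M <= T)%N by near: T; exact: nbhs_infty_ge.
  rewrite (big_cat_nat (n := N)) ?(leq_trans _ MT) ?leq_addr //=.
  rewrite (big_cat_nat (n := N + M) (m := N)) ?leq_addr //=.
  rewrite addrCA; apply: le_trans (_ : _ <= \sum_(N <= n < N + M) n.+1%:R * 1 * (bump k).[r ^+ n]) _.
    rewrite mulr_natl -[X in _ *+ X](addKn N M) -sumr_const_nat.
    apply: ler_sum_nat => n /andP[Nn nM]; rewrite mulr1.
    have q1 : 0 <= 1 - (q%:R : R) ^- 2.
      by rewrite subr_ge0 invf_le1 ?exprn_gt0 // exprn_ege1 // ler1n.
    rewrite ler_pM ?mulr_ge0 ?exprn_ge0 // ?ler_nat ?(leq_trans Nn) //.
    by apply: (bump_window r01 (ltn0Sn N0) rN k q0); rewrite Nn.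
  by rewrite lerDl addr_ge0 // sumr_ge0.
have h := half_life_ge r01 rN; rewrite -/N in h.
have q1 : 0 <= 1 - (q%:R : R) ^- 2.
  by rewrite subr_ge0 invf_le1 ?exprn_gt0 // exprn_ege1 // ler1n.
rewrite /bmass -/r; apply: le_trans (ler_wpM2l (sqr_ge0 _) lb).
set X := (1 - _ ^- 2) ^+ k; have X0 : 0 <= X by exact: exprn_ge0.
have Mq : N%:R / q%:R <= M%:R :> R.
  by rewrite ler_pdivrMr // -natrM ler_nat ltnW // /M ltn_ceil.
have N0' : 0 < (N%:R : R) by rewrite ltr0n.
have -> : (1 - r) ^+ 2 * (M%:R * (N%:R * (4^-1 * X))) =
    ((1 - r) ^+ 2 * (M%:R * N%:R) * 4^-1) * X by ring.
rewrite ler_wpM2r // invfM.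
have Y : (1 - r) ^+ 2 * (N%:R / q%:R * N%:R) <= (1 - r) ^+ 2 * (M%:R * N%:R).
  by rewrite ler_wpM2l ?sqr_ge0 // ler_wpM2r // ltW.
apply: le_trans (_ : _ <= (1 - r) ^+ 2 * (N%:R / q%:R * N%:R) * 4^-1) _; last first.
  by rewrite ler_wpM2r.
have -> : (1 - r) ^+ 2 * (N%:R / q%:R * N%:R) * 4^-1 = (N%:R * (1 - r)) ^+ 2 * 4^-1 * q%:R^-1.
  by ring.
rewrite ler_wpM2r ?invr_ge0 ?(ltW q0') //.
have : 2^-1 ^+ 2 <= (N%:R * (1 - r)) ^+ 2.
  by rewrite lerXn2r ?nnegrE ?mulr_ge0 ?subr_ge0 // ltW.
by rewrite expr2; lra.
Unshelve. all: by end_near. Qed.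

Lemma blim_gt0 k : 0 < blim k.
Proof.
apply: lt_le_trans (@blim_ge k 2 isT); rewrite mulr_gt0 ?invr_gt0 ?exprn_gt0 //.
by rewrite subr_gt0 invf_lt1 ?exprn_gt0 // exprn_egt1 // ltr1n.
Qed.

(** The masses blim k do not decay geometrically, so consecutive ones are
    eventually comparable within any factor. *)
Lemma blim_ratio e : 0 < e -> exists k, blim k - blim k.+1 <= e * blim k.
Proof.
move=> e0; apply: contrapT => /forallNP h.
have {}h k : blim k.+1 <= (1 - e) * blim k.
  by have /negP := h k; rewrite -ltNge; lra.
have [q q0 qe] : exists2 q : nat, (0 < q)%N & q%:R ^- 2 < e.
  exists (Num.bound e^-1).+1 => //.
  have b := archi_boundP (ltW (_ : 0 < e^-1)).
  have {}b : e^-1 < (Num.bound e^-1).+1%:R.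
    by apply: lt_le_trans (b _) _; rewrite ?invr_gt0 // ler_nat.
  rewrite -[ltRHS]invrK ltf_pV2 ?posrE ?invr_gt0 ?exprn_gt0 ?ltr0n //.
  by apply: lt_le_trans b _; rewrite ler_eXnr // ler1n.
have q0' : 0 < (q%:R : R) by rewrite ltr0n.
set s := 1 - (q%:R : R) ^- 2.
have e1 : 0 < 1 - e.
  have := lt_le_trans (blim_gt0 1) (h 0%N); have := blim_gt0 0%N.
  by move=> b0; rewrite pmulr_lgt0.
have s0 : 0 < s by rewrite /s; lra.
have dec k : blim k <= (1 - e) ^+ k * blim 0%N.
  elim: k => [|k ih]; first by rewrite expr0 mul1r.
  by apply: le_trans (h k) _; rewrite exprS -mulrA ler_wpM2l // ltW.
pose x := s / (1 - e) - 1.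
have x0 : 0 < x by rewrite /x subr_gt0 ltr_pdivlMr // mul1r /s; lra.
have gr (k : nat) : 1 + k%:R * x <= (1 + x) ^+ k.
  elim: k => [|k ih]; first by rewrite mul0r addr0 expr0.
  rewrite exprS -natr1; have : 0 <= k%:R * x by rewrite mulr_ge0 // ltW.
  by move: ih x0; nra.
(* By Bernoulli's inequality, geometric decay would bound a linear sequence. *)
pose A := 16 * q%:R * blim 0%N.
have up (k : nat) : k%:R * x <= A.
  have h1 := le_trans (@blim_ge k q q0) (dec k).
  have sE : s = (1 + x) * (1 - e) by rewrite /x addrC subrK divfK // gt_eqF.
  have e1k : 0 < (1 - e) ^+ k by rewrite exprn_gt0.
  have h2 : (16 * q%:R)^-1 * (1 + x) ^+ k <= blim 0%N.
    by rewrite -(ler_pM2r e1k) -mulrA -exprMn -sE [leRHS]mulrC.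
  rewrite ler_pdivrMl ?mulr_gt0 // in h2.
  by apply: le_trans h2; have := gr k; lra.
have := up (Num.bound (A / x)); rewrite -ler_pdivlMr // leNgt archi_boundP //.
by rewrite divr_ge0 ?(ltW x0) // /A !mulr_ge0 // ltW // blim_gt0.
Qed.

(** For every k the weighted mean of lam tends to 0; slow oscillation compares
    lam N with that mean, up to the spread of the weights. *)
Lemma abel_tauberian0 lam g (B D : R) : (forall n, `|lam n| <= B) ->
  (forall n, `|lam n.+1 - lam n| <= D / n.+1%:R) -> abel_sum lam g ->
  (forall e, 0 < e -> exists2 d, 0 < d &
    forall x, 1 - d < x < 1 -> `|(1 - x) ^+ 2 * g x| <= e) ->
  lam @ \oo --> (0 : R).
Proof.
move=> hB hD lg hg.
have B0 : 0 <= B by exact: le_trans (hB 0%N).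
have D0 : 0 <= D by have := le_trans (normr_ge0 _) (hD 0%N); rewrite invr1 mulr1.
pose K := 8 * D + 16 * B; have K0 : 0 <= K by rewrite /K; lra.
suff key e : 0 < e -> exists N0, forall N, (N0 <= N)%N -> `|lam N.+1| <= (1 + 3 * K) * e.
  have K1 : 0 < 1 + 3 * K by lra.
  apply: cvg0_of_bound => e e0; have [|N0 hN0] := key (e / (1 + 3 * K)); first exact: divr_gt0.
  exists N0.+1 => -[//|N] NN; have := hN0 N NN.
  by rewrite mulrC divfK // gt_eqF.
move=> e0; have e20 : 0 < e ^+ 2 / 2 by rewrite divr_gt0 // exprn_gt0.
have [k hk] := blim_ratio e20; have b0 := blim_gt0 k; set b := blim k in hk b0.
have vc := poly_sum_cvg0 (bump0 k) hg.
have bc := bmass_cvg (k := k); have bc1 := bmass_cvg (k := k.+1).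
have eb0 : 0 < e * b / 2 by rewrite divr_gt0 // mulr_gt0.
have [N1 h1] := cvg0_bound vc eb0.
have b20 : 0 < b / 2 by rewrite divr_gt0.
have [N2 h2] := cvg0_bound (cvg_subr0_seq bc) b20.
have e2b0 : 0 < e ^+ 2 * b / 2 by rewrite divr_gt0 // mulr_gt0 // exprn_gt0.
have [N3 h3] := cvg0_bound (cvg_subr0_seq (cvgB bc bc1)) e2b0.
exists (maxn N1 (maxn N2 N3)) => N; rewrite !geq_max => /and3P[/h1 {}h1 /h2 {}h2 /h3 {}h3].
move: h2 h3; rewrite !ltr_norml => /andP[h2 _] /andP[_ h3].
rewrite /bmass -/(bmass k N) -/(bmass k.+1 N) -/b in h2 h3.
have {}h3 : bmass k N - bmass k.+1 N - (b - blim k.+1) < e ^+ 2 * b / 2 := h3.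
have {}h3 : bmass k N - bmass k.+1 N <= e ^+ 2 * b by lra.
have {}h2 : b / 2 <= bmass k N by lra.
set v := (1 - hl N) ^+ 2 * poly_sum g (bump k) N in h1.
suff main : `|lam N.+1| * bmass k N <=
    `|v| + K * (e * bmass k N + e^-1 * (bmass k N - bmass k.+1 N)).
  have m0 : 0 < bmass k N by exact: lt_le_trans b20 h2.
  rewrite -(ler_pM2r m0); apply: le_trans main _.
  have t1 : `|v| <= e * bmass k N.
    by apply: le_trans (ltW h1) _; rewrite -mulrA ler_wpM2l // ltW.
  have t2 : e^-1 * (bmass k N - bmass k.+1 N) <= 2 * (e * bmass k N).
    rewrite ler_pdivrMl //; apply: le_trans h3 _.
    rewrite (_ : e * (2 * (e * bmass k N)) = e ^+ 2 * (2 * bmass k N)); last by ring.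
    by rewrite ler_wpM2l ?sqr_ge0 //; lra.
  have t3 := ler_wpM2l K0 t2; move: t1 t3; lra.
have r01 := hl01 N; have rN := hlN N; have /andP[r0 r1] := r01.
set r := hl N in r01 rN r0 r1.
have cW := abel_sum_poly abel_sum1 (bump0 k) r01.
have cW1 := abel_sum_poly abel_sum1 (bump0 k.+1) r01.
have cV := abel_sum_poly lg (bump0 k) r01.
have main : `|lam N.+1| * poly_sum (fun x => (1 - x) ^- 2) (bump k) N <=
    `|poly_sum g (bump k) N| + K * (e * poly_sum (fun x => (1 - x) ^- 2) (bump k) N +
      e^-1 * (poly_sum (fun x => (1 - x) ^- 2) (bump k) N -
              poly_sum (fun x => (1 - x) ^- 2) (bump k.+1) N)).
  pose W (i T : nat) := \sum_(0 <= n < T) n.+1%:R * 1 * (bump i).[r ^+ n].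
  pose V (T : nat) := \sum_(0 <= n < T) n.+1%:R * lam n * (bump k).[r ^+ n].
  have cL : (fun T => `|lam N.+1| * W k T) @ \oo -->
      `|lam N.+1| * poly_sum (fun x => (1 - x) ^- 2) (bump k) N.
    by apply: cvgM; [exact: cvg_cst|exact: cW].
  have cR : (fun T => `|V T| + K * (e * W k T + e^-1 * (W k T - W k.+1 T))) @ \oo -->
      `|poly_sum g (bump k) N| + K * (e * poly_sum (fun x => (1 - x) ^- 2) (bump k) N +
      e^-1 * (poly_sum (fun x => (1 - x) ^- 2) (bump k) N -
              poly_sum (fun x => (1 - x) ^- 2) (bump k.+1) N)).
    apply: cvgD; first exact: cvg_norm cV.
    apply: cvgM; first exact: cvg_cst.
    apply: cvgD; first by apply: cvgM; [exact: cvg_cst|exact: cW].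
    by apply: cvgM; [exact: cvg_cst|apply: cvgB; [exact: cW|exact: cW1]].
  apply: (ler_cvg_to cL cR); near=> T; rewrite /V /W.
  have y01 n : 0 <= r ^+ n <= 1.
    by rewrite exprn_ge0 ?(ltW r0) //= exprn_ile1 // ltW.
  pose w n := n.+1%:R * 1 * (bump k).[r ^+ n].
  have w0 n : 0 <= w n by rewrite /w mulr1 mulr_ge0 // bump_ge0.
  have -> : `|lam N.+1| * \sum_(0 <= n < T) w n =
      `|\sum_(0 <= n < T) n.+1%:R * lam n * (bump k).[r ^+ n] +
        \sum_(0 <= n < T) w n * (lam N.+1 - lam n)|.
    rewrite -big_split /= -[X in _ * X]ger0_norm ?sumr_ge0 // -normrM mulr_sumr.
    by congr `|_|; apply: eq_bigr => n _; rewrite /w; ring.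
  rewrite (le_trans (ler_normD _ _)) // lerD2l (le_trans (ler_norm_sum _ _ _)) //.
  rewrite -sumrB !mulr_sumr -big_split /= mulr_sumr; apply: ler_sum => n _.
  rewrite -mulrBr -bumpS normrM (ger0_norm (w0 n)).
  have so := slow_oscillation r01 (ltn0Sn N) rN n hB hD.
  rewrite distrC in so.
  apply: le_trans (ler_wpM2l (w0 n) so) _; rewrite -/K.
  set t := 1 - 2 * r ^+ n.
  (* A second moment bounds a first one: |t| <= e + t^2 / e. *)
  have tle : `|t| <= e + e^-1 * t ^+ 2.
    rewrite -(real_normK (num_real t)) -(ler_pM2l e0) mulrDr mulrA divff ?gt_eqF // mul1r.
    by have := sqr_ge0 (`|t| - e / 2); rewrite !expr2; have := sqr_ge0 e; rewrite expr2; lra.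
  apply: le_trans (_ : _ <= w n * (K * (e + e^-1 * t ^+ 2))) _.
    by rewrite ler_wpM2l // ler_wpM2l.
  by rewrite le_eqVlt; apply/orP; left; apply/eqP; rewrite /w; ring.
have q0 : 0 <= (1 - r) ^+ 2 by exact: sqr_ge0.
have := ler_wpM2l q0 main; rewrite /v normrM (ger0_norm q0) /bmass -/r.
lra.
Unshelve. all: by end_near. Qed.

End bump_sums.

(** Subtracting the constant sequence L, whose means are computed by [abel_sum1],
    reduces to limit 0. *)
Theorem abel_tauberian lam g (B D L : R) : (forall n, `|lam n| <= B) ->
  (forall n, `|lam n.+1 - lam n| <= D / n.+1%:R) -> abel_sum lam g ->
  (forall e, 0 < e -> exists2 d, 0 < d &
    forall x, 1 - d < x < 1 -> `|(1 - x) ^+ 2 * g x - L| <= e) ->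
  lam @ \oo --> L.
Proof.
move=> hB hD lg hg; apply: subr_cvg0_seq.
have /choice[hl hlP] : forall N, exists r : R, 0 < r < 1 /\ r ^+ N.+1 = 2^-1.
  by move=> N; have [r r01 rN] := @half_life_ex N.+1 isT; exists r.
have B0 : 0 <= B by exact: le_trans (hB 0%N).
apply: (abel_tauberian0 (fun N => (hlP N).1) (fun N => (hlP N).2)
    (lam := fun n => lam n - L) (g := fun x => g x - L * (1 - x) ^- 2)
    (B := B + `|L|) (D := D)).
- by move=> n; rewrite (le_trans (ler_normB _ _)) // lerD2r.
- by move=> n; rewrite opprB addrA subrK.
- move=> x x01; rewrite (_ : (fun _ => _) = fun T => \sum_(0 <= n < T) n.+1%:R * lam n * x ^+ n -
      L * \sum_(0 <= n < T) n.+1%:R * 1 * x ^+ n).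
    apply: cvgB; first exact: lg.
    by apply: cvgM; [exact: cvg_cst|exact: abel_sum1].
  by apply/funext => T; rewrite mulr_sumr -sumrB; apply: eq_bigr => n _; ring.
move=> e e0; have [d d0 hd] := hg e e0; exists (Num.min d 1); first by rewrite lt_min d0 ltr01.
move=> x /andP[x0 x1]; have xd : 1 - d < x < 1.
  by rewrite x1 andbT; apply: le_lt_trans x0; rewrite lerD2l lerN2 ge_min lexx.
have := hd x xd; rewrite mulrBr mulrCA mulfV ?mulr1 //.
by rewrite expf_neq0 // subr_eq0 gt_eqF.
Qed.

End tauberian.

(** * Rotations and dilations of the plane *)

Section plane_measure.
Context {R : realType}.
Local Notation leb := (@lebesgue_measure R).
Local Notation leb2 := (leb \x leb)%E.
Local Notation plane := (measurableTypeR R * measurableTypeR R)%type.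

Lemma lebesgue_measure_affine (k t : R) (A : set R) : 0 < k -> measurable A ->
  leb ((fun y => k * y + t) @^-1` A) = ((k^-1)%:E * leb A)%E.
Proof.
move=> k0 mA.
have mphi : measurable_fun setT
    (fun y : measurableTypeR R => (k * y + t : measurableTypeR R)).
  by apply: measurable_funD => //; exact: measurable_funM.
pose kk : {nonneg R} := NngNum (ltW k0).
pose m' : {measure set (measurableTypeR R) -> \bar R} :=
  mscale kk (pushforward leb (fun y : measurableTypeR R => (k * y + t : measurableTypeR R))).
have -> : leb A = m' mphi A.
  apply: lebesgue_measure_unique => // _ [[a b] _ <-] /=.
  rewrite /mscale /pushforward /=.
  rewrite [X in (_ * lebesgue_measure X)%E](_ : _ = `](a - t) / k, (b - t) / k]%classic); last first.
    apply/seteqP; split => y /=; rewrite !in_itv /= ltr_pdivrMr // ler_pdivlMr //;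
      by rewrite (mulrC y) ltrBlDr lerBrDr.
  rewrite !lebesgue_measure_itv /= !lte_fin ltr_pM2r ?invr_gt0 // ltrD2r.
  case: ifP => ab; last by rewrite mule0.
  rewrite -!EFinB -EFinM; congr EFin; field.
  by rewrite gt_eqF.
by rewrite /m' /= /mscale /pushforward /= muleA -EFinM mulVf ?gt_eqF // mul1e.
Qed.

(** Cavalieri's principle: a map that preserves each vertical line and scales its
    length by k scales area by k. *)
Lemma leb2_fiber1 (phi : R -> R -> R) (k : R) (E : set plane) :
  0 <= k -> measurable E ->
  measurable ((fun p : plane => (p.1, phi p.1 p.2) : plane) @^-1` E) ->
  (forall x (A : set R), measurable A -> leb (phi x @^-1` A) = (k%:E * leb A)%E) ->
  leb2 ((fun p : plane => (p.1, phi p.1 p.2) : plane) @^-1` E) = (k%:E * leb2 E)%E.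
Proof.
move=> k0 mE mpre hphi; rewrite /product_measure1.
rewrite -ge0_integralZl //.
- apply: eq_integral => x _ /=; rewrite -(hphi x); last exact: measurable_xsection.
  by congr leb; apply/seteqP; split => y; rewrite /xsection /= !inE.
- exact: measurable_fun_xsection.
Qed.

Lemma leb2_fiber2 (phi : R -> R -> R) (k : R) (E : set plane) :
  0 <= k -> measurable E ->
  measurable ((fun p : plane => (phi p.2 p.1, p.2) : plane) @^-1` E) ->
  (forall y (A : set R), measurable A -> leb (phi y @^-1` A) = (k%:E * leb A)%E) ->
  leb2 ((fun p : plane => (phi p.2 p.1, p.2) : plane) @^-1` E) = (k%:E * leb2 E)%E.
Proof.
move=> k0 mE mpre hphi.
have eq21 (X : set plane) : measurable X -> leb2 X = (leb \x^ leb)%E X.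
  by move=> mX; apply: product_measure_unique => // A B mA mB; rewrite /= product_measure2E.
rewrite !eq21 // /product_measure2.
rewrite -ge0_integralZl //.
- apply: eq_integral => x _ /=; rewrite -(hphi x); last exact: measurable_ysection.
  by congr leb; apply/seteqP; split => y; rewrite /ysection /= !inE.
- exact: measurable_fun_ysection.
Qed.

Lemma measurable_preimageT d d' (T : measurableType d) (T' : measurableType d')
    (f : T -> T') (E : set T') :
  measurable_fun setT f -> measurable E -> measurable (f @^-1` E).
Proof. by move=> mf mE; rewrite -[X in measurable X]setTI; exact: mf. Qed.

Definition shear1 (a : R) (p : plane) : plane := (p.1, p.2 + a * p.1).
Definition shear2 (a : R) (p : plane) : plane := (p.1 + a * p.2, p.2).

Lemma measurable_shear1 a : measurable_fun setT (shear1 a).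
Proof.
apply/measurable_fun_pair => //=.
by apply: measurable_funD => //; exact: measurable_funM.
Qed.

Lemma measurable_shear2 a : measurable_fun setT (shear2 a).
Proof.
apply/measurable_fun_pair => //=.
by apply: measurable_funD => //; exact: measurable_funM.
Qed.

Let translate (x : R) (A : set R) : measurable A ->
  leb ((fun y => y + x) @^-1` A) = (1%:E * leb A)%E.
Proof.
move=> mA; rewrite -[X in X%:E](invr1 R) -(@lebesgue_measure_affine 1 x) //.
by congr leb; apply/seteqP; split => y /=; rewrite mul1r.
Qed.

Lemma leb2_shear1 (a : R) (E : set plane) : measurable E ->
  leb2 (shear1 a @^-1` E) = leb2 E.
Proof.
move=> mE; rewrite -[RHS]mul1e.
apply: (@leb2_fiber1 (fun x y => y + a * x)) => //.
  exact: measurable_preimageT (measurable_shear1 a) mE.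
by move=> x A; exact: translate.
Qed.

Lemma leb2_shear2 (a : R) (E : set plane) : measurable E ->
  leb2 (shear2 a @^-1` E) = leb2 E.
Proof.
move=> mE; rewrite -[RHS]mul1e.
apply: (@leb2_fiber2 (fun x y => y + a * x)) => //.
  exact: measurable_preimageT (measurable_shear2 a) mE.
by move=> x A; exact: translate.
Qed.

Definition rot2 (c s : R) (p : plane) : plane :=
  (c * p.1 - s * p.2, s * p.1 + c * p.2).

Lemma measurable_rot2 c s : measurable_fun setT (rot2 c s).
Proof.
apply/measurable_fun_pair => /=.
  by apply: measurable_funB; exact: measurable_funM.
by apply: measurable_funD; exact: measurable_funM.
Qed.

(** The matrix factorization behind the rotation invariance of the area. *)
Lemma rot_shears (c s x y : R) : c ^+ 2 + s ^+ 2 = 1 -> s != 0 ->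
  let t := (c - 1) / s in let x' := x + t * y in let y' := y + s * x' in
  c * x - s * y = x' + t * y' /\ s * x + c * y = y'.
Proof.
move=> cs s0 t x' y'; have ts : t * s = c - 1 by rewrite /t divfK.
have tc : t * (c + 1) = - s.
  apply: (mulIf s0); rewrite mulrAC ts mulNr -expr2.
  by rewrite -[s ^+ 2](addKr (c ^+ 2)) cs; ring.
split.
  transitivity (x + t * s * x + y * (2 * t + t * (t * s))); last first.
    by rewrite /y' /x'; ring.
  rewrite ts (_ : 2 * t + _ = t * (c + 1)); last by ring.
  by rewrite tc; ring.
transitivity (s * x + y + t * s * y); last by rewrite /y' /x'; ring.
by rewrite ts; ring.
Qed.

(** A rotation with nonzero sine is a product of three shears; the half turn is
    the square of a quarter turn. *)
Lemma leb2_rot c s (E : set plane) : c ^+ 2 + s ^+ 2 = 1 -> measurable E ->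
  leb2 (rot2 c s @^-1` E) = leb2 E.
Proof.
have rot_sin c' s' (F : set plane) : c' ^+ 2 + s' ^+ 2 = 1 -> s' != 0 ->
    measurable F -> leb2 (rot2 c' s' @^-1` F) = leb2 F.
  move=> cs s0 mF; pose t := (c' - 1) / s'.
  have -> : rot2 c' s' @^-1` F = shear2 t @^-1` (shear1 s' @^-1` (shear2 t @^-1` F)).
    have rotE p : rot2 c' s' p = shear2 t (shear1 s' (shear2 t p)).
      by case: p => x y; have [e1 e2] := rot_shears x y cs s0; congr pair.
    by apply/seteqP; split => p; rewrite /preimage /= rotE.
  have m2 := measurable_preimageT (measurable_shear2 t) mF.
  have m1 := measurable_preimageT (measurable_shear1 s') m2.
  by rewrite (leb2_shear2 t m1) (leb2_shear1 s' m2) (leb2_shear2 t mF).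
move=> cs mE; have [s0|] := eqVneq s 0; last by move=> s0; exact: rot_sin.
move: cs; rewrite s0 expr0n addr0 => /eqP; rewrite sqrf_eq1 => /orP[/eqP c1|/eqP c1].
  congr leb2; rewrite c1 /rot2; apply/seteqP; split => -[x y]; rewrite /preimage /=;
    by rewrite !mul1r !mul0r subr0 add0r.
have -> : rot2 c 0 @^-1` E = rot2 0 1 @^-1` (rot2 0 1 @^-1` E).
  rewrite c1 /rot2; apply/seteqP; split => -[x y]; rewrite /preimage /=;
    by rewrite !mul1r !mul0r !sub0r !addr0 !mulN1r subr0 add0r.
have h : 0 ^+ 2 + 1 ^+ 2 = 1 :> R by rewrite expr0n expr1n add0r.
have m1 := measurable_preimageT (measurable_rot2 0 1) mE.
by rewrite (rot_sin _ _ _ h (oner_neq0 _) m1) (rot_sin _ _ _ h (oner_neq0 _) mE).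
Qed.

Lemma leb2_dilate (r : R) (E : set plane) : 0 < r -> measurable E ->
  leb2 ((fun p : plane => (r * p.1, r * p.2) : plane) @^-1` E) =
  ((r ^- 2)%:E * leb2 E)%E.
Proof.
move=> r0 mE.
pose D1 := (fun p : plane => (p.1, r * p.2) : plane).
pose D2 := (fun p : plane => (r * p.1, p.2) : plane).
have mD2 : measurable_fun setT D2.
  by apply/measurable_fun_pair => //=; exact: measurable_funM.
have mD1 : measurable_fun setT D1.
  by apply/measurable_fun_pair => //=; exact: measurable_funM.
have aff (A : set R) : measurable A -> leb ((fun y => r * y) @^-1` A) = ((r^-1)%:E * leb A)%E.
  by move=> mA; rewrite -(@lebesgue_measure_affine _ 0) //;
    congr leb; apply/seteqP; split => y /=; rewrite addr0.
rewrite (_ : _ @^-1` E = D1 @^-1` (D2 @^-1` E)) //.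
rewrite (@leb2_fiber1 (fun x y => r * y) r^-1) ?invr_ge0 ?(ltW r0) //; last first.
- exact: measurable_preimageT mD1 (measurable_preimageT mD2 mE).
- exact: measurable_preimageT mD2 mE.
rewrite (@leb2_fiber2 (fun x y => r * y) r^-1) ?invr_ge0 ?(ltW r0) //; last first.
  exact: measurable_preimageT mD2 mE.
by rewrite muleA -EFinM -invfM -expr2.
Qed.

End plane_measure.

(** * Maps of the disk *)

Section disk_maps.
Context {R : realType}.
Local Notation C := R[i].
Local Notation leb2 := (@lebesgue_measure R \x @lebesgue_measure R)%E.
Implicit Types (z w : disk R) (u : C).

(** The default value z is never met when u has modulus at most 1. *)
Definition dmul u z : disk R := insubd z (u * dval z).

Lemma disk_lt1 z : normc (dval z) < 1.
Proof. by case: z. Qed.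

Lemma dval_dmul u z : normc u <= 1 -> dval (dmul u z) = u * dval z.
Proof.
move=> u1; rewrite /dmul; have h : normc (u * dval z) < 1.
  rewrite normcM; apply: le_lt_trans (disk_lt1 z).
  by rewrite ler_piMl ?normc_ge0.
by rewrite insubdK.
Qed.

Lemma disk_inj z w : dval z = dval w -> z = w.
Proof. exact: val_inj. Qed.

Lemma xy_rot u z : normc u <= 1 ->
  xy (dmul u z) = rot2 (complex.Re u) (complex.Im u) (xy z).
Proof.
move=> u1; rewrite /xy dval_dmul //; case: u {u1} => a b; case: (dval z) => x y.
by rewrite /rot2 /=; congr pair; rewrite addrC.
Qed.

Lemma measurable_to_disk d (T : measurableType d) (f : T -> disk R) :
  measurable_fun setT (@xy R \o f) -> measurable_fun setT f.
Proof.
by move=> mf _ E [B mB <-]; have := mf measurableT B mB; rewrite !setTI.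
Qed.

Lemma measurable_dmul u : normc u <= 1 -> measurable_fun setT (dmul u).
Proof.
move=> u1; apply: measurable_to_disk.
rewrite (_ : _ \o _ = rot2 (complex.Re u) (complex.Im u) \o @xy R).
  exact: measurableT_comp (measurable_rot2 _ _) (@measurable_xy R).
by apply/funext => z; exact: xy_rot.
Qed.

Lemma in_range_xy (p : R * R) : p.1 ^+ 2 + p.2 ^+ 2 < 1 -> exists z : disk R, xy z = p.
Proof.
move=> p1; have : range (@xy R) p by rewrite range_xyE.
by move=> [z _ <-]; exists z.
Qed.

Lemma xy_norm z : (xy z).1 ^+ 2 + (xy z).2 ^+ 2 = normc (dval z) ^+ 2.
Proof. by rewrite sqr_normcE. Qed.

Lemma dA_rot u (E : set (disk R)) : normc u = 1 -> measurable E ->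
  dA (dmul u @^-1` E) = dA E.
Proof.
move=> u1 mE; rewrite /dA; congr (_ * _)%E.
have uu : complex.Re u ^+ 2 + complex.Im u ^+ 2 = 1 by rewrite -sqr_normcE u1 expr1n.
have u1' : normc u <= 1 by rewrite u1.
rewrite -(leb2_rot uu (measurable_xy_image mE)); congr leb2.
apply/seteqP; split => [_ [z Ez <-]|p].
  by exists (dmul u z) => //; exact: xy_rot.
move=> [w Ew wp]; have [z zp] : exists z : disk R, xy z = p.
  apply: in_range_xy; apply: (@le_lt_trans _ _ (normc (dval w) ^+ 2)); last first.
    by rewrite expr_lt1 ?normc_ge0 // disk_lt1.
  rewrite -xy_norm wp /rot2 /= le_eqVlt; apply/orP; left; apply/eqP.
  by rewrite -[LHS]mul1r -uu; ring.
exists z => //; rewrite /preimage /=; suff -> : dmul u z = w by [].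
by apply: xy_inj; rewrite xy_rot // zp wp.
Qed.

Lemma dA_dilate (r : R) (E : set (disk R)) : 0 < r <= 1 -> measurable E ->
  (forall w, E w -> normc (dval w) < r) ->
  dA (dmul r%:C @^-1` E) = ((r ^- 2)%:E * dA E)%E.
Proof.
move=> /andP[r0 r1] mE Er; rewrite /dA muleCA; congr (_ * _)%E.
have nr : normc r%:C <= 1 by rewrite normc_real gtr0_norm.
rewrite -(leb2_dilate r0 (measurable_xy_image mE)); congr leb2.
have dE z : xy (dmul r%:C z) = (r * (xy z).1, r * (xy z).2).
  by rewrite xy_rot // /rot2 /=; congr pair; ring.
apply/seteqP; split => [_ [z Ez <-]|p].
  by exists (dmul r%:C z) => //; exact: dE.
move=> [w Ew wp]; have [z zp] : exists z : disk R, xy z = p.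
  apply: in_range_xy; have := Er _ Ew.
  have r2 : 0 < r ^+ 2 by rewrite exprn_gt0.
  rewrite -(@ltr_pXn2r _ 2) ?nnegrE ?normc_ge0 ?(ltW r0) // -xy_norm wp /=.
  by rewrite !exprMn -mulrDr -[ltRHS]mulr1 ltr_pM2l.
exists z => //; rewrite /preimage /=; suff -> : dmul r%:C z = w by [].
by apply: xy_inj; rewrite dE zp wp.
Qed.

End disk_maps.

(** * Rotation-invariant functionals *)

Section radial_functionals.
Context {R : realType}.
Local Notation C := R[i].
Implicit Types (f g : disk R -> R) (F G : disk R -> C) (a : nat -> C) (r M : R).

Definition bmeas f := measurable_fun setT f /\ exists M, forall z, `|f z| <= M.

Definition cbmeas F := cmeasurable F /\ exists M, forall z, normc (F z) <= M.

(** What integration against a finite rotation-invariant signed measure provides.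
    It is used both for the area measure, to norm the Bergman space, and for the
    signed measure defining the Toeplitz operator. *)
Record radial_functional (I : (disk R -> R) -> R) : Prop := RadialFunctional {
  rf_lin : forall k f g, bmeas f -> bmeas g ->
    I (fun z => k * f z + g z) = k * I f + I g;
  rf_bound : exists2 K, 0 <= K &
    forall f M, bmeas f -> (forall z, `|f z| <= M) -> `|I f| <= K * M;
  rf_rot : forall t f, bmeas f ->
    I (fun z => f (dmul (cos t +i* sin t) z)) = I f }.

Lemma cbmeas_cst (c : C) : cbmeas (fun=> c).
Proof. by split; [exact: cmeasurable_cst|exists (normc c)]. Qed.

Lemma cbmeasD F G : cbmeas F -> cbmeas G -> cbmeas (fun z => F z + G z).
Proof.
move=> [mF [M hM]] [mG [N hN]]; split; first exact: cmeasurableD.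
by exists (M + N) => z; rewrite (le_trans (le_normcD _ _)) // lerD.
Qed.

Lemma cbmeasM F G : cbmeas F -> cbmeas G -> cbmeas (fun z => F z * G z).
Proof.
move=> [mF [M hM]] [mG [N hN]]; split; first exact: cmeasurableM.
by exists (M * N) => z; rewrite normcM ler_pM ?normc_ge0.
Qed.

Lemma cmeasurable_conj F : cmeasurable F -> cmeasurable (fun z => (F z)^*%C).
Proof.
move=> [mr mi]; split.
  by rewrite (_ : (fun _ => _) = (fun z => complex.Re (F z))) //; apply/funext => z; case: (F z).
rewrite (_ : (fun _ => _) = (fun z => - complex.Im (F z))).
  exact: measurableT_comp.
by apply/funext => z; case: (F z).
Qed.

Lemma cbmeas_conj F : cbmeas F -> cbmeas (fun z => (F z)^*%C).
Proof.
move=> [mF [M hM]]; split; first exact: cmeasurable_conj.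
by exists M => z; rewrite normc_conj.
Qed.

Lemma cbmeas_dval : cbmeas (@dval R).
Proof. by split; [exact: cmeasurable_dval|exists 1 => z; exact/ltW/disk_lt1]. Qed.

Lemma cbmeasX F n : cbmeas F -> cbmeas (fun z => F z ^+ n).
Proof.
move=> cF; elim: n => [|n ih]; first exact: (cbmeas_cst 1).
rewrite (_ : (fun _ => _) = (fun z => F z * F z ^+ n)); first exact: cbmeasM.
by apply/funext => z; rewrite exprS.
Qed.

Lemma cbmeas_sum (F : nat -> disk R -> C) N : (forall k, cbmeas (F k)) ->
  cbmeas (fun z => \sum_(0 <= k < N) F k z).
Proof.
move=> cF; elim: N => [|N ih].
  rewrite (_ : (fun _ => _) = fun=> 0); first exact: cbmeas_cst.
  by apply/funext => z; rewrite big_geq.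
rewrite (_ : (fun _ => _) = fun z => \sum_(0 <= k < N) F k z + F N z).
  exact: cbmeasD.
by apply/funext => z; rewrite big_nat_recr.
Qed.

Lemma cbmeas_Re F : cbmeas F -> bmeas (fun z => complex.Re (F z)).
Proof.
move=> [[mr _] [M hM]]; split=> //; exists M => z.
exact: le_trans (le_norm_Re _) (hM z).
Qed.

Lemma cbmeas_psum a N : cbmeas (fun z => psum a (dval z) N).
Proof.
apply: cbmeas_sum => k; apply: cbmeasM; first exact: cbmeas_cst.
exact: cbmeasX cbmeas_dval.
Qed.

Lemma cmeasurable_ps a : (forall z : disk R, cto (psum a (dval z)) (ps a (dval z))) ->
  cmeasurable (fun z => ps a (dval z)).
Proof.
move=> h; split.
  apply: (measurable_fun_cvg (fun n => (cbmeas_psum a n).1.1)) => z _.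
  exact: cto_Re (h z).
apply: (measurable_fun_cvg (fun n => (cbmeas_psum a n).1.2)) => z _.
exact: cto_Im (h z).
Qed.

Lemma cbmeas_ps a r M : 1 < r -> psbnd a r M -> cbmeas (fun z => ps a (dval z)).
Proof.
move=> r1 aM; have r0 : 0 < r by exact: lt_trans r1.
split.
  apply: cmeasurable_ps => z; apply: (ps_cto aM).
  exact: lt_trans (disk_lt1 z) r1.
exists (M / (1 - r^-1)) => z; apply: (ps_bound aM).
  by rewrite invr_ge0 (ltW r0) invf_lt1.
by rewrite mulVf ?gt_eqF // ltW // disk_lt1.
Qed.

Section radial.
Variables (I : (disk R -> R) -> R) (rI : radial_functional I).

Let mom n : R := I (fun z => normc (dval z) ^+ (2 * n)).

Lemma bmeas0 : bmeas (fun=> 0).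
Proof. by split; [exact: measurable_cst|exists 0 => z; rewrite normr0]. Qed.

Lemma rf0 : I (fun=> 0) = 0.
Proof.
have h : I (fun=> -1 * 0 + 0) = -1 * I (fun=> 0) + I (fun=> 0).
  exact: (rf_lin rI (-1) bmeas0 bmeas0).
rewrite -[RHS](addNr (I (fun=> 0))) -[X in X + _]mulN1r -h; congr I.
by apply/funext => z; rewrite mulr0 addr0.
Qed.

Lemma rfZ k f : bmeas f -> I (fun z => k * f z) = k * I f.
Proof.
move=> bf; rewrite -[RHS]addr0 -rf0 -(rf_lin rI) //; last exact: bmeas0.
by congr I; apply/funext => z; rewrite addr0.
Qed.

Lemma rfD f g : bmeas f -> bmeas g -> I (fun z => f z + g z) = I f + I g.
Proof.
move=> bf bg; rewrite -[I f]mul1r -(rf_lin rI) //.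
by congr I; apply/funext => z; rewrite mul1r.
Qed.

Lemma rfB f g : bmeas f -> bmeas g -> I (fun z => f z - g z) = I f - I g.
Proof.
move=> bf bg; rewrite addrC -mulN1r -(rf_lin rI) //.
by congr I; apply/funext => z; rewrite mulN1r addrC.
Qed.

Lemma rf_Re_sum (F : nat -> disk R -> C) N : (forall k, cbmeas (F k)) ->
  I (fun z => complex.Re (\sum_(0 <= k < N) F k z)) =
  \sum_(0 <= k < N) I (fun z => complex.Re (F k z)).
Proof.
move=> cF; elim: N => [|N ih].
  rewrite big_geq // -[RHS]rf0; congr I.
  by apply/funext => z; rewrite big_geq.
rewrite big_nat_recr //= -ih -rfD; first last.
- exact: cbmeas_Re.
- by apply: cbmeas_Re; exact: cbmeas_sum.
by congr I; apply/funext => z; rewrite big_nat_recr //= ReD.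
Qed.

Lemma de_moivre (t : R) n :
  (cos t +i* sin t) ^+ n = cos (n%:R * t) +i* sin (n%:R * t) :> C.
Proof.
elim: n => [|n ih]; first by rewrite expr0 mul0r cos0 sin0.
rewrite exprS ih -natr1 mulrDl mul1r (addrC _ t) cosD sinD.
by apply/eqP; rewrite eq_complex /=; apply/andP; split; apply/eqP; ring.
Qed.

Lemma normc_cis (t : R) : normc (cos t +i* sin t) = 1.
Proof. by rewrite /= cos2Dsin2 sqrtr1. Qed.

(** Rotating by the angle pi / |n - m| changes the sign of the integrand. *)
Lemma rf_orthogonal (b : C) n m : n != m ->
  I (fun z => complex.Re (b * dval z ^+ n * (dval z ^+ m)^*%C)) = 0.
Proof.
move=> nm; set f := (X in I X).
have bf : bmeas f.
  apply: cbmeas_Re; apply: cbmeasM.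
    by apply: cbmeasM; [exact: cbmeas_cst|exact: cbmeasX cbmeas_dval].
  by apply: cbmeas_conj; exact: cbmeasX cbmeas_dval.
have [t ht] : exists t, let u := cos t +i* sin t : C in u ^+ n * (u ^+ m)^*%C = -1.
  have key t i j : let u := cos t +i* sin t : C in
      u ^+ (i + j) * (u ^+ i)^*%C = u ^+ j.
    by rewrite /= exprD mulrAC mulc_conj normcX normc_cis !expr1n mul1r.
  have upi j : (0 < j)%N -> (cos (pi / j%:R) +i* sin (pi / j%:R)) ^+ j = -1 :> C.
    move=> j0; rewrite de_moivre mulrC divfK ?pnatr_eq0 ?gtn_eqF //.
    by rewrite cospi sinpi; apply/eqP; rewrite eq_complex /= oppr0 !eqxx.
  have [lt|gt|/eqP] := ltngtP n m; last by rewrite (negbTE nm).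
    exists (pi / (m - n)%:R) => /=; apply: (can_inj (@conjcK R)).
    rewrite conjcM conjcK mulrC; have := key (pi / (m - n)%:R) n (m - n)%N.
    rewrite /= (subnKC (ltnW lt)) => ->; rewrite upi ?subn_gt0 //.
    by apply/eqP; rewrite eq_complex /= !oppr0 !eqxx.
  exists (pi / (n - m)%:R); have := key (pi / (n - m)%:R) m (n - m)%N.
  by rewrite /= (subnKC (ltnW gt)) => ->; rewrite upi ?subn_gt0.
have := rf_rot rI t bf; rewrite (_ : (fun _ => _) = (fun z => -1 * f z)).
  by rewrite rfZ // mulN1r => /eqP; rewrite -subr_eq0 -opprD oppr_eq0 -mulr2n mulrn_eq0 => /eqP.
apply/funext => z; rewrite /f dval_dmul ?normc_cis // mulN1r.
move: ht => /=; set u := (_ +i* _) => ht.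
rewrite !exprMn conjcM (_ : _ * _ * _ =
  (u ^+ n * (u ^+ m)^*%C) * (b * dval z ^+ n * (dval z ^+ m)^*%C)); last by ring.
by rewrite ht mulN1r; case: (b * _ * _).
Qed.

Lemma rf_diag (b : C) n :
  I (fun z => complex.Re (b * dval z ^+ n * (dval z ^+ n)^*%C)) =
  complex.Re b * mom n.
Proof.
rewrite -rfZ; first congr I.
  apply/funext => z; rewrite -mulrA mulc_conj mulrC ReM_real mulrC normcX.
  by rewrite -exprM mulnC.
split.
  rewrite (_ : (fun _ => _) = fun z => complex.Re (1 * dval z ^+ n * (dval z ^+ n)^*%C)).
    apply: (cbmeas_Re _).1; apply: cbmeasM.
      by apply: cbmeasM; [exact: cbmeas_cst|exact: cbmeasX cbmeas_dval].
    by apply: cbmeas_conj; exact: cbmeasX cbmeas_dval.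
  by apply/funext => z; rewrite mul1r mulc_conj /= normcX -exprM mulnC.
exists 1 => z; rewrite ger0_norm ?exprn_ge0 ?normc_ge0 //.
by rewrite exprn_ile1 ?normc_ge0 // ltW // disk_lt1.
Qed.

(** Uniform convergence on the disk and orthogonality: pairing with a monomial
    extracts a Taylor coefficient. *)
Lemma rf_coef a r M n : 1 < r -> psbnd a r M ->
  I (fun z => complex.Re (ps a (dval z) * (dval z ^+ n)^*%C)) =
  complex.Re (a n) * mom n.
Proof.
move=> r1 aM; have r0 : 0 < r by exact: lt_trans r1.
have q01 : 0 <= r^-1 < 1 by rewrite invr_ge0 (ltW r0) invf_lt1.
have [K K0 hK] := rf_bound rI.
have cn := cbmeas_conj (cbmeasX n cbmeas_dval).
have cF := cbmeas_ps r1 aM.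
have psumI N : (n < N)%N ->
    I (fun z => complex.Re (psum a (dval z) N * (dval z ^+ n)^*%C)) =
    complex.Re (a n) * mom n.
  move=> nN; transitivity (I (fun z => complex.Re (\sum_(0 <= k < N)
      (a k * dval z ^+ k * (dval z ^+ n)^*%C)))).
    by congr I; apply/funext => z; rewrite /psum mulr_suml.
  rewrite rf_Re_sum; last first.
    move=> k; apply: cbmeasM cn; apply: cbmeasM; first exact: cbmeas_cst.
    exact: cbmeasX cbmeas_dval.
  rewrite (bigD1_seq n) //= ?mem_index_iota ?iota_uniq // rf_diag.
  by rewrite big1 ?addr0 // => k kn; rewrite rf_orthogonal.
apply/eqP; rewrite -subr_eq0 -normr_le0; apply/ler_addgt0Pl => e e0.
rewrite addr0.
have [N hN] := cvg0_bound (@geo_cvg0 _ (K * M / (1 - r^-1)) _ q01) e0.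
pose N' := maxn N n.+1.
rewrite -(psumI N') ?leq_maxr // -rfB; first last.
- by apply: cbmeas_Re; apply: cbmeasM cn; exact: cbmeas_psum.
- by apply: cbmeas_Re; apply: cbmeasM.
apply: (@le_trans _ _ (K * (M * (r^-1 ^+ N' / (1 - r^-1))))).
  apply: hK => [|z].
    rewrite (_ : (fun _ => _) = fun z => complex.Re
        ((ps a (dval z) + -1 * psum a (dval z) N') * (dval z ^+ n)^*%C)).
      apply: cbmeas_Re; apply: cbmeasM cn; apply: cbmeasD => //.
      by apply: cbmeasM; [exact: cbmeas_cst|exact: cbmeas_psum].
    by apply/funext => z; rewrite -ReB -mulrBl mulN1r.
  rewrite -ReB -mulrBl (le_trans (le_norm_Re _)) // normcM normc_conj normcX.
  rewrite -[leRHS]mulr1 ler_pM ?normc_ge0 ?exprn_ge0 ?normc_ge0 //.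
    by apply: (ps_err _ aM) => //; rewrite mulVf ?gt_eqF // ltW // disk_lt1.
  by rewrite exprn_ile1 ?normc_ge0 // ltW // disk_lt1.
have := hN N' (leq_maxl _ _) => /ltW; apply: le_trans.
by rewrite (le_trans _ (ler_norm _)) // le_eqVlt; apply/orP; left; apply/eqP; ring.
Qed.

(** The series is paired with its own partial sums: [rf_coef] evaluates each pairing,
    and the error is geometric since the radius exceeds 1. *)
Lemma rf_parseval a r M : 1 < r -> psbnd a r M ->
  (fun N => \sum_(0 <= k < N) normc (a k) ^+ 2 * mom k) @ \oo -->
  I (fun z => normc (ps a (dval z)) ^+ 2).
Proof.
move=> r1 aM; have r0 : 0 < r by exact: lt_trans r1.
have q01 : 0 <= r^-1 < 1 by rewrite invr_ge0 (ltW r0) invf_lt1.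
have [K K0 hK] := rf_bound rI.
have cF := cbmeas_ps r1 aM; have [_ [B hB]] := cF.
have psumI N : I (fun z => complex.Re (ps a (dval z) * (psum a (dval z) N)^*%C)) =
    \sum_(0 <= k < N) normc (a k) ^+ 2 * mom k.
  transitivity (I (fun z => complex.Re (\sum_(0 <= k < N)
      ((a k)^*%C * (ps a (dval z) * (dval z ^+ k)^*%C))))).
    congr I; apply/funext => z; rewrite /psum conjc_sum mulr_sumr; congr complex.Re.
    by apply: eq_bigr => k _; rewrite conjcM mulrCA.
  rewrite rf_Re_sum; last first.
    move=> k; apply: cbmeasM; first exact: cbmeas_cst.
    by apply: cbmeasM => //; exact/cbmeas_conj/cbmeasX/cbmeas_dval.
  apply: eq_bigr => k _.
  have akM := psbndZ (a k)^*%C aM.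
  have e : complex.Re ((a k)^*%C * a k) = normc (a k) ^+ 2 by rewrite mulrC mulc_conj.
  rewrite -e -(rf_coef k r1 akM).
  congr I; apply/funext => z; congr complex.Re; rewrite mulrA; congr (_ * _).
  by rewrite (psZ _ aM) // (lt_trans (disk_lt1 z)).
apply: subr_cvg0_seq.
apply: (@squeeze0 _ _ (fun N => K * B * M / (1 - r^-1) * r^-1 ^+ N)); last exact: geo_cvg0.
move=> N; rewrite -psumI -normrN opprB.
have bF2 : bmeas (fun z => normc (ps a (dval z)) ^+ 2).
  rewrite (_ : (fun _ => _) = fun z => complex.Re (ps a (dval z) * (ps a (dval z))^*%C)).
    by apply: cbmeas_Re; apply: cbmeasM => //; exact: cbmeas_conj.
  by apply/funext => z; rewrite mulc_conj.
have cFS : cbmeas (fun z => ps a (dval z) * (psum a (dval z) N)^*%C).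
  by apply: cbmeasM => //; apply: cbmeas_conj; exact: cbmeas_psum.
rewrite -rfB //; last exact: cbmeas_Re.
rewrite (_ : _ * _ = K * (B * (M * (r^-1 ^+ N / (1 - r^-1))))); last by ring.
apply: hK => [|z].
  split.
    by apply: measurable_funB; [exact: bF2.1|exact: (cbmeas_Re cFS).1].
  have [_ [b1 h1]] := bF2; have [_ [b2 h2]] := cbmeas_Re cFS.
  by exists (b1 + b2) => z; rewrite (le_trans (ler_normB _ _)) // lerD.
rewrite (_ : normc _ ^+ 2 - _ = complex.Re (ps a (dval z) *
    (ps a (dval z) - psum a (dval z) N)^*%C)); last first.
  by rewrite conjcB mulrBr ReB mulc_conj.
rewrite (le_trans (le_norm_Re _)) // normcM normc_conj ler_pM ?normc_ge0 //.
by apply: (ps_err _ aM) => //; rewrite mulVf ?gt_eqF // ltW // disk_lt1.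
Qed.

End radial.
End radial_functionals.

(** * The area measure *)

Section finite_measure_functional.
Context {R : realType}.
Implicit Types (m : {measure set (disk R) -> \bar R}) (f g : disk R -> R).

Lemma bmeas_integrable m f : (m setT < +oo)%E -> bmeas f ->
  m.-integrable setT (EFin \o f).
Proof.
move=> mfin [mf [M hM]]; apply: measurable_bounded_integrable => //.
exists M; split; first exact: num_real.
by move=> x Mx z _; exact: le_trans (hM z) (ltW Mx).
Qed.

Lemma bmeasZ k f : bmeas f -> bmeas (fun z => k * f z).
Proof.
move=> [mf [M hM]]; split; first exact: measurable_funM.
by exists (`|k| * M) => z; rewrite normrM ler_wpM2l.
Qed.

Lemma bmeasD f g : bmeas f -> bmeas g -> bmeas (fun z => f z + g z).
Proof.
move=> [mf [M hM]] [mg [N hN]]; split; first exact: measurable_funD.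
by exists (M + N) => z; rewrite (le_trans (ler_normD _ _)) // lerD.
Qed.

Lemma Rintegral_lin m k f g : (m setT < +oo)%E -> bmeas f -> bmeas g ->
  \int[m]_z (k * f z + g z) = k * \int[m]_z f z + \int[m]_z g z.
Proof.
move=> mfin bf bg; rewrite RintegralD //.
- by rewrite RintegralZl //; exact: bmeas_integrable.
- by apply: bmeas_integrable => //; exact: bmeasZ.
- exact: bmeas_integrable.
Qed.

Lemma Rintegral_bound m f M : (m setT < +oo)%E -> bmeas f ->
  (forall z, `|f z| <= M) -> `|\int[m]_z f z| <= fine (m setT) * M.
Proof.
move=> mfin bf hM.
apply: le_trans (le_normr_Rintegral _ _) _ => //; first exact: bmeas_integrable.
rewrite mulrC -Rintegral_cst //; apply: le_Rintegral => //.
- apply: bmeas_integrable => //; split; first exact: measurableT_comp bf.1.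
  by exists M => z; rewrite normr_id.
- by apply: bmeas_integrable => //; split; [exact: measurable_cst|exists `|M|].
Qed.

End finite_measure_functional.

Section area_functional.
Context {R : realType}.
Local Notation C := R[i].
Local Notation dA := (@dA R).
Implicit Types (f g : disk R -> R) (r M : R).

Lemma dA_pushforward u : normc (u : C) = 1 -> forall A, measurable A ->
  dA A = pushforward dA (dmul u) A.
Proof. by move=> u1 A mA; rewrite /pushforward dA_rot. Qed.

Lemma integral_dA_rot u f : normc (u : C) = 1 -> bmeas f ->
  \int[dA]_z f (dmul u z) = \int[dA]_z f z.
Proof.
move=> u1 bf; rewrite /Rintegral; congr fine.
have mu : measurable_fun setT (dmul u) by apply: measurable_dmul; rewrite u1.
have bfu : bmeas (f \o dmul u).
  split; first exact: measurableT_comp bf.1 mu.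
  by have [_ [M hM]] := bf; exists M => z; exact: hM.
rewrite [RHS](eq_measure_integral (pushforward dA (dmul u))); last first.
  by move=> A mA _; exact: dA_pushforward.
rewrite integral_pushforward //; first exact/measurable_EFinP/bf.1.
exact: (bmeas_integrable (dA_setT_fin) bfu).
Qed.

Lemma area_radial : radial_functional (fun f => \int[dA]_z f z).
Proof.
split.
- by move=> k f g bf bg; apply: Rintegral_lin => //; exact: dA_setT_fin.
- exists (fine (dA setT)); first by rewrite fine_ge0.
  by move=> f M bf hM; apply: Rintegral_bound => //; exact: dA_setT_fin.
- by move=> t f bf; apply: integral_dA_rot => //; exact: normc_cis.
Qed.

(** On this disc, the image of the unit disk under dilation by r, integrals are
    computed by [ge0_integral_dilate]. *)
Definition subdisk r : set (disk R) := [set w | normc (dval w) < r].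

Lemma measurable_normc_dval : measurable_fun setT (fun z : disk R => normc (dval z)).
Proof.
rewrite (_ : (fun _ => _) = fun z => Num.sqrt (normc (dval z) ^+ 2)).
  under eq_fun do rewrite -powR12_sqrt ?sqr_ge0 //.
  apply: (measurableT_comp (measurable_powR _)).
  exact: (measurable_sqr_normc cmeasurable_dval).
by apply/funext => z; rewrite sqrtr_sqr ger0_norm ?normc_ge0.
Qed.

Lemma measurable_subdisk r : measurable (subdisk r).
Proof.
rewrite (_ : subdisk r = (fun z : disk R => normc (dval z)) @^-1` `]-oo, r[).
  exact: measurable_preimageT measurable_normc_dval (measurable_itv _).
by apply/seteqP; split => z; rewrite /subdisk /preimage /= in_itv.
Qed.

Lemma ge0_integral_dilate r (g : disk R -> \bar R) : 0 < r <= 1 ->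
  measurable_fun setT g -> (forall z, 0 <= g z)%E ->
  (\int[dA]_(z in subdisk r) g z = (r ^+ 2)%:E * \int[dA]_z g (dmul r%:C z))%E.
Proof.
move=> r01 mg g0; have /andP[r0 r1] := r01.
have nr : normc r%:C <= 1 by rewrite normc_real gtr0_norm.
have mr := measurable_dmul nr.
have r20 : 0 <= r ^+ 2 by rewrite exprn_ge0 // ltW.
pose k : {nonneg R} := NngNum r20.
have preE : dmul r%:C @^-1` subdisk r = setT.
  apply/seteqP; split => // z _; rewrite /preimage /subdisk /= dval_dmul // normcM.
  by rewrite normc_real gtr0_norm // -[ltRHS]mulr1 ltr_pM2l // disk_lt1.
rewrite (eq_measure_integral (mscale k (pushforward dA (dmul r%:C)))); last first.
  move=> A mA Ar; transitivity ((r ^+ 2)%:E * dA (dmul r%:C @^-1` A))%E => //.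
  by rewrite dA_dilate // muleA -EFinM divff ?mul1e // expf_neq0 // gt_eqF.
transitivity ((r ^+ 2)%:E * \int[pushforward dA (dmul r%:C)]_(z in subdisk r) g z)%E.
  exact: (ge0_integral_mscale _ (measurable_subdisk r) k (measurable_funTS mg)
    (fun z _ => g0 z)).
have h := ge0_integral_pushforward mr dA (measurable_subdisk r) (measurable_funTS mg)
  (fun z _ => g0 z).
rewrite preE in h.
exact: (congr1 (fun x => (r ^+ 2)%:E * x)%E h).
Qed.

(** A common factor of all squared norms, kept symbolic instead of computing the
    area of the disk. *)
Definition area : R := fine (dA setT).

Lemma areaE : dA setT = area%:E.
Proof. by rewrite /area fineK // ge0_fin_numE // dA_setT_fin. Qed.

Lemma area_gt0 : 0 < area.
Proof.
rewrite -lte_fin -areaE /Defs.dA; apply: mule_gt0; first by rewrite lte_fin invr_gt0 pi_gt0.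
pose I := `[0, 1/2]%classic : set R.
have lI : lebesgue_measure I = (1/2)%:E.
  by rewrite /I lebesgue_measure_itv /= lte_fin ifT -?EFinB ?subr0 //; lra.
apply: (@lt_le_trans _ _ ((@lebesgue_measure R \x @lebesgue_measure R)%E (I `*` I))).
  rewrite product_measure1E; [|exact: measurable_itv..].
  rewrite (_ : (_ * _)%E = ((1/2) * (1/2))%:E); first by rewrite lte_fin; lra.
  by rewrite EFinM -lI.
apply: le_measure.
- by rewrite inE; apply: measurableX; exact: measurable_itv.
- by rewrite inE; exact: measurable_range_xy.
- rewrite range_xyE => -[a b] /= []; rewrite /I /= !in_itv /= => /andP[a0 a1] /andP[b0 b1].
  by rewrite !expr2; nra.
Qed.

Lemma bmeas_pow n : bmeas (fun z : disk R => normc (dval z) ^+ n).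
Proof.
split; first exact: measurable_funX measurable_normc_dval.
exists 1 => z; rewrite ger0_norm ?exprn_ge0 ?normc_ge0 //.
by rewrite exprn_ile1 ?normc_ge0 // ltW // disk_lt1.
Qed.

Let bindic r : bmeas (fun z : disk R => \1_(subdisk r) z).
Proof.
split; first by apply: measurable_indic; exact: measurable_subdisk.
by exists 1 => z; rewrite indicE; case: (_ \in _); rewrite ?normr1 ?normr0.
Qed.

Let bpow_indic n r : bmeas (fun z : disk R => normc (dval z) ^+ n * \1_(subdisk r) z).
Proof.
split; first by apply: measurable_funM; [exact: (bmeas_pow n).1|exact: (bindic r).1].
exists 1 => z; rewrite normrM -[leRHS]mulr1 ler_pM //.
  rewrite ger0_norm ?exprn_ge0 ?normc_ge0 //.
  by rewrite exprn_ile1 ?normc_ge0 // ltW // disk_lt1.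
by rewrite indicE; case: (_ \in _); rewrite ?normr1 ?normr0.
Qed.

Let moment_subdisk n r : 0 < r <= 1 ->
  \int[dA]_z (normc (dval z) ^+ n * \1_(subdisk r) z) =
  r ^+ (n + 2) * \int[dA]_z normc (dval z) ^+ n.
Proof.
move=> r01; have /andP[r0 r1] := r01.
have nr : normc r%:C <= 1 by rewrite normc_real gtr0_norm.
transitivity (fine (\int[dA]_(z in subdisk r) (normc (dval z) ^+ n)%:E)%E).
  rewrite /Rintegral; congr fine; rewrite [RHS]integral_mkcond.
  apply: eq_integral => z _; rewrite patchE indicE.
  by case: (_ \in _); rewrite ?mulr1 ?mulr0.
rewrite ge0_integral_dilate //; first last.
- by move=> z; rewrite lee_fin exprn_ge0 ?normc_ge0.
- exact/measurable_EFinP/(bmeas_pow n).1.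
under eq_integral => z _ do rewrite dval_dmul // normcM normc_real gtr0_norm // exprMn EFinM.
rewrite ge0_integralZl //; first last.
- by rewrite lee_fin exprn_ge0 // ltW.
- by move=> z _; rewrite lee_fin exprn_ge0 ?normc_ge0.
- exact/measurable_EFinP/(bmeas_pow n).1.
have fin : (\int[dA]_z (normc (dval z) ^+ n)%:E)%E \is a fin_num.
  exact: integrable_fin_num (bmeas_integrable dA_setT_fin (bmeas_pow n)).
by rewrite muleA -EFinM -exprD addnC fineM.
Qed.

(** Dilation determines the moments: the annulus r <= |w| < 1 carries the share
    1 - r^(2n+2) of the n-th moment, on which the integrand lies between r^(2n)
    and 1; let r tend to 1. *)
Lemma area_moment n : \int[dA]_z (normc (dval z) ^+ (2 * n)) = area / n.+1%:R.
Proof.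
set m := (X in X = _).
have key r : 0 < r < 1 -> r ^+ (2 * n) * (1 - r ^+ 2) * area <=
    (1 - (r ^+ 2) ^+ n.+1) * m <= (1 - r ^+ 2) * area.
  move=> /andP[r0 r1]; have r01 : 0 < r <= 1 by rewrite r0 ltW.
  have mE : (1 - (r ^+ 2) ^+ n.+1) * m = \int[dA]_z (-1 *
      (normc (dval z) ^+ (2 * n) * \1_(subdisk r) z) + normc (dval z) ^+ (2 * n)).
    rewrite (Rintegral_lin _ (@dA_setT_fin R) (bpow_indic _ _) (bmeas_pow _)).
    rewrite moment_subdisk // -/m -exprM mulnS addnC; ring.
  have aE : (1 - r ^+ 2) * area = \int[dA]_z (-1 * \1_(subdisk r) z + 1).
    rewrite Rintegral_lin //; first last.
    - by split; [exact: measurable_cst|exists 1 => z; rewrite normr1].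
    - exact: dA_setT_fin.
    rewrite Rintegral_cst // mul1r -/area.
    have := @moment_subdisk 0%N r r01.
    under eq_Rintegral do rewrite expr0 mul1r.
    under [in RHS]eq_Rintegral do rewrite expr0.
    by rewrite Rintegral_cst // mul1r -/area add0n => ->; ring.
  have b1 : bmeas (fun z : disk R => -1 * \1_(subdisk r) z + 1).
    apply: bmeasD; first exact: bmeasZ.
    by split; [exact: measurable_cst|exists 1 => z; rewrite normr1].
  have b2 : bmeas (fun z : disk R => -1 *
      (normc (dval z) ^+ (2 * n) * \1_(subdisk r) z) + normc (dval z) ^+ (2 * n)).
    by apply: bmeasD; [exact: bmeasZ|exact: bmeas_pow].
  rewrite -mulrA aE mE; apply/andP; split.
    rewrite -RintegralZl //; last exact: (bmeas_integrable dA_setT_fin b1).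
    apply: le_Rintegral => //.
    - exact: (bmeas_integrable dA_setT_fin (bmeasZ _ b1)).
    - exact: (bmeas_integrable dA_setT_fin b2).
    move=> z _; rewrite indicE; case: (boolP (z \in subdisk r)) => zr.
      by rewrite !mulr1 mulN1r !addNr mulr0.
    rewrite !mulr0 !add0r mulr1 lerXn2r ?nnegrE ?normc_ge0 ?(ltW r0) //.
    by rewrite leNgt; apply: contra zr; rewrite inE.
  apply: le_Rintegral => //.
  - exact: (bmeas_integrable dA_setT_fin b2).
  - exact: (bmeas_integrable dA_setT_fin b1).
  move=> z _; rewrite indicE; case: (boolP (z \in subdisk r)) => zr.
    by rewrite !mulr1 mulN1r !addNr.
  by rewrite !mulr0 !add0r exprn_ile1 ?normc_ge0 // ltW // disk_lt1.
have m0 : 0 <= m.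
  by rewrite /m; apply: Rintegral_ge0 => z _; rewrite exprn_ge0 ?normc_ge0.
have bern (e : R) : 0 < e < 1 -> (1 - (2 * n)%:R * e) * area <= n.+1%:R * m /\
    (1 - (2 * n)%:R * e) * (n.+1%:R * m) <= area.
  move=> /andP[e0 e1]; pose r := 1 - e.
  have r01 : 0 < r < 1 by rewrite /r; lra.
  have /andP[r0 r1] := r01; have /andP[k1 k2] := key r r01.
  have q0 : 0 < 1 - r ^+ 2 by rewrite subr_gt0 exprn_ilt1 // ltW.
  have geo : 1 - (r ^+ 2) ^+ n.+1 = (1 - r ^+ 2) * \sum_(i < n.+1) (r ^+ 2) ^+ i.
    by rewrite -{1}(expr1n _ n.+1) subrXX; congr (_ * _); apply: eq_bigr => i _; rewrite expr1n mul1r.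
  rewrite geo in k1 k2.
  have r2le j : (r ^+ 2) ^+ j <= 1 by rewrite exprn_ile1 ?exprn_ge0 ?exprn_ile1 // ltW.
  have bernou : 1 - (2 * n)%:R * e <= r ^+ (2 * n).
    elim: (2 * n)%N => [|j ih]; first by rewrite mul0r subr0 expr0.
    have rj : r ^+ j <= 1 by rewrite exprn_ile1 // ltW.
    by rewrite exprS -natr1 {1}/r; move: ih rj; nra.
  have S1 : \sum_(i < n.+1) (r ^+ 2) ^+ i <= n.+1%:R :> R.
    rewrite -[leRHS](_ : \sum_(i < n.+1) 1 = _); last by rewrite sumr_const card_ord.
    by apply: ler_sum => i _; exact: r2le.
  have S2 : n.+1%:R * r ^+ (2 * n) <= \sum_(i < n.+1) (r ^+ 2) ^+ i.
    rewrite mulr_natl -[X in _ *+ X]card_ord -sumr_const; apply: ler_sum => i _.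
    by rewrite exprM ler_wiXn2l ?exprn_ge0 ?exprn_ile1 ?(ltW r0) ?(ltW r1) // -ltnS ltn_ord.
  have k1' : r ^+ (2 * n) * area <= (\sum_(i < n.+1) (r ^+ 2) ^+ i) * m.
    by rewrite -(ler_pM2l q0) mulrCA mulrA mulrA.
  have k2' : (\sum_(i < n.+1) (r ^+ 2) ^+ i) * m <= area.
    by rewrite -(ler_pM2l q0) mulrA.
  split.
    apply: le_trans (ler_wpM2r m0 S1); apply: le_trans k1'.
    by rewrite ler_wpM2r // ltW // area_gt0.
  apply: le_trans k2'; apply: le_trans (ler_wpM2r m0 S2).
  by rewrite [leRHS]mulrAC [leRHS]mulrC ler_wpM2r // mulr_ge0.
have le_of_lim (x y : R) : 0 <= x -> (forall e : R, 0 < e < 1 -> (1 - (2 * n)%:R * e) * x <= y) -> x <= y.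
  move=> x0 h; apply/ler_addgt0Pl => d d0.
  pose N : R := (2 * n)%:R; have N0 : 0 <= N by rewrite /N ler0n.
  pose D := 1 + N * x + d; have D0 : 0 < D by rewrite /D; nra.
  have e01 : 0 < d / (2 * D) < 1.
    by rewrite divr_gt0 ?mulr_gt0 //= ltr_pdivrMr ?mulr_gt0 // mul1r /D; nra.
  have := h _ e01; rewrite -/N mulrBl mul1r lerBlDr => /le_trans; apply.
  rewrite [leRHS]addrC lerD2l (_ : _ * x = d * (N * x / (2 * D))); last by rewrite -/N; ring.
  rewrite -[leRHS]mulr1 ler_pM2l // ler_pdivrMr ?mulr_gt0 // mul1r /D.
  have := mulr_ge0 N0 x0; lra.
apply/eqP; rewrite eq_le ler_pdivlMr ?ltr0n // ler_pdivrMr ?ltr0n //.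
rewrite (mulrC m) (le_of_lim _ _ _ (fun e e01 => (bern e e01).2)) ?mulr_ge0 //.
by rewrite (le_of_lim _ _ _ (fun e e01 => (bern e e01).1)) // ltW // area_gt0.
Qed.

End area_functional.

(** * Cauchy's estimate and Parseval's identity *)

Section area_parseval.
Context {R : realType}.
Local Notation C := R[i].
Local Notation dA := (@dA R).
Local Notation c := (@area R).
Implicit Types (a : nat -> C) (r s M B : R).

Definition scaled a s n : C := a n * s%:C ^+ n.

Lemma ps_scaled a s w : ps (scaled a s) w = ps a (s%:C * w).
Proof.
rewrite /ps (_ : psum _ _ = psum a (s%:C * w)) //.
apply/funext => N; apply: eq_bigr => k _.
by rewrite /scaled exprMn mulrA.
Qed.

Lemma scaled_psbnd a s r M : 0 < s -> psbnd a r M -> psbnd (scaled a s) (r / s) M.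
Proof.
move=> s0 aM n; rewrite /scaled normcM normcX normc_real gtr0_norm //.
by rewrite -mulrA -exprMn mulrCA divff ?mulr1 // gt_eqF.
Qed.

(** Cauchy's estimate, up to a factor n + 1 that does not affect radii of
    convergence: the n-th coefficient is the mean of the series against a
    monomial. *)
Lemma cauchy_estimate a r s M B n : 0 < s < r -> psbnd a r M ->
  (forall w : C, normc w <= s -> normc (ps a w) <= B) ->
  normc (a n) * s ^+ n <= n.+1%:R * B.
Proof.
move=> /andP[s0 sr] aM hB.
have B0 : 0 <= B by apply: le_trans (hB 0 _); rewrite ?normc_ge0 // normcn0 ltW.
have [->|an0] := eqVneq (a n) 0; first by rewrite normcn0 mul0r mulr_ge0.
have n0 : 0 < normc (a n) by rewrite lt_neqAle normc_ge0 eq_sym normc_eq0 an0.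
pose u : C := (a n)^*%C * (normc (a n))^-1%:C.
have nu : normc u = 1.
  rewrite normcM normc_conj normc_real ger0_norm ?invr_ge0 ?normc_ge0 //.
  by rewrite divff // gt_eqF.
pose b := fun k => u * scaled a s k.
have r1 : 1 < r / s by rewrite ltr_pdivlMr // mul1r.
have sM := scaled_psbnd s0 aM.
have bM := psbndZ u sM.
have h := rf_coef area_radial n r1 bM.
have bn : complex.Re (b n) = normc (a n) * s ^+ n.
  have -> : b n = (a n * (a n)^*%C) * ((normc (a n))^-1%:C * s%:C ^+ n).
    by rewrite /b /u /scaled; ring.
  rewrite mulc_conj ReM_real ReM_real -rmorphXn /= expr2 mulrA mulfK // gt_eqF //.
have Re_le z : `|complex.Re (ps b (dval z) * (dval z ^+ n)^*%C)| <= B.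
  rewrite (le_trans (le_norm_Re _)) // normcM normc_conj normcX -[leRHS]mulr1.
  have zr : normc (dval z) < r / s by exact: lt_trans (disk_lt1 z) r1.
  rewrite ler_pM ?normc_ge0 ?exprn_ge0 ?normc_ge0 //; last first.
    by rewrite exprn_ile1 ?normc_ge0 // ltW // disk_lt1.
  rewrite (psZ _ sM zr).
  rewrite normcM nu mul1r ps_scaled; apply: hB.
  rewrite normcM normc_real gtr0_norm // -[leRHS]mulr1 ler_pM2l // ltW //.
  exact: disk_lt1.
have bm : bmeas (fun z : disk R => complex.Re (ps b (dval z) * (dval z ^+ n)^*%C)).
  apply: cbmeas_Re; apply: cbmeasM; first exact: cbmeas_ps r1 bM.
  exact/cbmeas_conj/cbmeasX/cbmeas_dval.
have := Rintegral_bound dA_setT_fin bm Re_le; rewrite -/area h.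
rewrite -/(b n) bn area_moment.
have c0 := @area_gt0 R.
rewrite ger0_norm; last by rewrite !mulr_ge0 ?exprn_ge0 ?normc_ge0 ?invr_ge0 ?(ltW s0) ?(ltW c0).
rewrite mulrCA ler_pM2l ?area_gt0 // ler_pdivrMr ?ltr0n //.
by rewrite (mulrC B).
Qed.

(** Radius of convergence at least 1. *)
Definition conv_disk a := forall r, 0 <= r < 1 -> exists M, psbnd a r M.

Lemma conv_disk_cto a (z : disk R) : conv_disk a -> cto (psum a (dval z)) (ps a (dval z)).
Proof.
move=> ca; have z1 := disk_lt1 z; have z0 := normc_ge0 (dval z).
pose r := (normc (dval z) + 1) / 2.
have r01 : 0 <= r < 1 by rewrite /r; apply/andP; split; lra.
by have [M aM] := ca r r01; apply: (ps_cto aM); rewrite /r; lra.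
Qed.

(** The squared Bergman norm of the N-th Taylor polynomial. *)
Definition bsum a N := \sum_(0 <= k < N) normc (a k) ^+ 2 * (c / k.+1%:R).

Lemma bterm_ge0 a k : 0 <= normc (a k) ^+ 2 * (c / k.+1%:R).
Proof. by rewrite mulr_ge0 ?sqr_ge0 ?divr_ge0 // ltW // area_gt0. Qed.

Lemma bsum_nd a : nondecreasing_seq (bsum a).
Proof. by apply: nondecreasing_series => k _ _; exact: bterm_ge0. Qed.

Lemma bsum_conv_disk a B : (forall N, bsum a N <= B) -> conv_disk a.
Proof.
move=> hB r /andP[r0 r1]; exists (1 + B / c / (1 - r)) => n.
have c0 : 0 < c := area_gt0.
have h : normc (a n) ^+ 2 * (c / n.+1%:R) <= B.
  apply: le_trans (hB n.+1); rewrite /bsum big_nat_recr //= lerDr.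
  by apply: sumr_ge0 => k _; exact: bterm_ge0.
have h2 : normc (a n) ^+ 2 <= B / c * n.+1%:R.
  by rewrite mulrAC ler_pdivlMr // -ler_pdivrMr ?ltr0n // -mulrA.
have nr : r ^+ n <= 1 by rewrite exprn_ile1 // ltW.
have rn0 : 0 <= r ^+ n by rewrite exprn_ge0.
have n2 : normc (a n) <= 1 + normc (a n) ^+ 2.
  by have := sqr_ge0 (normc (a n) - 1); rewrite sqrrB1 !expr2; have := normc_ge0 (a n); nra.
apply: (@le_trans _ _ ((1 + B / c * n.+1%:R) * r ^+ n)).
  by rewrite ler_wpM2r // (le_trans n2) // lerD2l.
rewrite mulrDl mul1r lerD // -mulrA ler_wpM2l //.
  by rewrite divr_ge0 ?(ltW c0) // (le_trans _ h) // bterm_ge0.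
by apply: natr_geo_le; rewrite r0.
Qed.

Let F a (z : disk R) := (normc (ps a (dval z)) ^+ 2)%:E.

Let mF a : conv_disk a -> measurable_fun setT (F a).
Proof.
move=> ca; apply/measurable_EFinP/measurable_sqr_normc.
by apply: cmeasurable_ps => z; exact: conv_disk_cto.
Qed.

Let F0 a z : (0 <= F a z)%E.
Proof. by rewrite lee_fin sqr_ge0. Qed.

(** Rescaled to the unit disk, the series converges beyond the boundary, where
    [rf_parseval] applies. *)
Let parseval_subdisk a r : conv_disk a -> 0 < r < 1 ->
  exists2 I : R, (\int[dA]_(z in subdisk r) F a z = (r ^+ 2 * I)%:E)%E &
    bsum (scaled a r) @ \oo --> I.
Proof.
move=> ca /andP[r0 r1]; pose s := (r + 1) / 2.
have s01 : 0 <= s < 1 by rewrite /s; apply/andP; split; lra.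
have [M aM] := ca s s01.
have sr1 : 1 < s / r by rewrite ltr_pdivlMr // mul1r /s; lra.
have sM := scaled_psbnd r0 aM.
exists (\int[dA]_z normc (ps (scaled a r) (dval z)) ^+ 2); last first.
  have := rf_parseval area_radial sr1 sM; rewrite (_ : (fun _ => _) = bsum (scaled a r)) //.
  by apply/funext => N; apply: eq_bigr => k _; rewrite area_moment.
have r01 : 0 < r <= 1 by rewrite r0 ltW.
have nr : normc r%:C <= 1 by rewrite normc_real gtr0_norm // ltW.
have e : (\int[dA]_z F a (dmul r%:C z) =
    (\int[dA]_z normc (ps (scaled a r) (dval z)) ^+ 2)%:E)%E.
  rewrite /Rintegral fineK; last first.
    apply: integrable_fin_num => //; apply: (bmeas_integrable dA_setT_fin).
    have cF := cbmeas_ps sr1 sM.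
    rewrite (_ : (fun _ => _) = fun z => complex.Re (ps (scaled a r) (dval z) *
      (ps (scaled a r) (dval z))^*%C)).
      by apply: cbmeas_Re; apply: cbmeasM => //; exact: cbmeas_conj.
    by apply/funext => z; rewrite mulc_conj.
  apply: eq_integral => z _; rewrite ps_scaled -(dval_dmul z nr).
  by [].
by rewrite (ge0_integral_dilate r01 (mF ca) (F0 a)) e -EFinM.
Qed.

Let rseq (j : nat) : R := 1 - j.+2%:R^-1.

Let rseq01 j : 0 < rseq j < 1.
Proof.
rewrite /rseq subr_gt0 invf_lt1 ?ltr0n // ltr1n /= gtrBl invr_gt0 ltr0n //.
Qed.

Let rseq_cvg : rseq @ \oo --> (1 : R).
Proof.
rewrite -[X in _ --> X](subr0 1); apply: cvgB; first exact: cvg_cst.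
have := @cvg_harmonic R; rewrite -(cvg_shiftS (@harmonic R)); exact.
Qed.

Let rseq_le i j : (i <= j)%N -> rseq i <= rseq j.
Proof. by move=> ij; rewrite lerD2l lerN2 lef_pV2 ?posrE ?ltr0n // ler_nat !ltnS. Qed.

Let subdisk_cover : \bigcup_j subdisk (rseq j) = [set: disk R].
Proof.
apply/seteqP; split => // z _; have z1 := disk_lt1 z.
have [N hN] : exists N, normc (dval z) < rseq N.
  have gap : 0 < 1 - normc (dval z) by rewrite subr_gt0.
  have [N hN] := cvg0_bound (cvg_subr0_seq rseq_cvg) gap.
  exists N; have := hN N (leqnn _); have /andP[_ rN] := rseq01 N.
  by rewrite ltr0_norm ?subr_lt0 // opprB; lra.
by exists N.
Qed.

Let scaled_le a r N : 0 < r < 1 -> bsum (scaled a r) N <= bsum a N.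
Proof.
move=> /andP[r0 r1]; apply: ler_sum => k _.
rewrite ler_wpM2r ?divr_ge0 ?(ltW (@area_gt0 R)) //.
rewrite lerXn2r ?nnegrE ?normc_ge0 // /scaled normcM normcX normc_real gtr0_norm //.
by rewrite ler_piMr ?normc_ge0 // exprn_ile1 // ltW.
Qed.

(** Fatou's half of Parseval: on the disc of radius r the identity holds by
    uniform convergence, and the discs exhaust the unit disk. *)
Lemma integral_ps_le a B : (forall N, bsum a N <= B) ->
  (\int[dA]_z (normc (ps a (dval z)) ^+ 2)%:E <= B%:E)%E.
Proof.
move=> hB; have ca := bsum_conv_disk hB.
have B0 : 0 <= B by apply: le_trans (hB 0%N); rewrite /bsum big_geq.
have cvg := @ge0_nondecreasing_set_cvg_integral _ _ R (fun j => subdisk (rseq j)) (F a) dA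
  _ (fun j => measurable_subdisk _) (fun j => measurable_funTS (mF ca))
  (fun j z _ => F0 a z).
rewrite subdisk_cover in cvg.
rewrite -(cvg_lim _ (cvg _)) //; last first.
  move=> i j ij; apply/subsetPset => z; rewrite /subdisk /= => /lt_le_trans; apply.
  exact: rseq_le.
apply: lime_le.
  apply/cvg_ex; exists (\int[dA]_x F a x)%E; apply: cvg.
  move=> i j ij; apply/subsetPset => z; rewrite /subdisk /= => /lt_le_trans; apply.
  exact: rseq_le.
near=> j; have [I -> cI] := parseval_subdisk ca (rseq01 j).
have /andP[r0 r1] := rseq01 j.
have IB : I <= B.
  apply: (ler_cvg_to cI (cvg_cst B)); near=> N.
  exact: le_trans (scaled_le a N (rseq01 j)) (hB N).
rewrite lee_fin; apply: le_trans (_ : 1 * B <= B); last by rewrite mul1r.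
have I0 : 0 <= I.
  apply: (ler_cvg_to (cvg_cst 0) cI); near=> N.
  by apply: sumr_ge0 => k _; exact: bterm_ge0.
by rewrite ler_pM ?sqr_ge0 // exprn_ile1 // ltW.
Unshelve. all: by end_near. Qed.

(** The other half follows by dropping the part of the integral outside the disc
    of radius r and letting r tend to 1. *)
Lemma le_integral_ps a B : conv_disk a ->
  (\int[dA]_z (normc (ps a (dval z)) ^+ 2)%:E <= B%:E)%E ->
  forall N, bsum a N <= B.
Proof.
move=> ca hB N.
have le j : rseq j ^+ 2 * bsum (scaled a (rseq j)) N <= B.
  have /andP[r0 r1] := rseq01 j.
  have [I hI cI] := parseval_subdisk ca (rseq01 j).
  have : (\int[dA]_(z in subdisk (rseq j)) F a z <= B%:E)%E.
    apply: le_trans hB; apply: ge0_subset_integral => //.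
    - exact: measurable_subdisk.
    - exact: mF.
  rewrite hI lee_fin; apply: le_trans; rewrite ler_wpM2l ?sqr_ge0 //.
  apply: (ler_cvg_to (cvg_cst _) cI); near=> K; apply: bsum_nd.
  by near: K; exact: nbhs_infty_ge.
have lim : (fun j => rseq j ^+ 2 * bsum (scaled a (rseq j)) N) @ \oo -->
    1 ^+ 2 * bsum (scaled a 1) N.
  apply: cvgM; first by rewrite !expr2; apply: cvgM.
  rewrite /bsum; apply: cvg_sum_nat => k.
  have e r : normc (scaled a r k) = normc (a k) * `|r| ^+ k.
    by rewrite /scaled normcM normcX normc_real.
  under eq_fun do rewrite e; rewrite e.
  apply: cvgM; last exact: cvg_cst.
  have cn : (fun j => normc (a k) * `|rseq j| ^+ k) @ \oo --> normc (a k) * `|1| ^+ k.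
    by apply: cvgM; [exact: cvg_cst|apply: cvgXr; exact: cvg_norm].
  by rewrite !expr2; apply: cvgM.
have s1 : bsum (scaled a 1) N = bsum a N.
  by apply: eq_bigr => k _; rewrite /scaled expr1n mulr1.
rewrite expr1n mul1r s1 in lim.
by apply: (ler_cvg_to lim (cvg_cst B)); near=> j; exact: le.
Unshelve. all: by end_near. Qed.

End area_parseval.

(** * Taylor expansion on the whole disk *)

Section global_taylor.
Context {R : realType}.
Local Notation C := R[i].
Implicit Types (a b : nat -> C) (r s M : R) (f : disk R -> C) (z w h : C).

(** Power series agreeing near 0 have the same coefficients, by Cauchy's estimate
    with bound 0. *)
Lemma ps_inj a b r e M M' : 0 < e < r -> psbnd a r M -> psbnd b r M' ->
  (forall w, normc w <= e -> ps a w = ps b w) -> a = b.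
Proof.
move=> /andP[e0 er] aM bM ab; apply/funext => n; apply/eqP; rewrite -subr_eq0.
have dM := psbndD (-1) (ltW (lt_trans e0 er)) bM aM.
have e0r : 0 < e < r by rewrite e0.
have := cauchy_estimate (B := 0) n e0r dM _; rewrite mulr0 => h.
have {h} : normc (-1 * b n + a n) * e ^+ n <= 0.
  apply: h => w we; rewrite (psD _ bM aM (le_lt_trans we er)) ab //.
  by rewrite mulN1r addNr normcn0.
rewrite pmulr_lle0 ?exprn_gt0 // => h.
by rewrite -normc_eq0 eq_le normc_ge0 andbT addrC -mulN1r.
Qed.

Definition locally_ps f z d M := exists2 b, psbnd b d M &
  forall w : disk R, normc (dval w - z) < d -> f w = ps b (dval w - z).

Lemma locally_ps_le f z d d' M M' : 0 <= d' <= d -> M <= M' ->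
  locally_ps f z d M -> locally_ps f z d' M'.
Proof.
move=> /andP[d0 dd] MM [b bM hb]; exists b => [n|w wd].
  by apply: le_trans MM; apply: (psbnd_le _ bM); rewrite d0.
by apply: hb; exact: lt_le_trans wd dd.
Qed.

(** Expanding a local power series about nearby points makes its radius and its
    coefficient bound locally uniform. *)
Lemma analytic_locally f (z0 : disk R) : analytic f ->
  exists2 d, 0 < d & exists M, forall z, normc (z - dval z0) < d -> locally_ps f z d M.
Proof.
move=> /(_ z0)[r r0 [a ha]].
have z1 := disk_lt1 z0; set y := dval z0 in z1 ha *.
pose p := Num.min r (1 - normc y) / 2.
have p0 : 0 < p by rewrite divr_gt0 // lt_min r0 subr_gt0.
have pr : p < r by rewrite ltr_pdivrMr // gt_min; apply/orP; left; lra.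
have py : normc y + p < 1.
  by rewrite addrC -ltrBrDr ltr_pdivrMr // gt_min; apply/orP; right; lra.
have np : normc p%:C = p by rewrite normc_real gtr0_norm.
have [M0 aM] : exists M0, psbnd a p M0.
  have yp : normc (y + p%:C) < 1 by rewrite (le_lt_trans (le_normcD _ _)) // np.
  have := ha (Disk _ yp); rewrite /= addrAC subrr add0r np => /(_ pr)/cto_cvg h.
  by have [M hM] := cto_psbnd h; exists M; rewrite -np.
have fps (w : disk R) : normc (dval w - y) < p -> f w = ps a (dval w - y).
  move=> wp; apply/esym/ps_eq/cto_cvg; apply: ha; exact: lt_trans wp pr.
exists (p / 4); first by rewrite divr_gt0.
exists (M0 / (1 - 2^-1)) => z zy; have zy0 := normc_ge0 (z - y).
exists (taylor a (z - y)).
  apply: (taylor_psbnd aM); [|by rewrite divr_ge0 // ltW|lra|lra].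
  by rewrite invr_ge0 ler0n /= invf_lt1 ?ltr1n.
move=> w wz; have e : dval w - y = (z - y) + (dval w - z) by ring.
have lt : normc (z - y) + normc (dval w - z) < p by lra.
rewrite fps; last by rewrite e (le_lt_trans (le_normcD _ _)).
by rewrite [in LHS]e; apply/esym/ps_eq; exact: ps_taylor aM lt.
Qed.

Lemma normc_sub_lt (x y x' y' e : R) : `|x - x'| < e -> `|y - y'| < e ->
  normc (x' +i* y' - (x +i* y)) < e + e.
Proof.
move=> xe ye; rewrite normc_distC; have := le_normc_ReIm (x +i* y - (x' +i* y')).
by move=> /le_lt_trans; apply; exact: ltrD.
Qed.

(** Compactness of the disc |z| <= s, through a square containing it: the integer m
    stands for both the coefficient bound m and the radius 1/(m+1). *)
Lemma analytic_uniform f s : analytic f -> s < 1 ->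
  exists2 d, 0 < d & exists M, forall z, normc z <= s -> locally_ps f z d M.
Proof.
move=> af s1.
pose P (m : nat) (p : R * R) :=
  normc (p.1 +i* p.2) <= s -> locally_ps f (p.1 +i* p.2) m.+1%:R^-1 m%:R.
pose K : set (R * R) := `[-1, 1]%classic `*` `[-1, 1]%classic.
have cK : compact K by apply: compact_setX; exact: segment_compact.
have /compact_near_coveringP/(_ _ \oo P eventually_filter) := cK.
have dist (p p' : R * R) e : ball p e p' ->
    normc ((p'.1 +i* p'.2) - (p.1 +i* p.2) : C) < e + e.
  by move=> [/= b1 b2]; exact: normc_sub_lt b1 b2.
have step p : K p -> \forall p' \near p & m \near \oo, P m p'.
  move=> _; have [ps|sp] := leP (normc (p.1 +i* p.2)) s; last first.
    pose e := (normc (p.1 +i* p.2) - s) / 4.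
    have e0 : 0 < e by rewrite divr_gt0 // subr_gt0.
    exists (ball p e, setT) => /=; first by split; [exact: nbhsx_ballx|exact: filterT].
    move=> [p' m] [/= /dist d _]; change (P m p') => p's.
    have := dist_normc (p'.1 +i* p'.2) (p.1 +i* p.2); rewrite ler_norml => /andP[h _].
    by exfalso; move: d h p's; rewrite /e; lra.
  have [d d0 [M hM]] := analytic_locally (Disk _ (le_lt_trans ps s1)) af.
  have [N NM] : exists N : nat, M <= N%:R /\ d^-1 <= N%:R.
    exists (Num.bound (`|M| + d^-1)).
    have := archi_boundP (_ : 0 <= `|M| + d^-1); rewrite addr_ge0 ?invr_ge0 ?(ltW d0) //.
    move=> /(_ isT)/ltW h; split; apply: le_trans h.
      by rewrite (le_trans (ler_norm _)) // lerDl invr_ge0 ltW.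
    by rewrite lerDr.
  exists (ball p (d / 2), [set m | (N <= m)%N]) => /=.
    split; first by apply: nbhsx_ballx; rewrite divr_gt0.
    by exists N.
  move=> [p' m] [/= /dist dp Nm]; change (P m p') => _.
  have Nm' : (N%:R : R) <= m%:R by rewrite ler_nat.
  have {}dp : normc (p'.1 +i* p'.2 - (p.1 +i* p.2)) < d by move: dp; lra.
  apply: locally_ps_le (hM _ dp); last exact: le_trans NM.1 Nm'.
  rewrite invr_ge0 ler0n /= -[leRHS]invrK lef_pV2 ?posrE ?ltr0n ?invr_gt0 //.
  by rewrite (le_trans NM.2) // (le_trans Nm') // ler_nat.
move=> /(_ step)[N _ hN].
exists N.+1%:R^-1; first by rewrite invr_gt0 ltr0n.
exists N%:R => z zs; have := hN N (leqnn _) (complex.Re z, complex.Im z).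
have in1 (x : R) : `|x| <= normc z -> -1 <= x <= 1.
  by move=> xz; rewrite -ler_norml; move: xz zs s1; lra.
rewrite /P /=; case: z zs in1 => x y zs in1; apply=> //.
by split; rewrite /= in_itv /= in1 //; [exact: (le_norm_Re (x +i* y))|exact: (le_norm_Im (x +i* y))].
Qed.

(** The disc of radius r is the part already reached by the expansion a of f at 0;
    [expands_step] enlarges it. *)
Definition expands f a r :=
  (forall t, 0 <= t < r -> exists M, psbnd a t M) /\
  forall w : disk R, normc (dval w) < r -> f w = ps a (dval w).

(** The Taylor coefficients of f at the points of the disc of radius r are bounded
    by M d^-k; as functions of the point they are power series, so Cauchy's
    estimate bounds their coefficients, and the binomial theorem turns these
    bounds into convergence of a on the disc of radius r + d/4. *)
Lemma expands_step f a d M s r : s < 1 -> 0 < d <= r -> r <= s ->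
  (forall z, normc z <= s -> locally_ps f z d M) ->
  expands f a r -> expands f a (r + d / 4).
Proof.
move=> s1 /andP[d0 dr] rs loc [ca fa].
have r0 : 0 < r by exact: lt_le_trans dr.
(* Local expansions agree with the re-expansion of a. *)
have tay z b : normc z < r -> psbnd b d M ->
    (forall w : disk R, normc (dval w - z) < d -> f w = ps b (dval w - z)) ->
    taylor a z = b.
  move=> zr bM hb; have z0 := normc_ge0 z.
  pose t := (normc z + r) / 2; pose e := Num.min (d / 2) ((r - normc z) / 8).
  have e0 : 0 < e by rewrite lt_min !divr_gt0 // subr_gt0.
  have ed : e <= d / 2 by rewrite ge_min lexx.
  have er : e <= (r - normc z) / 8 by rewrite ge_min lexx orbT.
  have tr : 0 <= t < r by rewrite /t; apply/andP; split; lra.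
  have [M' aM] := ca t tr.
  pose e2 := 2 * e.
  pose q := (normc z + e2) / t.
  have t0 : 0 < t by rewrite /t; lra.
  have q01 : 0 <= q < 1.
    apply/andP; split; first by rewrite divr_ge0 // /e2; lra.
    by rewrite ltr_pdivrMr // mul1r /t /e2; lra.
  have tM : psbnd (taylor a z) e2 (M' / (1 - q)).
    apply: (taylor_psbnd aM) => //; rewrite ?/e2; [lra|rewrite /q divfK ?gt_eqF //|rewrite /t; lra].
  have bM' : psbnd b e2 M by apply: (psbnd_le _ bM); rewrite /e2; apply/andP; split; lra.
  apply: (ps_inj (e := e)) tM bM' _; first by rewrite /e2; apply/andP; split; lra.
  move=> h he; have zh : normc (z + h) < r by rewrite (le_lt_trans (le_normcD _ _)) //; lra.
  have zh1 : normc (z + h) < 1 by apply: (lt_le_trans zh); lra.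
  have eh : z + h - z = h by ring.
  transitivity (f (Disk _ zh1)).
    have zht : normc z + normc h < t by rewrite /t; lra.
    by rewrite (fa (Disk _ zh1) zh); exact: ps_eq (ps_taylor aM zht).
  by rewrite hb /= eh //; lra.
have tbound z k : normc z < r -> normc (taylor a z k) * d ^+ k <= M.
  move=> zr; have zs : normc z <= s by rewrite ltW // (lt_le_trans zr).
  have [b bM hb] := loc z zs.
  by rewrite (tay _ _ zr bM hb).
have M0 : 0 <= M.
  apply: le_trans (tbound 0 0%N _); last by rewrite normcn0.
  by rewrite mulr_ge0 ?normc_ge0 ?exprn_ge0 // ltW.
(* Shrinking r by d/8 and moving out by d/2 still gains more than d/4. *)
pose t := r - d / 8; have t0 : 0 < t by rewrite /t; lra.
have dbound k n : normc (dercoef a k n) * t ^+ n <= n.+1%:R * (M / d ^+ k).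
  pose x := r - d / 16; pose y := d / 32.
  have xyr : 0 <= x + y < r by rewrite /x /y; apply/andP; split; lra.
  have [M' aM] := ca (x + y) xyr.
  have dM : psbnd (dercoef a k) x (M' / y ^+ k).
    by apply: (dercoef_psbnd k _ _ _ aM); rewrite /x /y; lra.
  apply: (cauchy_estimate _ _ dM); first by rewrite t0 /x /t; lra.
  by move=> w wt; rewrite ler_pdivlMr ?exprn_gt0 //; apply: tbound; rewrite /t in wt; lra.
pose q := t + d / 2.
have abound N : normc (a N) * q ^+ N <= N.+1%:R * (2 * M).
  rewrite /q exprDn mulr_sumr.
  apply: (@le_trans _ _ (\sum_(i < N.+1) N.+1%:R * (M * 2^-1 ^+ i))).
    apply: ler_sum => i _; have iN : (i <= N)%N by rewrite -ltnS.
    have := dbound i (N - i)%N; rewrite /dercoef subnK // normcM normc_nat.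
    rewrite mulrA -ler_pdivlMr ?exprn_gt0 // => h.
    rewrite -mulr_natl.
    rewrite (_ : _ * (_ * _) =
      'C(N, i)%:R * normc (a N) * t ^+ (N - i) * (d / 2) ^+ i); last by ring.
    have h' : 'C(N, i)%:R * normc (a N) * t ^+ (N - i) <= (N - i).+1%:R * M / d ^+ i.
      by move: h; rewrite ler_pdivlMr ?exprn_gt0 //.
    apply: (@le_trans _ _ ((N - i).+1%:R * M / d ^+ i * (d / 2) ^+ i)).
      by rewrite ler_wpM2r // exprn_ge0 // divr_ge0 // ltW.
    rewrite exprMn (_ : _ / _ * _ = (N - i).+1%:R * (M * 2^-1 ^+ i)); last first.
      by field; rewrite expf_neq0 // gt_eqF.
    rewrite ler_wpM2r ?mulr_ge0 ?exprn_ge0 ?invr_ge0 //.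
    by rewrite ler_nat ltnS leq_subr.
  rewrite -!mulr_sumr ler_wpM2l // mulrC ler_wpM2r //.
  rewrite -(big_mkord xpredT (fun i => 2^-1 ^+ i)).
  apply: le_trans (@geo_sum_le R 2^-1 0 N.+1 _) _.
    by rewrite invr_ge0 ler0n /= invf_lt1 ?ltr1n.
  by rewrite expr0 mul1r (_ : 1 - 2^-1 = 2^-1) ?invrK //; lra.
have cv u : 0 <= u < r + d / 4 -> exists M', psbnd a u M'.
  move=> /andP[u0 u1]; have q0 : 0 < q by rewrite /q; lra.
  have uq : 0 <= u / q < 1.
    by rewrite divr_ge0 ?(ltW q0) //= ltr_pdivrMr // mul1r /q /t; lra.
  exists (2 * M * (1 - u / q)^-1) => N.
  have -> : u ^+ N = q ^+ N * (u / q) ^+ N by rewrite -exprMn mulrC divfK // gt_eqF.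
  rewrite mulrA; apply: le_trans (ler_wpM2r _ (abound N)) _.
    by rewrite exprn_ge0 //; case/andP: uq.
  rewrite mulrAC mulrC ler_wpM2l ?mulr_ge0 //; exact: natr_geo_le.
split=> // w wr; have [|rw] := ltP (normc (dval w)) r; first exact: fa.
have w0 : 0 < normc (dval w) by lra.
(* z is the point of the ray through w at distance d/2 before w. *)
pose l := 1 - (d / 2) / normc (dval w); pose z := l%:C * dval w.
have l0 : 0 <= l by rewrite subr_ge0 ler_pdivrMr // mul1r; lra.
have nz : normc z = normc (dval w) - d / 2.
  by rewrite normcM normc_real ger0_norm // mulrBl mul1r divfK // gt_eqF.
have wz : dval w - z = ((d / 2) / normc (dval w))%:C * dval w.
  rewrite -[X in X - _]mul1r -mulrBl; congr (_ * _).
  by rewrite /l rmorphB /= opprB addrC subrK.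
have nwz : normc (dval w - z) = d / 2.
  by rewrite wz normcM normc_real ger0_norm ?divfK ?gt_eqF // divr_ge0 ?normc_ge0 //; lra.
have zr : normc z < r by lra.
have zs : normc z <= s by lra.
have [b bM hb] := loc z zs.
rewrite hb ?nwz; last by lra.
rewrite -(tay _ _ zr bM hb).
pose u := (normc (dval w) + (r + d / 4)) / 2.
have ur : 0 <= u < r + d / 4 by rewrite /u; apply/andP; split; lra.
have [M' aM] := cv u ur.
have -> : ps a (dval w) = ps a (z + (dval w - z)) by congr ps; ring.
by apply: ps_eq; apply: (ps_taylor aM); rewrite nz nwz /u; lra.
Qed.

Lemma expands_le f a r r' : r' <= r -> expands f a r -> expands f a r'.
Proof.
move=> rr [ca fa]; split=> [t /andP[t0 tr]|w wr].
  by apply: ca; rewrite t0 (lt_le_trans tr).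
by apply: fa; exact: lt_le_trans wr rr.
Qed.

(** Below any s < 1 the radius of the expansion grows by a fixed step, so finitely
    many steps reach s. *)
Theorem analytic_expands f : analytic f ->
  exists2 a, conv_disk a & forall z : disk R, f z = ps a (dval z).
Proof.
move=> af; have [e e0 [Me he]] := analytic_locally point af.
have p0 : dval (point : disk R) = 0 by [].
rewrite p0 in he.
have e00 : normc (0 - 0 : C) < e by rewrite subr0 normcn0.
have [a aMe fa] := he 0 e00.
have ex s : 0 < s < 1 -> expands f a s.
  move=> /andP[s0 s1]; have [d1 d10 [M hM]] := analytic_uniform af s1.
  pose d := Num.min d1 (Num.min e s).
  have d0 : 0 < d by rewrite !lt_min d10 e0 s0.
  have dd1 : d <= d1 by rewrite ge_min lexx.
  have de : d <= e by rewrite !ge_min lexx orbT.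
  have ds : d <= s by rewrite !ge_min lexx !orbT.
  have loc z : normc z <= s -> locally_ps f z d M.
    by move=> zs; apply: (locally_ps_le _ (lexx M) (hM z zs)); rewrite dd1 ltW.
  have steps (j : nat) : expands f a (Num.min s (d + j%:R * (d / 4))).
    elim: j => [|j ih].
      rewrite mul0r addr0 min_r //; split=> [t /andP[t0 td]|w wd].
        by exists Me; apply: (psbnd_le _ aMe); rewrite t0 (le_trans (ltW td)).
      by rewrite fa subr0 // (lt_le_trans wd).
    set r := Num.min _ _ in ih.
    have jd : 0 <= j%:R * (d / 4) by rewrite mulr_ge0 // divr_ge0 // ltW.
    have dr : d <= r by rewrite /r le_min ds lerDl.
    have rs : r <= s by rewrite /r ge_min lexx.
    apply: expands_le (expands_step s1 _ rs loc ih); last by rewrite d0.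
    have [sj|js] := leP s (d + j%:R * (d / 4)).
      by rewrite /r (min_l sj) ge_min; apply/orP; left; lra.
    by rewrite /r (min_r (ltW js)) -natr1 ge_min; apply/orP; right; lra.
  have := steps (Num.bound (s / (d / 4))); apply: expands_le.
  rewrite le_min lexx /=; apply: le_trans (_ : _ <= s / (d / 4) * (d / 4)) _.
    by rewrite divfK // gt_eqF // divr_gt0.
  apply: (@le_trans _ _ ((Num.bound (s / (d / 4)))%:R * (d / 4))); last by rewrite lerDr ltW.
  rewrite ler_wpM2r // ?divr_ge0 ?(ltW d0) // ltW // archi_boundP //.
  by rewrite !divr_ge0 // ltW.
exists a => [r /andP[r0 r1]|z].
  have /ex[h _] : 0 < (1 + r) / 2 < 1 by apply/andP; split; lra.
  by apply: h; rewrite r0 /=; lra.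
have z1 := disk_lt1 z; have z0 := normc_ge0 (dval z).
have /ex[_ h] : 0 < (1 + normc (dval z)) / 2 < 1 by apply/andP; split; lra.
by apply: h; lra.
Qed.

End global_taylor.

(** * Coefficients and diagonal operators on the Bergman space *)

Section bergman_coefficients.
Context {R : realType}.
Local Notation C := R[i].
Local Notation c := (@area R).
Local Notation dA := (@dA R).
Implicit Types (f g : bergman R) (a b : nat -> C) (z : disk R).

Lemma bergmanP f : analytic f /\ square_integrable f.
Proof. by case: f => f h; exact/asboolP. Qed.

Lemma bergman_ext f g : (forall z, f z = g z) -> f = g.
Proof. by move=> fg; apply: val_inj; apply/funext. Qed.

Lemma bergmanD f g z : (f + g) z = f z + g z.
Proof. by have := GRing.valD f g => /(congr1 (fun h => h z)). Qed.

Lemma bergmanZ (u : C) f z : (u *: f) z = u * f z.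
Proof. by rewrite /GRing.scale. Qed.

Lemma bergmanB f g z : (f - g) z = f z - g z.
Proof. by rewrite -scaleN1r bergmanD bergmanZ mulN1r. Qed.

Lemma coef_ex f : exists a, conv_disk a /\ forall z, f z = ps a (dval z).
Proof. by have [a ca fa] := analytic_expands (bergmanP f).1; exists a. Qed.

Definition coef f : nat -> C := sval (cid (coef_ex f)).

Lemma coef_conv f : conv_disk (coef f).
Proof. by rewrite /coef; case: cid => a []. Qed.

Lemma coefE f z : f z = ps (coef f) (dval z).
Proof. by rewrite /coef; case: cid => a []. Qed.

Lemma ps_disk_inj a b : conv_disk a -> conv_disk b ->
  (forall z : disk R, ps a (dval z) = ps b (dval z)) -> a = b.
Proof.
move=> ca cb ab; have h01 : 0 <= (2^-1 : R) < 1 by apply/andP; split; lra.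
have [M aM] := ca _ h01; have [M' bM] := cb _ h01.
apply: (ps_inj (e := 4^-1)) aM bM _; first by apply/andP; split; lra.
move=> w we; have w1 : normc w < 1 by lra.
exact: (ab (Disk _ w1)).
Qed.

Lemma coef_eq f a : conv_disk a -> (forall z, f z = ps a (dval z)) -> coef f = a.
Proof.
move=> ca fa; apply: ps_disk_inj ca _; first exact: coef_conv.
by move=> z; rewrite -coefE.
Qed.

Lemma coef_inj f g : coef f = coef g -> f = g.
Proof. by move=> fg; apply: bergman_ext => z; rewrite !coefE fg. Qed.

Lemma conv_diskD (u : C) a b : conv_disk a -> conv_disk b ->
  conv_disk (fun n => u * a n + b n).
Proof.
move=> ca cb r r01; have [M aM] := ca r r01; have [M' bM] := cb r r01.
by exists (normc u * M + M'); apply: psbndD => //; case/andP: r01.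
Qed.

Lemma coefP (u : C) f g n : coef (u *: f + g) n = u * coef f n + coef g n.
Proof.
rewrite (@coef_eq _ (fun n => u * coef f n + coef g n)) //.
  by apply: conv_diskD; exact: coef_conv.
move=> z; rewrite bergmanD bergmanZ !coefE.
have z1 := disk_lt1 z; have z0 := normc_ge0 (dval z).
have r01 : 0 <= (normc (dval z) + 1) / 2 < 1 by apply/andP; split; lra.
have [M aM] := coef_conv f r01; have [M' bM] := coef_conv g r01.
by rewrite (psD u aM bM) //; lra.
Qed.

Lemma coef0 n : coef (0 : bergman R) n = 0.
Proof.
have := coefP (-1) 0 0 n; rewrite scaler0 addr0 mulN1r addNr; exact.
Qed.

Lemma coefZ (u : C) f n : coef (u *: f) n = u * coef f n.
Proof. by rewrite -[u *: f]addr0 coefP coef0 addr0. Qed.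

Lemma coefD f g n : coef (f + g) n = coef f n + coef g n.
Proof. by rewrite -[f in LHS]scale1r coefP mul1r. Qed.

Lemma coefB f g n : coef (f - g) n = coef f n - coef g n.
Proof. by rewrite -scaleN1r addrC coefP mulN1r addrC. Qed.

Lemma coef_sum (I : Type) (s : seq I) (P : pred I) (F : I -> bergman R) n :
  coef (\sum_(i <- s | P i) F i) n = \sum_(i <- s | P i) coef (F i) n.
Proof.
elim/big_rec2 : _ => [|i y x _ <-]; first exact: coef0.
by rewrite coefD.
Qed.

Lemma coef_bergman_poly (p : {poly C}) n : coef (bergman_poly p) n = p`_n.
Proof.
rewrite (@coef_eq _ (fun n => p`_n)) //.
  move=> r /andP[r0 r1]; exists (\sum_(k < size p) normc p`_k) => k.
  have [ks|sk] := ltnP k (size p); last first.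
    by rewrite nth_default // normcn0 mul0r sumr_ge0 // => i _; exact: normc_ge0.
  apply: (@le_trans _ _ (normc p`_k)).
    by rewrite ler_piMr ?normc_ge0 // exprn_ile1 // ltW.
  rewrite (bigD1 (Ordinal ks)) //= lerDl; apply: sumr_ge0 => i _; exact: normc_ge0.
move=> z; apply/esym/ps_eq; apply: cvg0_of_bound => e e0; exists (size p) => N sN.
rewrite /= (horner_coef_wide _ sN) /psum big_mkord subrr normcn0 normr0 ltW //.
Qed.

Let normsq_fin f : (\int[dA]_z (normc (f z) ^+ 2)%:E)%E =
  (\int[dA]_z normc (f z) ^+ 2)%:E.
Proof.
rewrite /Rintegral fineK // ge0_fin_numE; first exact: (bergmanP f).2.2.
by apply: integral_ge0 => z _; rewrite lee_fin sqr_ge0.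
Qed.

Lemma L2norm_sqr f : L2norm f ^+ 2 = \int[dA]_z normc (f z) ^+ 2.
Proof. by rewrite sqr_sqrtr // Rintegral_ge0 // => z _; rewrite sqr_ge0. Qed.

(** Parseval's identity, from its two halves [integral_ps_le] and [le_integral_ps]. *)
Lemma bsum_cvg f : bsum (coef f) @ \oo --> L2norm f ^+ 2.
Proof.
have intE : (\int[dA]_z (normc (ps (coef f) (dval z)) ^+ 2)%:E)%E = (L2norm f ^+ 2)%:E.
  rewrite L2norm_sqr -normsq_fin; apply: eq_integral => z _.
  by rewrite coefE.
have le N : bsum (coef f) N <= L2norm f ^+ 2.
  by apply: le_integral_ps; [exact: coef_conv|rewrite intE].
have ub : has_ubound (range (bsum (coef f))).
  by exists (L2norm f ^+ 2) => _ [N _ <-].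
have cv := nondecreasing_cvgn (@bsum_nd _ (coef f)) ub.
suff -> : L2norm f ^+ 2 = sup (range (bsum (coef f))) by [].
apply/eqP; rewrite eq_le; apply/andP; split.
  rewrite -lee_fin -intE; apply: integral_ps_le => N.
  by apply: ub_le_sup => //; exists N.
by apply: ge_sup => [|_ [N _ <-]]; [exists (bsum (coef f) 0%N); exists 0%N|exact: le].
Qed.

Lemma bsum_le f N : bsum (coef f) N <= L2norm f ^+ 2.
Proof.
apply: (ler_cvg_to (cvg_cst _) (@bsum_cvg f)); near=> M.
by apply: bsum_nd; near: M; exact: nbhs_infty_ge.
Unshelve. all: by end_near. Qed.

Lemma analytic_ps a : conv_disk a -> analytic (fun z : disk R => ps a (dval z)).
Proof.
move=> ca z; have z1 := disk_lt1 z; have z0 := normc_ge0 (dval z).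
exists ((1 - normc (dval z)) / 2); first by lra.
exists (taylor a (dval z)) => w wz.
have r01 : 0 <= (1 + normc (dval z)) / 2 < 1 by apply/andP; split; lra.
have [M aM] := ca _ r01.
have lt : normc (dval z) + normc (dval w - dval z) < (1 + normc (dval z)) / 2 by lra.
have := ps_taylor aM lt; rewrite [X in ps a X]addrC subrK.
by move=> /cto_cvg.
Qed.

(** The Riesz-Fischer half: the sum of the series is square integrable by
    [integral_ps_le]. *)
Lemma coef_surj a (B : R) : (forall N, bsum a N <= B) ->
  exists f : bergman R, coef f = a.
Proof.
move=> hB; have ca := bsum_conv_disk hB.
have fB : (fun z : disk R => ps a (dval z)) \in bergman_pred.
  apply/asboolP; split; first exact: analytic_ps.
  split; first by apply: cmeasurable_ps => z; exact: conv_disk_cto.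
  by apply: le_lt_trans (integral_ps_le hB) _; rewrite ltry.
by exists (Bergman _ fB); apply: coef_eq.
Qed.

Lemma coef_bound f n : normc (coef f n) ^+ 2 * (c / n.+1%:R) <= L2norm f ^+ 2.
Proof.
apply: le_trans (bsum_le f n.+1); rewrite /bsum big_nat_recr //= lerDr.
by apply: sumr_ge0 => k _; exact: bterm_ge0.
Qed.

Definition truncate f N : bergman R := bergman_poly (\poly_(k < N) coef f k).

Lemma coef_truncate f N n : coef (truncate f N) n = if (n < N)%N then coef f n else 0.
Proof. by rewrite coef_bergman_poly coef_poly. Qed.

(** Density of the polynomials: the error is a tail of Parseval's series. *)
Lemma truncate_cvg f : (fun N => L2norm (f - truncate f N) ^+ 2) @ \oo --> (0 : R).
Proof.
rewrite (_ : (fun _ => _) = fun N => L2norm f ^+ 2 - bsum (coef f) N).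
  by rewrite -(subrr (L2norm f ^+ 2)); apply: cvgB; [exact: cvg_cst|exact: bsum_cvg].
apply/funext => N.
have h : bsum (coef f) @ \oo --> L2norm (f - truncate f N) ^+ 2 + bsum (coef f) N.
  apply: (cvg_eq_from (N := N)) (cvgD (@bsum_cvg (f - truncate f N))
    (cvg_cst (bsum (coef f) N))) => M NM.
  have e0 : bsum (coef (f - truncate f N)) N = 0.
    rewrite /bsum big_nat_cond big1 // => k /andP[/andP[_ kN] _].
    by rewrite coefB coef_truncate kN subrr normcn0 expr0n mul0r.
  transitivity (bsum (coef (f - truncate f N)) M + bsum (coef f) N) => //.
  rewrite [in RHS]/bsum (big_cat_nat (n := N) (m := 0%N) (p := M)) //=.
  rewrite -/(bsum _ N) e0 add0r addrC [in LHS]/bsum.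
  rewrite (big_cat_nat (n := N) (m := 0%N) (p := M)) //=; congr (_ + _).
  apply: eq_big_nat => k /andP[Nk _].
  by rewrite coefB coef_truncate ltnNge Nk /= subr0.
have -> : L2norm f ^+ 2 = L2norm (f - truncate f N) ^+ 2 + bsum (coef f) N.
  exact: cvg_unique (@bsum_cvg f) h.
by rewrite addrK.
Qed.

End bergman_coefficients.

Section diagonal_operators.
Context {R : realType}.
Local Notation C := R[i].
Local Notation c := (@area R).
Implicit Types (f g : bergman R) (lam : nat -> C).

(** The monomials are eigenvectors, in a form that sees infinite expansions. *)
Definition is_diagonal (T : bergman R -> bergman R) lam :=
  forall f n, coef (T f) n = lam n * coef f n.

Lemma bsum_diag lam (B : R) f N : (forall n, normc (lam n) <= B) ->
  bsum (fun n => lam n * coef f n) N <= B ^+ 2 * L2norm f ^+ 2.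
Proof.
move=> hB; have B0 : 0 <= B by exact: le_trans (normc_ge0 _) (hB 0%N).
apply: le_trans (ler_wpM2l (sqr_ge0 B) (bsum_le f N)).
rewrite /bsum mulr_sumr; apply: ler_sum => k _.
rewrite normcM exprMn -mulrA ler_wpM2r ?bterm_ge0 //.
by rewrite lerXn2r ?nnegrE ?normc_ge0.
Qed.

Lemma diag_ex lam f : (exists B : R, forall n, normc (lam n) <= B) ->
  exists g, coef g = fun n => lam n * coef f n.
Proof. by move=> [B hB]; exact: coef_surj (fun N => bsum_diag f N hB). Qed.

Definition diag_op lam (hB : exists B : R, forall n, normc (lam n) <= B) f :
  bergman R := sval (cid (diag_ex f hB)).

Lemma diag_opP lam hB : is_diagonal (@diag_op lam hB) lam.
Proof. by move=> f n; rewrite /diag_op; case: cid => g /= ->. Qed.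

Lemma diag_op_linear lam hB : linear (@diag_op lam hB).
Proof.
move=> u f g; apply: coef_inj; apply/funext => n.
by rewrite !(diag_opP, coefP); ring.
Qed.

HB.instance Definition _ lam hB :=
  GRing.isLinear.Build C (bergman R) (bergman R) *:%R (@diag_op lam hB)
    (@diag_op_linear lam hB).

Lemma diagonal_bounded T lam (B : R) : (forall n, normc (lam n) <= B) ->
  is_diagonal T lam -> bounded_op T.
Proof.
move=> hB dT; have B0 : 0 <= B by exact: le_trans (normc_ge0 _) (hB 0%N).
exists B => f.
have n0 g : 0 <= L2norm g by exact: sqrtr_ge0.
rewrite -(@ler_pXn2r _ 2) ?nnegrE ?mulr_ge0 // exprMn.
apply: (ler_cvg_to (@bsum_cvg _ (T f)) (cvg_cst _)); near=> N.
rewrite (_ : coef (T f) = fun n => lam n * coef f n); first exact: bsum_diag.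
by apply/funext => n; exact: dT.
Unshelve. all: by end_near. Qed.

(** Continuity and the density of the polynomials propagate the eigenvalue
    equation from the monomials to the whole space. *)
Lemma diagonal_of_poly (T : {linear bergman R -> bergman R}) lam :
  bounded_op T ->
  (forall (p : {poly C}) n, coef (T (bergman_poly p)) n = lam n * p`_n) ->
  is_diagonal T lam.
Proof.
move=> [M hM] Tp f n; apply/eqP; rewrite -subr_eq0 -normc_eq0 -sqrf_eq0.
rewrite eq_le sqr_ge0 andbT.
have cn : 0 < c / n.+1%:R by rewrite divr_gt0 // area_gt0.
rewrite -(pmulr_lle0 _ cn).
have lim : (fun N => M ^+ 2 * L2norm (f - truncate f N) ^+ 2) @ \oo --> (0 : R).
  exact: cvg0Z (@truncate_cvg _ f).
apply: (ler_cvg_to (cvg_cst _) lim); near=> N.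
have nN : (n < N)%N by near: N; exact: nbhs_infty_gt.
have -> : coef (T f) n - lam n * coef f n = coef (T (f - truncate f N)) n.
  by rewrite linearB coefB Tp coef_poly nN.
apply: le_trans (coef_bound _ _) _; rewrite -exprMn.
have n0 g : 0 <= L2norm g by exact: sqrtr_ge0.
by rewrite lerXn2r ?nnegrE // (le_trans (n0 _) (hM _)).
Unshelve. all: by end_near. Qed.

End diagonal_operators.

(** * Self-adjoint and Fredholm diagonal operators *)

Section selfadjoint_diagonal.
Context {R : realType}.
Local Notation C := R[i].
Local Notation c := (@area R).
Local Notation dA := (@dA R).
Implicit Types (f g : bergman R).

Lemma normsq_integrable f : dA.-integrable setT (fun z => (normc (f z) ^+ 2)%:E).
Proof.
have [mf fin] := (bergmanP f).2.
apply/integrableP; split; first exact/measurable_EFinP/measurable_sqr_normc.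
apply: le_lt_trans fin; rewrite le_eqVlt; apply/orP; left; apply/eqP.
by apply: eq_integral => z _; rewrite abse_EFin ger0_norm ?sqr_ge0.
Qed.

Lemma polarization (x y : C) :
  complex.Re (x * y^*%C) = (normc (x + y) ^+ 2 - normc (x - y) ^+ 2) / 4.
Proof. by rewrite !sqr_normcE; case: x y => [a b] [a' b'] /=; field. Qed.

Lemma Re_dot f g : complex.Re (bergman_dot f g) =
  (L2norm (f + g) ^+ 2 - L2norm (f - g) ^+ 2) / 4.
Proof.
rewrite !L2norm_sqr.
have -> : complex.Re (bergman_dot f g) = \int[dA]_z complex.Re (f z * (g z)^*%C) by [].
rewrite -RintegralB //; try exact: normsq_integrable.
rewrite -RintegralZr //; last first.
  have := integrableB _ (normsq_integrable (f + g)) (normsq_integrable (f - g)).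
  by apply.
apply: eq_Rintegral => z _.
by rewrite polarization bergmanD bergmanB.
Qed.

Lemma Im_dot f g : complex.Im (bergman_dot f g) =
  complex.Re (bergman_dot f ('i%C *: g)).
Proof.
have -> : complex.Im (bergman_dot f g) = \int[dA]_z complex.Im (f z * (g z)^*%C) by [].
transitivity (\int[dA]_z complex.Re (f z * (('i%C *: g) z)^*%C)); last by [].
apply: eq_Rintegral => z _; rewrite bergmanZ.
by case: (f z) (g z) => [a b] [a' b'] /=; ring.
Qed.

(** By polarization it is enough to compare norms, hence by Parseval moduli of
    coefficients, where a real eigenvalue moves from one side to the other. *)
Lemma diagonal_selfadjoint (T : {linear bergman R -> bergman R}) (lam : nat -> R) :
  is_diagonal T (fun n => (lam n)%:C) -> selfadjoint T.
Proof.
move=> dT; have ReT f g : complex.Re (bergman_dot (T f) g) = complex.Re (bergman_dot f (T g)).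
  rewrite !Re_dot; congr (_ / 4).
  have h1 : bsum (coef (T f + g)) - bsum (coef (T f - g)) @ \oo -->
      L2norm (T f + g) ^+ 2 - L2norm (T f - g) ^+ 2.
    by apply: cvgB; exact: bsum_cvg.
  have h2 : bsum (coef (f + T g)) - bsum (coef (f - T g)) @ \oo -->
      L2norm (f + T g) ^+ 2 - L2norm (f - T g) ^+ 2.
    by apply: cvgB; exact: bsum_cvg.
  suff e : bsum (coef (T f + g)) - bsum (coef (T f - g)) =
      bsum (coef (f + T g)) - bsum (coef (f - T g)).
    rewrite e in h1.
    exact: (cvg_unique (@Rhausdorff R) h1 h2).
  apply/funext => N.
  rewrite !fctE /bsum -!sumrB; apply: eq_bigr => k _.
  rewrite -!mulrBl; congr (_ * _).
  rewrite !coefB !coefD !dT !sqr_normcE.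
  by case: (coef f k) (coef g k) => [a b] [a' b'] /=; ring.
move=> f g; apply/eqP; rewrite eq_complex; apply/andP; split; apply/eqP; first exact: ReT.
by rewrite !Im_dot ReT linearZ.
Qed.

End selfadjoint_diagonal.

Section diagonal_fredholm.
Context {R : realType}.
Local Notation C := R[i].
Local Notation c := (@area R).
Implicit Types (f g : bergman R) (T : {linear bergman R -> bergman R}) (d : nat -> C).

Lemma finite_support_span N v : (forall n, (N <= n)%N -> coef v n = 0) ->
  lin_span [seq (bergman_poly 'X^n : bergman R) | n <- iota 0 N] v.
Proof.
move=> hv; exists (fun i => coef v i); apply: coef_inj; apply/funext => n.
rewrite coef_sum.
transitivity (\sum_(i < N) coef v i * (n == i)%:R).
  have [nN|Nn] := ltnP n N.
    rewrite (bigD1 (Ordinal nN)) //= eqxx mulr1 big1 ?addr0 // => i ni.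
    by rewrite (negbTE (_ : n != i)) ?mulr0 // eq_sym; apply: contra ni => /eqP e; apply/eqP/val_inj.
  rewrite hv // big1 // => i _; rewrite (gtn_eqF (leq_trans (ltn_ord i) Nn)) ?mulr0 //.
rewrite -(big_mkord xpredT (fun i => coef v i * (n == i)%:R)).
rewrite -(big_mkord xpredT (fun i => coef (coef v i *: _`_i) n)) size_map size_iota.
apply: eq_big_nat => i /andP[_ iN].
by rewrite coefZ (nth_map 0%N) ?size_iota // nth_iota // coef_bergman_poly coefXn.
Qed.

(** Dividing coefficients by d inverts T modulo the first N monomials, whose span
    therefore contains the kernel and meets every class modulo the range. *)
Lemma fredholm_diagonal T d (e : R) N : is_diagonal T d -> 0 < e ->
  (forall n, (N <= n)%N -> e <= normc (d n)) -> fredholm T.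
Proof.
move=> dT e0 hd; split.
  exists [seq bergman_poly 'X^n | n <- iota 0 N] => v /= Tv0.
  apply: finite_support_span => n Nn; have := dT v n; rewrite Tv0 coef0 => /esym/eqP.
  rewrite mulf_eq0 => /orP[/eqP d0|/eqP //]; have := hd n Nn.
  by rewrite d0 normcn0 leNgt e0.
exists [seq bergman_poly 'X^n | n <- iota 0 N] => v.
pose q n : C := if (N <= n)%N then (d n)^-1 else 0.
have qB : exists B : R, forall n, normc (q n) <= B.
  exists e^-1 => n; rewrite /q; case: ifP => [Nn|_]; last by rewrite normcn0 invr_ge0 ltW.
  by rewrite normcV lef_pV2 ?posrE ?(lt_le_trans e0) ?hd.
have [g hg] := diag_ex v qB.
exists (T g); first by exists g.
apply: finite_support_span => n Nn; rewrite coefB dT hg /q Nn mulrA divff ?mul1r ?subrr //.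
by apply/eqP => d0; have := hd n Nn; rewrite d0 normcn0 leNgt e0.
Qed.

(** The range of T has infinite codimension. Suppose k vectors span a complement of
    it. Along a sparse set of indices, split into k + 1 infinite classes, take for
    each class a function whose coefficients dominate d there; a nontrivial
    combination of these k + 1 functions lies in the range, and the terms of
    Parseval's series of its preimage do not tend to 0. *)
Lemma not_fredholm_diagonal T d : is_diagonal T d -> cto d 0 -> ~ fredholm T.
Proof.
move=> dT d0 [_ [s hs]]; pose k := size s.
have c0 : 0 < c := area_gt0.
have /choice[thr hthr] : forall m, exists N, forall n, (N <= n)%N -> normc (d n) <= 2^-1 ^+ m.
  move=> m; have em : (0 : R) < 2^-1 ^+ m by rewrite exprn_gt0.
  have [N hN] := cvg0_bound d0 em; exists N => n /hN.
  by rewrite subr0 ger0_norm ?normc_ge0 // => /ltW.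
(* Strictly increasing, with |d (nu m)| at most 2^-m. *)
pose nu m := (\sum_(i < m.+1) (thr i).+1)%N.
have nuS m : (nu m < nu m.+1)%N by rewrite /nu [in ltnRHS]big_ord_recr /= -addn1 leq_add2l.
have nu_mono : {homo nu : i j / (i < j)%N}.
  by apply: homo_ltn => //; exact: ltn_trans.
have nu_inj : injective nu.
  move=> i j ij; case: (ltngtP i j) => // /nu_mono; rewrite ij ltnn //.
have nu_ge m : (m <= nu m)%N.
  by elim: m => // m ih; exact: leq_ltn_trans ih (nuS m).
have nu_thr m : (thr m <= nu m)%N by rewrite /nu big_ord_recr /= (leq_trans (leqnSn _)) // leq_addl.
pose S (j n : nat) := [exists m : 'I_n.+1, (nu m == n) && (m %% k.+1 == j)%N].
have Snu j m : S j (nu m) = (m %% k.+1 == j)%N.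
  apply/existsP/idP => [[i /andP[/eqP/nu_inj e im]]|mj]; first by rewrite -e.
  have lt : (m < (nu m).+1)%N by rewrite ltnS.
  by exists (Ordinal lt); rewrite /= eqxx.
(* With this coefficient the monomial has norm |d n| + 2^-n: square summable along
   nu, at least |d n|, and nonzero even where d vanishes. *)
pose amp n : R := Num.sqrt (n.+1%:R / c) * (normc (d n) + 2^-1 ^+ n).
pose a j n : C := if S j n then (amp n)%:C else 0.
have ampE n : amp n ^+ 2 * (c / n.+1%:R) = (normc (d n) + 2^-1 ^+ n) ^+ 2.
  rewrite exprMn sqr_sqrtr ?divr_ge0 ?(ltW c0) //; field.
  by rewrite nat1r pnatr_eq0 /= gt_eqF.
have aB j N : bsum (a j) N <= 16.
  pose F n : R := (normc (d n) + 2^-1 ^+ n) ^+ 2.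
  have F0 n : 0 <= F n by exact: sqr_ge0.
  have Fnu m : F (nu m) <= 4 * (4^-1 ^+ m).
    have h1 := hthr m (nu m) (nu_thr m).
    have h2 : (2^-1 : R) ^+ (nu m) <= 2^-1 ^+ m.
      by rewrite ler_wiXn2l // ?invr_ge0 // invf_le1 // ler1n.
    have -> : 4 * (4^-1 : R) ^+ m = (2 * 2^-1 ^+ m) ^+ 2.
      rewrite exprMn -exprM mulnC exprM; congr (_ * _ ^+ m); first by rewrite expr2; lra.
      by rewrite expr2; lra.
    rewrite lerXn2r ?nnegrE ?addr_ge0 ?normc_ge0 ?mulr_ge0 ?exprn_ge0 ?invr_ge0 //.
    by lra.
  apply: (@le_trans _ _ (\sum_(0 <= m < N) F (nu m))).
    apply: (@le_trans _ _ (\sum_(0 <= m < N) \sum_(0 <= n < N) (nu m == n)%:R * F n)).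
      rewrite exchange_big /=; apply: ler_sum_nat => n /andP[_ nN].
      rewrite /a; case: ifP => [/existsP[i /andP[/eqP ni _]]|_]; last first.
        by rewrite normcn0 expr0n mul0r sumr_ge0 // => i _; rewrite mulr_ge0.
      rewrite normc_real real_normK ?num_real // ampE -/(F n).
      have iN : (i < N)%N by exact: leq_trans (ltn_ord i) nN.
      rewrite (bigD1_seq (val i)) ?mem_index_iota ?iota_uniq //= ni eqxx mul1r lerDl.
      by apply: sumr_ge0 => i' _; rewrite mulr_ge0.
    apply: ler_sum => m _; have [mN|Nm] := ltnP (nu m) N.
      rewrite (bigD1_seq (nu m)) ?mem_index_iota ?iota_uniq //= eqxx mul1r big1 ?addr0 //.
      by move=> n nm; rewrite eq_sym (negbTE nm) mul0r.
    rewrite big_nat_cond big1 // => n /andP[/andP[_ nN] _].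
    by rewrite (gtn_eqF (leq_trans nN Nm)) mul0r.
  apply: le_trans (ler_sum _ (fun m _ => Fnu m)) _.
  rewrite -mulr_sumr; have q01 : 0 <= (4^-1 : R) < 1 by apply/andP; split; lra.
  have := @geo_sum_le _ 4^-1 0 N q01; rewrite expr0 mul1r.
  have : (1 - 4^-1 : R)^-1 <= 2.
    by rewrite -[leRHS]invrK lef_pV2 ?posrE ?invr_gt0 //; lra.
  by lra.
have /choice[v hv] : forall j, exists f : bergman R, coef f = a j.
  by move=> j; exact: coef_surj (aB j).
have /choice[u hu] : forall j, exists u, exists x : 'I_k -> C,
    v j - T u = \sum_i x i *: s`_i.
  by move=> j; have [_ [u _ <-] [x hx]] := hs (v j); exists u; exists x.
have /choice[x hx] := hu.
pose A : 'M[C]_(k.+1, k) := \matrix_(j, i) x j i.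
have : kermx A != 0.
  by rewrite kermx_eq0 /row_free neq_ltn (leq_ltn_trans (rank_leq_col A)).
case/rowV0Pn => b /sub_kermxP bA b0.
have [j0 bj0] : exists j0, b 0 j0 != 0.
  apply: contrapT => /forallNP h; case/negP: b0; apply/eqP/rowP => j.
  by rewrite mxE; apply/eqP; apply: contrapT => /negP; exact: h.
pose f := \sum_(j < k.+1) b 0 j *: u j.
have Tf : T f = \sum_(j < k.+1) b 0 j *: v j.
  rewrite linear_sum; apply/eqP; rewrite eq_sym -subr_eq0 -sumrB; apply/eqP.
  transitivity (\sum_(j < k.+1) \sum_(i < k) (b 0 j * A j i) *: s`_i).
    apply: eq_bigr => j _; rewrite linearZ -scalerBr hx scaler_sumr.
    by apply: eq_bigr => i _; rewrite mxE scalerA.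
  rewrite exchange_big big1 // => i _; rewrite -scaler_suml.
  have := congr1 (fun M : 'rV[C]_k => M 0 i) bA; rewrite !mxE => ->.
  by rewrite scale0r.
have low m : (m %% k.+1 = j0)%N ->
    normc (b 0 j0) ^+ 2 <= normc (coef f (nu m)) ^+ 2 * (c / (nu m).+1%:R).
  move=> mj; set n := nu m.
  have e : d n * coef f n = b 0 j0 * (amp n)%:C.
    rewrite -dT Tf coef_sum (bigD1 j0) //= big1 ?addr0.
      by rewrite coefZ hv /a Snu mj eqxx.
    move=> j jj; rewrite coefZ hv /a Snu mj; case: ifP => [/eqP h|_]; last by rewrite mulr0.
    by case/negP: jj; apply/eqP/val_inj.
  have ne : normc (d n) * normc (coef f n) = normc (b 0 j0) * amp n.
    have amp0 : 0 <= amp n by rewrite mulr_ge0 ?sqrtr_ge0 // addr_ge0 ?normc_ge0 ?exprn_ge0.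
    by rewrite -normcM e normcM normc_real ger0_norm.
  have t0 : 0 < (2^-1 : R) ^+ n by rewrite exprn_gt0.
  have sq : normc (d n) ^+ 2 * (normc (coef f n) ^+ 2 * (c / n.+1%:R)) =
      normc (b 0 j0) ^+ 2 * (normc (d n) + 2^-1 ^+ n) ^+ 2.
    by rewrite mulrA -exprMn ne exprMn -mulrA ampE.
  have dn0 := normc_ge0 (d n).
  have b20 : 0 < normc (b 0 j0) ^+ 2 by rewrite exprn_gt0 // lt_neqAle normc_ge0 eq_sym normc_eq0 bj0.
  have dd : normc (d n) ^+ 2 <= (normc (d n) + 2^-1 ^+ n) ^+ 2.
    by rewrite lerXn2r ?nnegrE ?addr_ge0 ?(ltW t0) // lerDl ltW.
  have dpos : 0 < normc (d n) ^+ 2.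
    rewrite lt_neqAle sqr_ge0 andbT eq_sym; apply/eqP => z0; move: sq; rewrite z0 mul0r.
    apply/eqP; rewrite eq_sym mulf_eq0 negb_or gt_eqF //= expf_neq0 // gt_eqF //.
    by rewrite ltr_wpDl.
  by rewrite -(ler_pM2l dpos) sq mulrC ler_wpM2l // ltW.
have b20 : 0 < normc (b 0 j0) ^+ 2 by rewrite exprn_gt0 // lt_neqAle normc_ge0 eq_sym normc_eq0 bj0.
have b22 : 0 < normc (b 0 j0) ^+ 2 / 2 by rewrite divr_gt0.
have [N hN] := cvg0_bound (cvg_subr0_seq (@bsum_cvg _ f)) b22.
pose m := (N * k.+1 + j0)%N.
have mj : (m %% k.+1 = j0)%N by rewrite /m modnMDl modn_small // ltn_ord.
have Nm : (N <= nu m)%N.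
  by rewrite (leq_trans _ (nu_ge m)) // /m (leq_trans _ (leq_addr _ _)) // leq_pmulr.
have h1 := hN _ Nm; have h2 := hN _ (leqW Nm); have h3 := low m mj.
have h4 : bsum (coef f) (nu m).+1 = bsum (coef f) (nu m) +
    normc (coef f (nu m)) ^+ 2 * (c / (nu m).+1%:R) by rewrite /bsum big_nat_recr.
rewrite h4 in h2; move: h1 h2 h3; rewrite !ltr_norml => /andP[h1 _] /andP[_ h2].
set t := (X in _ <= X) => h3.
have {}h2 : bsum (coef f) (nu m) + t - L2norm f ^+ 2 < normc (b 0 j0) ^+ 2 / 2 by exact: h2.
lra.
Qed.

End diagonal_fredholm.

(** * Integration against a radial charge *)

Section charge_functional.
Context {R : realType}.
Local Notation C := R[i].
Implicit Types (m : {measure set (disk R) -> \bar R}) (f : disk R -> R) (mu : charge (disk R) R).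

Lemma pos_part_fin mu : (pos_part mu setT < +oo)%E.
Proof.
have := fin_num_measure (jordan_pos (svalP (hahn_ex mu))) setT measurableT.
by rewrite ge0_fin_numE.
Qed.

Lemma neg_part_fin mu : (neg_part mu setT < +oo)%E.
Proof.
have := fin_num_measure (jordan_neg (svalP (hahn_ex mu))) setT measurableT.
by rewrite ge0_fin_numE.
Qed.

Lemma jordanE mu E : measurable E -> (mu E = pos_part mu E - neg_part mu E)%E.
Proof.
move=> mE; rewrite (jordan_decomp (svalP (hahn_ex mu)) mE).
by rewrite /cadd /= cscaleN1.
Qed.

Lemma Rintegral_measure_add m1 m2 f : (m1 setT < +oo)%E -> (m2 setT < +oo)%E ->
  bmeas f -> \int[measure_add m1 m2]_z f z = \int[m1]_z f z + \int[m2]_z f z.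
Proof.
move=> fin1 fin2 bf; rewrite /Rintegral.
have i1 := bmeas_integrable fin1 bf; have i2 := bmeas_integrable fin2 bf.
have e := integral_measure_add measurableT i1 i2.
rewrite -fineD; [exact: (congr1 fine e)|exact: integrable_fin_num i1|exact: integrable_fin_num i2].
Qed.

Lemma image_measure m (phi : disk R -> disk R) : (m setT < +oo)%E ->
  measurable_fun setT phi -> exists m' : {measure set (disk R) -> \bar R},
  (forall A, m' A = m (phi @^-1` A)) /\
  forall f, bmeas f -> \int[m']_z f z = \int[m]_z f (phi z).
Proof.
move=> fin mphi; unshelve eexists (pushforward m phi); first exact: mphi.
split=> // f bf; rewrite /Rintegral.
have bfp : bmeas (f \o phi).
  split; first exact: measurableT_comp bf.1 mphi.
  by have [_ [M hM]] := bf; exists M => z; exact: hM.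
have mf : measurable_fun setT (EFin \o f) by apply/measurable_EFinP; exact: bf.1.
have i := bmeas_integrable fin bfp.
exact: (congr1 fine (integral_pushforward mphi mf i measurableT)).
Qed.

Lemma rotate_dmul t (E : set (disk R)) :
  rotate t (dmul (cos t +i* sin t) @^-1` E) = E.
Proof.
have u1 : normc (cos t +i* sin t) <= 1 by rewrite normc_cis.
apply/seteqP; split => [w [z Ez zw]|w Ew].
  have -> : w = dmul (cos t +i* sin t) z by apply: disk_inj; rewrite dval_dmul.
  exact: Ez.
have v1 : normc (cos t +i* sin t)^*%C <= 1 by rewrite normc_conj.
exists (dmul (cos t +i* sin t)^*%C w); last first.
  by rewrite dval_dmul // mulrA mulc_conj normc_cis expr1n mul1r.
rewrite /preimage /=; suff -> : dmul (cos t +i* sin t) (dmul (cos t +i* sin t)^*%C w) = w by [].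
by apply: disk_inj; rewrite !dval_dmul // mulrA mulc_conj normc_cis expr1n mul1r.
Qed.

(** The rotated Jordan parts pos' and neg' of a radial charge satisfy
    pos' - neg' = pos - neg. Moving the negative parts to the other sides gives an
    equality of measures, which is integrated. *)
Lemma charge_integral_radial mu : radial mu -> radial_functional (charge_integral mu).
Proof.
move=> rmu; have fp := pos_part_fin mu; have fn := neg_part_fin mu.
split=> [k f g bf bg||t f bf].
- by rewrite /charge_integral !Rintegral_lin //; ring.
- exists (fine (pos_part mu setT) + fine (neg_part mu setT)).
    by rewrite addr_ge0 // fine_ge0.
  move=> f M bf hM; rewrite mulrDl (le_trans (ler_normB _ _)) // lerD //;
    exact: Rintegral_bound.
set u := cos t +i* sin t.
have m_u : measurable_fun setT (dmul u) by apply: measurable_dmul; rewrite normc_cis.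
have [p' [p'E intp']] := image_measure fp m_u; have [n' [n'E intn']] := image_measure fn m_u.
have fp' : (p' setT < +oo)%E by rewrite p'E.
have fn' : (n' setT < +oo)%E by rewrite n'E.
apply/eqP; rewrite /charge_integral subr_eq addrAC eq_sym subr_eq; apply/eqP.
rewrite -intp' // -intn' // -!Rintegral_measure_add //.
rewrite /Rintegral; congr fine; apply: eq_measure_integral => A mA _.
transitivity (pos_part mu A + n' A)%E; first exact: measure_addE.
transitivity (p' A + neg_part mu A)%E; last exact/esym/measure_addE.
rewrite p'E n'E.
have mA' : measurable (dmul u @^-1` A) by rewrite -[X in measurable X]setTI; exact: m_u.
have := rmu t _ mA'; rewrite rotate_dmul !jordanE //.
have pA : pos_part mu A \is a fin_num.
  exact: (fin_num_measure (jordan_pos (svalP (hahn_ex mu)))).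
have nA : neg_part mu A \is a fin_num.
  exact: (fin_num_measure (jordan_neg (svalP (hahn_ex mu)))).
have pA' : pos_part mu (dmul u @^-1` A) \is a fin_num.
  exact: (fin_num_measure (jordan_pos (svalP (hahn_ex mu)))).
have nA' : neg_part mu (dmul u @^-1` A) \is a fin_num.
  exact: (fin_num_measure (jordan_neg (svalP (hahn_ex mu)))).
move: pA nA pA' nA'.
move: (pos_part mu A) (neg_part mu A) (pos_part mu (dmul u @^-1` A))
  (neg_part mu (dmul u @^-1` A)) => [x| |] [y| |] [x'| |] [y'| |] // _ _ _ _.
by rewrite -?EFinB -?EFinD => -[e]; apply: congr1; lra.
Qed.

Lemma Rintegral_variation mu f : bmeas f -> \int[total_variation_measure mu]_z f z =
  \int[pos_part mu]_z f z + \int[neg_part mu]_z f z.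
Proof.
move=> bf; rewrite -Rintegral_measure_add //; [|exact: pos_part_fin|exact: neg_part_fin].
rewrite /Rintegral; congr fine.
by apply: eq_measure_integral => A mA _; exact/esym/measure_addE.
Qed.

Lemma variation_fin mu : (total_variation_measure mu setT < +oo)%E.
Proof. by have := lte_add_pinfty (pos_part_fin mu) (neg_part_fin mu). Qed.

Lemma bmeas_norm f : bmeas f -> bmeas (fun z => `|f z|).
Proof.
move=> [mf [M hM]]; split; first exact: measurableT_comp.
by exists M => z; rewrite normr_id.
Qed.

Lemma le_charge_integral mu f : bmeas f ->
  `|charge_integral mu f| <= \int[total_variation_measure mu]_z `|f z|.
Proof.
move=> bf; rewrite Rintegral_variation; last exact: bmeas_norm.
rewrite (le_trans (ler_normB _ _)) // lerD //; apply: le_normr_Rintegral => //;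
  apply: bmeas_integrable => //; [exact: pos_part_fin|exact: neg_part_fin].
Qed.

End charge_functional.

(** * Moments and eigenvalues *)

Section moments.
Context {R : realType}.
Local Notation C := R[i].
Local Notation c := (@area R).
Implicit Types (mu : charge (disk R) R).

(** For moments of order 1/n, the decrements are of order 1/n^2: they decrease, and
    those between n/2 and n add up to at most the moment of index n/2. *)
Lemma decrement_le (M : nat -> R) (K : R) : (forall n, 0 <= M n) ->
  (forall n, M n <= K / n.+1%:R) ->
  (forall n, M n.+1 - M n.+2 <= M n - M n.+1) ->
  forall n, n.+1%:R * (M n - M n.+1) <= 4 * K / n.+1%:R.
Proof.
move=> M0 MK dM n.
have ndM : {homo (fun k => M k - M k.+1) : i j / (i <= j)%N >-> j <= i}.
  by apply: homo_leq => // a b c' ba ac; exact: le_trans ac ba.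
pose h := n./2.
have hn : (h <= n)%N by rewrite /h -{2}(odd_double_half n) -addnn addnA leq_addl.
have tel : \sum_(h <= k < n.+1) (M k - M k.+1) = M h - M n.+1.
  have := @telescope_sumr R h n.+1 (fun k => - M k) (leq_trans hn (leqnSn n)).
  rewrite (_ : - M n.+1 - - M h = M h - M n.+1); last by ring.
  by move=> <-; apply: eq_bigr => k _; ring.
have low : (n.+1 - h)%:R * (M n - M n.+1) <= M h - M n.+1.
  rewrite -tel mulr_natl -sumr_const_nat; apply: ler_sum_nat => k /andP[_ kn].
  exact: ndM.
have K0 : 0 <= K by have := le_trans (M0 0%N) (MK 0%N); rewrite invr1 mulr1.
have n0 : 0 < n.+1%:R :> R by rewrite ltr0n.
have e2 : (n.+1%:R : R) <= 2 * h.+1%:R.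
  by rewrite -natrM ler_nat mul2n /h -[n in (n < _)%N]odd_double_half; case: odd; rewrite /= doubleS.
have e3 : (n.+1%:R : R) <= 2 * (n.+1 - h)%:R.
  have hh : (h.*2 <= n)%N by rewrite /h -{2}(odd_double_half n) leq_addl.
  rewrite -natrM ler_nat mul2n doubleB; apply: leq_trans (leq_sub2l _ hh).
  by rewrite -addnn addSnnS addKn.
have Mh : M h <= 2 * K / n.+1%:R.
  apply: le_trans (MK h) _; rewrite ler_pdivrMr ?ltr0n // mulrAC ler_pdivlMr //.
  by rewrite (mulrC 2) -mulrA ler_wpM2l.
have Mn := M0 n.+1.
have [d0|d0] := lerP 0 (M n - M n.+1); last first.
  by apply: (@le_trans _ _ 0); [rewrite pmulr_rle0 // ltW|rewrite divr_ge0 ?mulr_ge0 // ltW].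
apply: le_trans (ler_wpM2r d0 e3) _.
rewrite -!mulrA; apply: (@le_trans _ _ (2 * (2 * (K / n.+1%:R)))).
  rewrite ler_pM2l //; by apply: le_trans low _; rewrite mulrA (le_trans _ Mh) // lerBlDr lerDl.
by rewrite mulrA -natrM lexx.
Qed.

Definition moment mu n := charge_integral mu (fun z => normc (dval z) ^+ (2 * n)).

(** The quotient of <T z^n, z^n> by |z^n|^2, for the area measure of mass 1. *)
Definition toeplitz_eigenvalue mu n := n.+1%:R * moment mu n.

Let M mu n := \int[total_variation_measure mu]_z normc (dval z) ^+ (2 * n).

Let int_pow mu n : (total_variation_measure mu).-integrable setT
  (EFin \o (fun z => normc (dval z) ^+ (2 * n))).
Proof. exact: bmeas_integrable (variation_fin mu) (bmeas_pow _). Qed.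

Let M_ge0 mu n : 0 <= M mu n.
Proof. by apply: Rintegral_ge0 => z _; rewrite exprn_ge0 ?normc_ge0. Qed.

(** The Carleson condition, tested on monomials. *)
Lemma carleson_moment mu : carleson (total_variation_measure mu) ->
  exists2 K : R, 0 <= K & forall n, M mu n <= K / n.+1%:R.
Proof.
move=> [K hK]; exists (`|K| * c); first by rewrite mulr_ge0 // ltW // area_gt0.
move=> n; have := hK 'X^n.
have e z : normc ('X^n : {poly C}).[dval z] ^+ 2 = normc (dval (z : disk R)) ^+ (2 * n).
  by rewrite hornerXn normcX -exprM mulnC.
under eq_integral do rewrite e.
under [in leRHS]eq_integral do rewrite e.
have i1 := integrable_fin_num measurableT (int_pow mu n).
have i2 := integrable_fin_num measurableT (bmeas_integrable (@dA_setT_fin R) (bmeas_pow (2 * n))).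
rewrite -(fineK i1) -(fineK i2) -EFinM lee_fin => h.
have {}h : M mu n <= K * (c / n.+1%:R) by rewrite -area_moment; exact: h.
apply: le_trans h _.
by rewrite -mulrA ler_wpM2r ?ler_norm // divr_ge0 // ltW // area_gt0.
Qed.

Let moment_le mu n : `|moment mu n| <= M mu n.
Proof.
apply: le_trans (le_charge_integral _ (bmeas_pow _)) _.
rewrite le_eqVlt; apply/orP; left; apply/eqP; apply: eq_Rintegral => z _.
by rewrite ger0_norm // exprn_ge0 // normc_ge0.
Qed.

Let step n (z : disk R) := -1 * normc (dval z) ^+ (2 * n.+1) + normc (dval z) ^+ (2 * n).

Let bstep n : bmeas (step n).
Proof. by apply: bmeasD; [apply: bmeasZ|]; exact: bmeas_pow. Qed.

Let stepE n z : step n z = normc (dval z) ^+ (2 * n) * (1 - normc (dval z) ^+ 2).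
Proof. by rewrite /step mulnS addnC exprD; ring. Qed.

Let step_ge0 n z : 0 <= step n z.
Proof.
rewrite stepE mulr_ge0 ?exprn_ge0 ?normc_ge0 // subr_ge0.
by rewrite exprn_ile1 ?normc_ge0 // ltW // disk_lt1.
Qed.

Let M_step mu n : M mu n - M mu n.+1 = \int[total_variation_measure mu]_z step n z.
Proof.
rewrite /step Rintegral_lin; first by rewrite /M; ring.
- exact: variation_fin.
- exact: bmeas_pow.
- exact: bmeas_pow.
Qed.

Let M_convex mu n : M mu n.+1 - M mu n.+2 <= M mu n - M mu n.+1.
Proof.
rewrite !M_step; apply: le_Rintegral => //.
- exact: bmeas_integrable (variation_fin mu) (bstep _).
- exact: bmeas_integrable (variation_fin mu) (bstep _).
move=> z _; rewrite !stepE; have z1 := disk_lt1 z.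
have q0 : 0 <= 1 - normc (dval z) ^+ 2.
  by rewrite subr_ge0 exprn_ile1 ?normc_ge0 // ltW.
rewrite ler_wpM2r // ler_wiXn2l ?normc_ge0 ?(ltW z1) //; last by rewrite leq_pmul2l.
Qed.

Let moment_step_le mu n : radial mu -> `|moment mu n.+1 - moment mu n| <= M mu n - M mu n.+1.
Proof.
move=> rmu; rewrite distrC M_step.
have -> : moment mu n - moment mu n.+1 = charge_integral mu (step n).
  rewrite /moment /step (rf_lin (charge_integral_radial rmu)); first by ring.
  - exact: bmeas_pow.
  - exact: bmeas_pow.
apply: le_trans (le_charge_integral _ (bstep _)) _.
rewrite le_eqVlt; apply/orP; left; apply/eqP; apply: eq_Rintegral => z _.
by rewrite ger0_norm // step_ge0.
Qed.

Lemma toeplitz_eigenvalue_bounded mu : carleson (total_variation_measure mu) ->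
  exists B, forall n, `|toeplitz_eigenvalue mu n| <= B.
Proof.
move=> /carleson_moment[K K0 hK]; exists K => n.
rewrite normrM ger0_norm // mulrC -ler_pdivlMr ?ltr0n //.
exact: le_trans (moment_le _ _) (hK n).
Qed.

(** This slow variation is what makes the convergence of the Berezin transform
    reach the eigenvalues. *)
Lemma toeplitz_eigenvalue_slow mu : radial mu -> carleson (total_variation_measure mu) ->
  exists D, forall n, `|toeplitz_eigenvalue mu n.+1 - toeplitz_eigenvalue mu n| <= D / n.+1%:R.
Proof.
move=> rmu /carleson_moment[K K0 hK]; exists (5 * K) => n; rewrite /toeplitz_eigenvalue.
have -> : n.+2%:R * moment mu n.+1 - n.+1%:R * moment mu n =
    moment mu n.+1 + n.+1%:R * (moment mu n.+1 - moment mu n).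
  by rewrite -[n.+2%:R]natr1; ring.
apply: le_trans (ler_normD _ _) _; rewrite normrM (ger0_norm (ler0n _ _)).
have h1 := decrement_le (M_ge0 mu) hK (M_convex mu) n.
have h2 : n.+1%:R * `|moment mu n.+1 - moment mu n| <= n.+1%:R * (M mu n - M mu n.+1).
  by rewrite ler_wpM2l // moment_step_le.
have h3 : `|moment mu n.+1| <= K / n.+1%:R.
  apply: le_trans (moment_le _ _) _; apply: le_trans (hK _) _.
  by rewrite ler_wpM2l // lef_pV2 ?posrE ?ltr0n // ler_nat.
have -> : 5 * K / n.+1%:R = K / n.+1%:R + 4 * K / n.+1%:R by ring.
exact: lerD h3 (le_trans h2 h1).
Qed.

End moments.

(** * The Bergman kernel *)

Section kernel_series.
Context {R : realType}.
Local Notation C := R[i].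
Local Notation c := (@area R).
Implicit Types (z w : disk R) (q : C).

Lemma cto_geo2 q : normc q < 1 -> cto (fun N => \sum_(0 <= k < N) k.+1%:R * q ^+ k) ((1 - q) ^- 2).
Proof.
move=> q1; have q01 : 0 <= normc q < 1 by rewrite normc_ge0.
have q1' : 1 - q != 0.
  by rewrite subr_eq0; apply/eqP => e; move: q1; rewrite -e -[1]/(1%:C) normc_real normr1 ltxx.
have k1 : (1 - q) ^+ 2 != 0 by rewrite expf_neq0.
apply: (@squeeze0 _ _ (fun N => normc ((1 - q) ^- 2) * (N.+1%:R * normc q ^+ N) +
    normc ((1 - q) ^- 2) * (N.+1%:R * normc q ^+ N))).
  move=> N; rewrite ger0_norm ?normc_ge0 //.
  have -> : \sum_(0 <= k < N) k.+1%:R * q ^+ k - (1 - q) ^- 2 =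
      (1 - q) ^- 2 * (N%:R * q ^+ N.+1 - N.+1%:R * q ^+ N).
    apply: (mulfI k1); rewrite mulrBr geo2_sum mulrA divff // mul1r; ring.
  rewrite normcM -mulrDr ler_wpM2l ?normc_ge0 //.
  apply: le_trans (le_normcD _ _) _; rewrite normcN !normcM !normcX !normc_nat lerD2r.
  rewrite ler_pM ?exprn_ge0 ?normc_ge0 ?ler_nat // ler_wiXn2l ?normc_ge0 // ltW //.
rewrite -[X in _ --> X](addr0 0).
by apply: cvgD; apply: cvg0Z; exact: natr_geo_cvg0.
Qed.

(** The Taylor coefficients of [bergman_kernel z]. *)
Definition kernel_coef z k : C := k.+1%:R * (dval z)^*%C ^+ k.

Lemma kernel_psbnd z : exists r, exists2 M, 1 < r & psbnd (kernel_coef z) r M.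
Proof.
have z1 := disk_lt1 z; have z0 := normc_ge0 (dval z).
pose s := (1 + normc (dval z)) / 2; have s01 : 0 <= s < 1 by rewrite /s; apply/andP; split; lra.
have s0 : 0 < s by rewrite /s; lra.
exists s^-1; exists (1 - normc (dval z) / s)^-1.
  by rewrite invf_gt1 //; case/andP: s01.
have q01 : 0 <= normc (dval z) / s < 1.
  by rewrite divr_ge0 ?(ltW s0) //= ltr_pdivrMr // mul1r /s; lra.
move=> n; apply: le_trans (natr_geo_le n q01).
by rewrite /kernel_coef normcM normcX normc_conj normc_nat exprMn mulrA.
Qed.

Lemma kernelE z w : bergman_kernel z w = ps (kernel_coef z) (dval w).
Proof.
apply/esym/ps_eq; rewrite /bergman_kernel.
have zw : normc ((dval z)^*%C * dval w) < 1.
  rewrite normcM normc_conj; apply: le_lt_trans (disk_lt1 z).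
  by rewrite ler_piMr ?normc_ge0 // ltW // disk_lt1.
rewrite (_ : psum _ _ = fun N => \sum_(0 <= k < N) k.+1%:R * ((dval z)^*%C * dval w) ^+ k).
  exact: cto_geo2.
by apply/funext => N; apply: eq_bigr => k _; rewrite /kernel_coef exprMn mulrA.
Qed.

Lemma cbmeas_kernel z : cbmeas (bergman_kernel z).
Proof.
have [r [M r1 hM]] := kernel_psbnd z.
rewrite (_ : bergman_kernel z = fun w => ps (kernel_coef z) (dval w)); first exact: cbmeas_ps r1 hM.
by apply/funext => w; exact: kernelE.
Qed.

Lemma bmeas_sqr_normc (F : disk R -> C) : cbmeas F -> bmeas (fun w => normc (F w) ^+ 2).
Proof.
move=> [mF [M hM]]; split; first exact: measurable_sqr_normc.
exists (M ^+ 2) => w; rewrite ger0_norm ?sqr_ge0 //.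
by rewrite lerXn2r ?nnegrE ?normc_ge0 // (le_trans (normc_ge0 _) (hM w)).
Qed.

Lemma Re_conjc q : complex.Re q^*%C = complex.Re q.
Proof. by case: q. Qed.

Lemma ReM_nat n q : complex.Re (n%:R * q) = n%:R * complex.Re q.
Proof. by rewrite (_ : n%:R = (n%:R : R)%:C) ?ReM_real // rmorph_nat. Qed.

Lemma conj_kernel_coef z n : (kernel_coef z n)^*%C = n.+1%:R * dval z ^+ n.
Proof. by rewrite /kernel_coef rmorphM rmorphXn rmorph_nat /= conjcK. Qed.

Lemma conj_kernel z w : (bergman_kernel z w)^*%C = (1 - (dval w)^*%C * dval z) ^- 2.
Proof.
rewrite /bergman_kernel fmorphV rmorphXn rmorphB rmorph1 rmorphM /= conjcK.
by rewrite (mulrC (dval z)).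
Qed.

Section radial_kernel.
Variables (I : (disk R -> R) -> R) (rI : radial_functional I).
Let mom n : R := I (fun w => normc (dval w) ^+ (2 * n)).

Let cbmeas_term (b : C) n z :
  cbmeas (fun w => b * dval w ^+ n / (1 - (dval w)^*%C * dval z) ^+ 2).
Proof.
rewrite (_ : (fun _ => _) = fun w => b * dval w ^+ n * (bergman_kernel z w)^*%C).
  apply: cbmeasM; last exact/cbmeas_conj/cbmeas_kernel.
  by apply: cbmeasM; [exact: cbmeas_cst|exact: cbmeasX cbmeas_dval].
by apply/funext => w; rewrite conj_kernel.
Qed.

Lemma rf_monomial_kernel (b : C) n z :
  I (fun w => complex.Re (b * dval w ^+ n / (1 - (dval w)^*%C * dval z) ^+ 2)) =
  complex.Re ((n.+1%:R * mom n)%:C * (b * dval z ^+ n)).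
Proof.
have [r [M r1 hM]] := kernel_psbnd z.
have h := rf_coef rI n r1 (psbndZ b^*%C hM).
have e : complex.Re (b^*%C * kernel_coef z n) * mom n =
    complex.Re ((n.+1%:R * mom n)%:C * (b * dval z ^+ n)).
  rewrite -[in LHS]Re_conjc conjcM conjcK conj_kernel_coef ReM_real mulrCA ReM_nat; ring.
rewrite -e -h; congr I; apply/funext => w.
rewrite (psZ _ hM) ?(lt_trans (disk_lt1 w)) // -kernelE -[RHS]Re_conjc 2!conjcM !conjcK.
by rewrite conj_kernel mulrAC.
Qed.

(** The conjugate kernel pairs each monomial with its own power only, so the defining
    integral of a Toeplitz operator acts on coefficients one by one. *)
Lemma rf_toeplitz (p : {poly C}) z :
  let F w := p.[dval w] / (1 - (dval w)^*%C * dval z) ^+ 2 in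
  I (fun w => complex.Re (F w)) +i* I (fun w => complex.Im (F w)) =
  (\poly_(n < size p) ((n.+1%:R * mom n)%:C * p`_n)).[dval z].
Proof.
move=> F; set X := _.[_].
have key (u : C) : I (fun w => complex.Re (u * F w)) = complex.Re (u * X).
  transitivity (I (fun w => complex.Re (\sum_(0 <= n < size p)
      u * p`_n * dval w ^+ n / (1 - (dval w)^*%C * dval z) ^+ 2))).
    congr I; apply/funext => w; rewrite /F horner_coef mulrA mulr_sumr mulr_suml big_mkord.
    by congr complex.Re; apply: eq_bigr => n _; rewrite !mulrA.
  rewrite (rf_Re_sum rI); last by move=> n; exact: cbmeas_term.
  rewrite /X horner_poly mulr_sumr Re_sum big_mkord; apply: eq_bigr => n _.
  by rewrite rf_monomial_kernel; congr complex.Re; ring.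
have ImE (x : C) : complex.Im x = complex.Re (- 'i%C * x).
  by case: x => a b /=; ring.
apply/eqP; rewrite eq_complex /=; apply/andP; split; apply/eqP.
  have := key 1; rewrite mul1r => <-; congr I; apply/funext => w; by rewrite mul1r.
rewrite ImE -key; congr I; apply/funext => w; exact: ImE.
Qed.

(** Parseval's identity for the Bergman kernel at z, as a series in |z|^2. *)
Lemma rf_kernel z :
  (fun N => \sum_(0 <= n < N) n.+1%:R * (n.+1%:R * mom n) * (normc (dval z) ^+ 2) ^+ n)
  @ \oo --> I (fun w => normc (bergman_kernel z w) ^+ 2).
Proof.
have [r [M r1 hM]] := kernel_psbnd z.
have h := rf_parseval rI r1 hM.
rewrite (_ : (fun w => _) = fun w => normc (ps (kernel_coef z) (dval w)) ^+ 2).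
  rewrite (_ : (fun N => _) = fun N => \sum_(0 <= k < N) normc (kernel_coef z k) ^+ 2 * mom k).
    exact: h.
  apply/funext => N; apply: eq_bigr => k _.
  rewrite /kernel_coef normcM normcX normc_conj normc_nat -exprM exprMn -exprM mulnC; ring.
by apply/funext => w; rewrite kernelE.
Qed.

End radial_kernel.

Lemma kernel_norm z : L2norm (bergman_kernel z) ^+ 2 = c * (1 - normc (dval z) ^+ 2) ^- 2.
Proof.
have x01 : 0 <= normc (dval z) ^+ 2 < 1.
  by rewrite sqr_ge0 expr_lt1 ?normc_ge0 // disk_lt1.
have h := rf_kernel (@area_radial R) (z := z).
rewrite sqr_sqrtr; last by apply: Rintegral_ge0 => w _; rewrite sqr_ge0.
apply: (cvg_unique (@Rhausdorff R) h).
rewrite (_ : (fun N => _) = fun N => c * \sum_(0 <= n < N) n.+1%:R * 1 * (normc (dval z) ^+ 2) ^+ n).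
  by apply: cvgM; [exact: cvg_cst|exact: abel_sum1].
apply/funext => N; rewrite mulr_sumr; apply: eq_bigr => n _; rewrite area_moment.
rewrite (mulrC _ (c / _)) divfK ?pnatr_eq0 // mulr1; ring.
Qed.

End kernel_series.

(** * Toeplitz operators and Berezin transforms of radial charges *)

Section radial_toeplitz.
Context {R : realType}.
Local Notation C := R[i].
Local Notation c := (@area R).
Variable mu : charge (disk R) R.
Hypotheses (mu_radial : radial mu) (mu_carleson : carleson (total_variation_measure mu)).
Let lam n : C := (toeplitz_eigenvalue mu n)%:C.

Let lamB : exists B : R, forall n, normc (lam n) <= B.
Proof.
have [B hB] := toeplitz_eigenvalue_bounded mu_carleson.
by exists B => n; rewrite normc_real.
Qed.

Lemma toeplitz_poly (p : {poly C}) (z : disk R) :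
  charge_cintegral mu (fun w => p.[dval w] / (1 - (dval w)^*%C * dval z) ^+ 2) =
  bergman_poly (\poly_(n < size p) (lam n * p`_n)) z.
Proof. exact: (rf_toeplitz (charge_integral_radial mu_radial) p z). Qed.

Lemma toeplitz_extension_diag : toeplitz_extension mu (diag_op lamB).
Proof.
split.
  by have [B hB] := lamB; exact: diagonal_bounded hB (diag_opP lamB).
move=> p z; rewrite toeplitz_poly; congr (bfun _ z); apply: coef_inj; apply/funext => n.
rewrite diag_opP !coef_bergman_poly coef_poly; case: ltnP => // sp.
by rewrite nth_default // mulr0.
Qed.

Lemma toeplitzP : toeplitz_extension mu (toeplitz mu).
Proof.
rewrite /toeplitz; case: pselect => [h|[]]; first by case: cid.
by exists (diag_op lamB); exact: toeplitz_extension_diag.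
Qed.

(** On polynomials this is [toeplitz_poly]; [diagonal_of_poly] extends it. *)
Lemma toeplitz_diagonal : is_diagonal (toeplitz mu) lam.
Proof.
have [bT hT] := toeplitzP; apply: diagonal_of_poly bT _ => p n.
rewrite (_ : toeplitz mu (bergman_poly p) = bergman_poly (\poly_(n < size p) (lam n * p`_n))).
  rewrite coef_bergman_poly coef_poly; case: ltnP => // sp.
  by rewrite nth_default // mulr0.
by apply: bergman_ext => z; rewrite hT toeplitz_poly.
Qed.

Lemma berezinE (z : disk R) : berezin mu z =
  c^-1 * (1 - normc (dval z) ^+ 2) ^+ 2 * charge_integral mu (fun w => normc (bergman_kernel z w) ^+ 2).
Proof.
have rI := charge_integral_radial mu_radial.
rewrite -(rfZ rI); last exact/bmeas_sqr_normc/cbmeas_kernel.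
congr charge_integral; apply/funext => w.
have -> : c^-1 * (1 - normc (dval z) ^+ 2) ^+ 2 = (L2norm (bergman_kernel z) ^+ 2)^-1.
  by rewrite kernel_norm invfM invrK.
rewrite /normalized_kernel normcM (normcV (L2norm _)%:C) normc_real exprMn mulrC; congr (_ * _).
by rewrite exprVn real_normK ?num_real.
Qed.

(** With x = |z|^2, [berezinE] and [rf_kernel] exhibit the Berezin transform at z as
    (1 - x)^2 sum (n+1) lam_n x^n, up to the factor [area]: the Tauberian theorem
    applies. *)
Lemma toeplitz_eigenvalue_cvg (L : R) : berezin mu @ near_circle --> L ->
  toeplitz_eigenvalue mu @ \oo --> c * L.
Proof.
move=> bL; have c0 : 0 < c := area_gt0.
have [B hB] := toeplitz_eigenvalue_bounded mu_carleson.
have [D hD] := toeplitz_eigenvalue_slow mu_radial mu_carleson.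
pose pt (x : R) : disk R := insubd (point : disk R) (Num.sqrt x)%:C.
have npt x : 0 <= x < 1 -> normc (dval (pt x)) ^+ 2 = x.
  move=> /andP[x0 x1]; rewrite /pt insubdK.
    by rewrite normc_real real_normK ?num_real // sqr_sqrtr.
  rewrite unfold_in normc_real ger0_norm ?sqrtr_ge0 //.
  by rewrite -(@ltr_pXn2r _ 2) ?nnegrE ?sqrtr_ge0 // sqr_sqrtr // expr1n.
pose g x := charge_integral mu (fun w => normc (bergman_kernel (pt x) w) ^+ 2).
apply: (abel_tauberian hB hD (g := g)).
  move=> x x01; have h := rf_kernel (charge_integral_radial mu_radial) (z := pt x).
  by rewrite npt // in h.
move=> e e0; have ec : 0 < e / c by rewrite divr_gt0.
have [r r1 hr] : exists2 r : R, r < 1 & forall z : disk R, r < normc (dval z) -> `|berezin mu z - L| <= e / c.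
  have /cvgrPdist_le/(_ _ ec) [r r1 hr] := bL; exists r => // z rz.
  by rewrite distrC; exact: hr.
exists (Num.min (1 - r) 1); first by rewrite lt_min subr_gt0 r1 ltr01.
move=> x /andP[x0 x1].
have [xr x00] : r < x /\ 0 < x.
  have m1 : Num.min (1 - r) 1 <= 1 - r by rewrite ge_min lexx.
  have m2 : Num.min (1 - r) 1 <= 1 by rewrite ge_min lexx orbT.
  by split; lra.
have x01 : 0 <= x < 1 by rewrite ltW.
have rn : r < normc (dval (pt x)).
  apply: lt_le_trans xr _; rewrite -{1}(npt x x01) expr2 ler_piMr ?normc_ge0 //.
  exact/ltW/disk_lt1.
have := hr _ rn; rewrite berezinE npt // -/(g x) => h.
have -> : (1 - x) ^+ 2 * g x - c * L = c * (c^-1 * (1 - x) ^+ 2 * g x - L).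
  by field; rewrite gt_eqF.
by rewrite normrM gtr0_norm // mulrC -ler_pdivlMr.
Qed.

End radial_toeplitz.

Close Scope complex_scope.

Theorem theorem9 (R : realType) (mu : charge (disk R) R)
    (mu_radial : radial mu)
    (mu_carleson : carleson (total_variation_measure mu))
    (L : R) (berezin_cvg : berezin mu @ near_circle --> L) :
  essentially_positive (toeplitz mu) <-> 0 <= L.
Proof.
set c := @area R; have c0 : 0 < c := area_gt0.
have dT := toeplitz_diagonal mu_radial mu_carleson.
have lamL := toeplitz_eigenvalue_cvg mu_radial mu_carleson berezin_cvg.
have dl l : is_diagonal (toeplitz mu \- l \*: idfun)
    (fun n => (toeplitz_eigenvalue mu n)%:C%C - l).
  by move=> f n; rewrite mulrBl -dT -coefZ -coefB.
have cl l : cto (fun n => (toeplitz_eigenvalue mu n)%:C%C - l) ((c * L)%:C%C - l).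
  apply: cvg0_of_bound => e e0; have [N hN] := cvg0_bound (cvg_subr0_seq lamL) e0.
  exists N => n Nn; rewrite opprB addrA subrK -rmorphB normc_real normr_id.
  exact/ltW/hN.
(* The diagonal of T - l tends to cL - l: the essential spectrum is {cL}. *)
split=> [[_ _ spec]|L0].
  have : ess_spectrum (toeplitz mu) (c * L)%:C%C.
    by apply: not_fredholm_diagonal (dl _) _; rewrite -(subrr ((c * L)%:C%C)); exact: cl.
  by move=> /spec /=; rewrite lecR pmulr_rge0.
split.
- exact: (toeplitzP mu_radial mu_carleson).1.
- exact: diagonal_selfadjoint dT.
move=> l nf; suff -> : l = (c * L)%:C%C by rewrite /= lecR mulr_ge0 // ltW.
apply: contrapT => /eqP ll; apply: nf.
have e0 : 0 < Normc.normc ((c * L)%:C%C - l) / 2.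
  by rewrite divr_gt0 // lt_neqAle normc_ge0 eq_sym normc_eq0 subr_eq0 eq_sym ll.
have [N hN] := cvg0_bound (cl l) e0.
apply: (fredholm_diagonal (N := N) (dl l) e0) => n Nn.
have := hN n Nn; rewrite ger0_norm ?normc_ge0 //.
have := dist_normc ((toeplitz_eigenvalue mu n)%:C%C - l) ((c * L)%:C%C - l).
by rewrite ler_norml => /andP[+ _]; lra.
Qed.
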